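(* There exists a constant $C>0$ such that for all dominant weights $\mu\in\Lambda^+$ of $G=\mathrm{SU}(3)$ and all $H\in\mathfrak{t}$, $$|\chi(\mu,H)|\leq C\sum_{s\in W}\ \prod_{\alpha\in\Phi^+}\min\left\{|\langle s(\mu+\rho),\alpha\rangle|,\ \left|\sin\left(\frac{\alpha(H)}{2i}\right)\right|^{-1}\right\}.$$
   Context: $G=\mathrm{SU}(3)$, $T$ is a maximal torus of $G$ with Lie algebra $\mathfrak{t}$, and $\mathfrak{t}^*$ is the real dual of $\mathfrak{t}$. Roots and weights are regarded as elements of $i\mathfrak{t}^*$ (so $\alpha(H)/i\in\mathbb{R}$ for a root $\alpha$ and $H\in\mathfrak{t}$). $\Phi^+\subset i\mathfrak{t}^*$ is a fixed positive root system (it has three elements), $\rho$ is the half sum of the positive roots, $W$ is the Weyl group, $\langle\cdot,\cdot\rangle$ is a fixed $W$-invariant inner product on $i\mathfrak{t}^*$, and $\Lambda^+\subset i\mathfrak{t}^*$ is the set of dominant weights. For $\mu\in\Lambda^+$, $\chi_\mu:G\to\mathbb{C}$ is the character of the irreducible representation of $G$ with highest weight $\mu$, and $\chi(\mu,H):=\chi_\mu(\exp H)$ for $H\in\mathfrak{t}$. Convention: $0^{-1}=+\infty$, so that $\min\{x,0^{-1}\}=x$. *)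

(* Defs.v *)
From HB Require Import structures.
From mathcomp Require Import all_boot all_order all_algebra.
From mathcomp Require Export complex.
From mathcomp Require Import all_classical all_reals all_analysis.

Set Implicit Arguments.
Unset Strict Implicit.
Unset Printing Implicit Defensive.

Import Order.TTheory GRing.Theory Num.Theory.
Import numFieldNormedType.Exports.

Local Open Scope classical_set_scope.
Local Open Scope ring_scope.
Local Open Scope complex_scope.

(* R[i] with the topology of its norm; MathComp-Analysis only provides it for
   abstract numeric fields and for regular algebras. *)
HB.instance Definition _ (R : realType) := GRing.ComAlgebra.copy R[i] (R[i]^o).
HB.instance Definition _ (R : realType) := Vector.copy R[i] (R[i]^o).
HB.instance Definition _ (R : realType) := NormedModule.copy R[i] (R[i]^o).

Section SU3.
Variable R : realType.

Local Notation M3 := ('M[R[i]]_3).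

Definition expM (X : M3) : M3 :=
  lim (series (fun k => (k`!%:R)^-1 *: X ^+ k) @ \oo).

(* e^{i theta} *)
Definition cis (theta : R) : R[i] := cos theta +i* sin theta.

Definition SU3 : set M3 := [set A | A \is unitarymx /\ \det A = 1].

Definition torus (T : set M3) : Prop :=
  [/\ T `<=` SU3, compact T & connected T] /\
  [/\ T 1%:M,
      forall a b, T a -> T b -> T (a *m b),
      forall a, T a -> T (invmx a) &
      forall a b, T a -> T b -> a *m b = b *m a].

Definition maximal_torus (T : set M3) : Prop :=
  torus T /\ forall S, torus S -> T `<=` S -> S = T.

Section Torus.
Variable T : set M3.

Definition lie_algebra : set M3 :=
  [set X | forall x : R, T (expM (x%:C *: X))].

(* The Lie algebra t of T is a real subspace of M3.  An element lambda of
   i t^* is represented by the real functional H |-> lambda(H) / i on t,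
   extended by 0 outside t so that equality in i t^* is Leibniz equality;
   sums and real multiples in i t^* are then the pointwise ones. *)
Definition idual : set (M3 -> R) :=
  [set f | [/\ forall X Y, lie_algebra X -> lie_algebra Y ->
                 f (X + Y) = f X + f Y,
               forall (x : R) X, lie_algebra X -> f (x%:C *: X) = x * f X &
               forall X, ~ lie_algebra X -> f X = 0]].

(* The complexification of su(3) is sl_3, the complex matrices of trace 0;
   the root condition reads [H, X] = alpha(H) X. *)
Definition root : set (M3 -> R) :=
  [set alpha | [/\ idual alpha, alpha <> 0 &
     exists X : M3, [/\ X != 0, \tr X = 0 &
       forall H, lie_algebra H ->
         H *m X - X *m H = ('i * (alpha H)%:C) *: X]]].

Definition positive_system (Phi : set (M3 -> R)) : Prop :=
  [/\ Phi `<=` root,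
      forall alpha, root alpha -> Phi alpha \/ Phi (- alpha),
      forall alpha, Phi alpha -> ~ Phi (- alpha) &
      forall alpha beta, Phi alpha -> Phi beta -> root (alpha + beta) ->
        Phi (alpha + beta)].

Definition half_sum (Phi : set (M3 -> R)) : M3 -> R :=
  2^-1 *: \sum_(alpha \in Phi) alpha.

Definition normalizes (g : M3) : Prop :=
  [set invmx g *m a *m g | a in T] = T.

(* (Ad^*(g) f)(H) = f(Ad(g^-1) H) for H in t. *)
Definition coadjoint (g : M3) (f : M3 -> R) : M3 -> R :=
  patch (fun=> 0) lie_algebra (fun H => f (invmx g *m H *m g)).

(* N_G(T) / T, as the set of the transformations it induces on i t^*; the
   truncation to t in coadjoint makes elements of N_G(T) that agree modulo T
   induce the same one. *)
Definition weyl_group : set ((M3 -> R) -> (M3 -> R)) :=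
  [set s | exists g, [/\ SU3 g, normalizes g & s = coadjoint g]].

Definition weyl_inner_product (ip : (M3 -> R) -> (M3 -> R) -> R) : Prop :=
  [/\ forall (x : R) a b c, idual a -> idual b -> idual c ->
        ip (x *: a + b) c = x * ip a c + ip b c,
      forall a b, idual a -> idual b -> ip a b = ip b a,
      forall a, idual a -> a <> 0 -> 0 < ip a a &
      forall s a b, weyl_group s -> idual a -> idual b ->
        ip (s a) (s b) = ip a b].

(* The differentials of the characters of T: lambda in i t^* with
   lambda(H) in 2 pi i Z whenever exp H = 1. *)
Definition integral_weight (mu : M3 -> R) : Prop :=
  idual mu /\
  forall H, lie_algebra H -> expM H = 1%:M ->
    exists m : int, mu H = 2 * pi * m%:~R.

Definition dominant_weight (Phi : set (M3 -> R))
    (ip : (M3 -> R) -> (M3 -> R) -> R) (mu : M3 -> R) : Prop :=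
  integral_weight mu /\ forall alpha, Phi alpha -> 0 <= ip mu alpha.

End Torus.

(* A complex representation of SU(3) on C^n, acting on column vectors; only
   the values of sigma on SU3 matter. *)
Definition representation n (sigma : M3 -> 'M[R[i]]_n) : Prop :=
  [/\ {within SU3, continuous sigma},
      sigma 1%:M = 1%:M &
      forall a b, SU3 a -> SU3 b -> sigma (a *m b) = sigma a *m sigma b].

Definition irreducible n (sigma : M3 -> 'M[R[i]]_n) : Prop :=
  (0 < n)%N /\
  forall U : {vspace 'cV[R[i]]_n},
    (forall g v, SU3 g -> v \in U -> sigma g *m v \in U) ->
    U = 0%VS \/ U = fullv.

Definition weight_of (T : set M3) n (sigma : M3 -> 'M[R[i]]_n)
    (nu : M3 -> R) : Prop :=
  idual T nu /\
  exists2 v : 'cV[R[i]]_n, v != 0 &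
    forall H, lie_algebra T H -> sigma (expM H) *m v = cis (nu H) *: v.

Definition highest_weight (T : set M3) (Phi : set (M3 -> R))
    n (sigma : M3 -> 'M[R[i]]_n) (mu : M3 -> R) : Prop :=
  weight_of T sigma mu /\
  forall nu, weight_of T sigma nu ->
    exists c : (M3 -> R) -> nat,
      mu - nu = \sum_(alpha \in Phi) alpha *+ c alpha.

Definition character n (sigma : M3 -> 'M[R[i]]_n) (g : M3) : R[i] :=
  \tr (sigma g).

End SU3.

(* min {x, y^-1} with 0^-1 = +oo *)
Definition min_inv (R : realType) (x y : R) : R :=
  if y == 0 then x else Num.min x y^-1.

(* Main.v *)
(* The Weyl group acts on the maximal torus by permutations of the three
   eigenvalue angles t_0, t_1, t_2, so everything is computed on diagonal
   matrices.  Differentiating a representation along one-parameter subgroups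
   gives an sl_3-module; for a highest weight with Dynkin labels (p, q) it has a
   Gelfand-Tsetlin basis of eigenvectors of the torus, whence, up to a factor of
   modulus 1,
     chi = sum_(a <= p, b <= q) (r s)^a s^b sum_(j <= p - a + b) r^j,
   with r = e^{i(t_1 - t_0)} and s = e^{i(t_2 - t_1)}.  When |1 - r| is the
   smallest of |1 - r|, |1 - s|, |1 - r s|, this double sum of geometric sums is
   at most 4 min{p + q + 2, 2/|1 - r|} min{p + 1, 2/|1 - r s|}
   min{q + 1, 2/|1 - s|}: the long side p + q + 2 of the weight mu + rho is paired
   with the root on which H is the smallest.  Since chi is invariant under
   permutations of the angles, this case suffices, and the bound is a constant
   multiple of one single term of the sum over the Weyl group. *)

Require Import Defs.
From HB Require Import structures.
From mathcomp Require Import all_boot all_order all_algebra fingroup perm.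
From mathcomp Require Import complex.
From mathcomp Require Import all_classical all_reals all_analysis.
From mathcomp Require Import zify ring lra.

Set Implicit Arguments.
Unset Strict Implicit.
Unset Printing Implicit Defensive.

Import Order.TTheory GRing.Theory Num.Theory.
Import numFieldNormedType.Exports.

Local Open Scope classical_set_scope.
Local Open Scope ring_scope.
Local Open Scope complex_scope.

Import ComplexField.Normc.

(** A representation is only assumed continuous, so its differential has to be built. It is taken
    along the times 2^-k, where halving the time is taking a square root in the group: as long as f
    = sigma(exp(tX)) - 1 has norm at most 1/4, f(t) is half of f(2t) up to a quadratic error, and
    the difference quotients converge geometrically. Additivity comes from the Lie-Trotter formula,
    homogeneity from additivity and local boundedness, the bracket from differentiating drep(Ad(g)
    X) sigma(g) = sigma(g) drep(X). The Gelfand-Tsetlin vectors are joint eigenvectors spanning an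
    invariant subspace; irreducibility makes it the whole space, so the trace is the sum of their
    eigenvalues. In the double sum, minimality of |1 - r| makes |1 - s| and |1 - r s| agree up to a
    factor 2, so that bounds in s and in r s can be traded for one another. Invariance forces the
    inner product of a weight with the root (j, k) to be c (w_j - w_k) for one c > 0; the constant
    of the theorem is 4 / min(c, 1)^3. *)

Section Normc.
Variable R : realType.
Implicit Types x y : R[i].

Lemma normc_ge0 x : 0 <= normc x.
Proof. by case: x => a b; exact: sqrtr_ge0. Qed.

Lemma normcB x y : normc (x - y) <= normc x + normc y.
Proof. by rewrite (le_trans (le_normcD _ _)) // normcN. Qed.

Lemma normcX x n : normc (x ^+ n) = normc x ^+ n.
Proof.
elim: n => [|n IH]; first by rewrite !expr0 normc1.
by rewrite !exprS normcM IH.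
Qed.

Lemma normc_sum (I : Type) (s : seq I) (G : I -> R[i]) :
  normc (\sum_(i <- s) G i) <= \sum_(i <- s) normc (G i).
Proof.
elim/big_ind2: _ => //; first by rewrite normc0.
by move=> a b c d ab cd; rewrite (le_trans (le_normcD _ _)) // lerD.
Qed.

End Normc.

(** * The bound for sums of weights *)

Section MinInv.
Variable R : realType.
Implicit Types x y z : R.

(** A division-free characterisation: for y = 0 the second condition is vacuous, which is the
    convention 0^-1 = +oo. *)
Lemma le_min_inv z x y : 0 <= y -> (z <= min_inv x y) = (z <= x) && (z * y <= 1).
Proof.
rewrite /min_inv; case: eqVneq => [-> _|y0 yge]; first by rewrite mulr0 ler01 andbT.
have ypos : 0 < y by rewrite lt_def y0.
by rewrite le_min -[y^-1]mul1r ler_pdivlMr.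
Qed.

Lemma min_inv_ge0 x y : 0 <= x -> 0 <= y -> 0 <= min_inv x y.
Proof. by move=> x0 y0; rewrite le_min_inv // x0 mul0r ler01. Qed.

Lemma min_inv_lel x y : 0 <= y -> min_inv x y <= x.
Proof. by move=> y0; have := lexx (min_inv x y); rewrite le_min_inv // => /andP[]. Qed.

Lemma min_inv_mul_le1 x y : 0 <= y -> min_inv x y * y <= 1.
Proof. by move=> y0; have := lexx (min_inv x y); rewrite le_min_inv // => /andP[]. Qed.

Lemma min_inv_scale c x y : 0 <= c <= 1 -> 0 <= x -> 0 <= y ->
  c * min_inv x y <= min_inv (c * x) y.
Proof.
move=> /andP[c0 c1] x0 y0; rewrite le_min_inv // ler_wpM2l ?min_inv_lel //=.
by rewrite -mulrA mulr_ile1 ?min_inv_mul_le1 // mulr_ge0 ?min_inv_ge0.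
Qed.

Lemma min_inv_homo x x' y : x <= x' -> 0 <= y -> min_inv x y <= min_inv x' y.
Proof.
move=> xx y0; rewrite le_min_inv // min_inv_mul_le1 // andbT.
by rewrite (le_trans (min_inv_lel _ _)).
Qed.

Lemma min_inv_double x y y' : 0 <= x -> 0 <= y -> 0 <= y' -> y' <= 2 * y ->
  min_inv x y <= 2 * min_inv x y'.
Proof.
move=> x0 y0 y'0 yy; rewrite mulrC -ler_pdivrMr ?ltr0n // le_min_inv //.
have m0 := min_inv_ge0 x0 y0; have m1 := min_inv_mul_le1 x y0.
have := min_inv_lel x y0; move: (min_inv x y) m0 m1 => m m0 m1 mx.
by apply/andP; split; nra.
Qed.

(** Lets a bound by a minimum times [P] be assembled from two independent estimates, one for each
    argument of the minimum. *)
Lemma le_mul_min_inv z P x y : 0 <= P -> 0 <= y -> z <= x * P -> z * y <= P ->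
  z <= min_inv x y * P.
Proof.
move=> P0 y0 zx zy; rewrite /min_inv; case: eqVneq => // yn0.
have yp : 0 < y by rewrite lt_def yn0.
by rewrite minEle; case: ifP => // _; rewrite mulrC ler_pdivlMr.
Qed.

End MinInv.

Section WeightSum.
Variable R : realType.
Implicit Types r s x : R[i].

Definition geom x m := \sum_(0 <= i < m) x ^+ i.

Lemma geom0 x : geom x 0 = 0. Proof. by rewrite /geom big_geq. Qed.

Lemma geomS x m : geom x m.+1 = geom x m + x ^+ m.
Proof. by rewrite /geom big_nat_recr. Qed.

Lemma geomSl x m : geom x m.+1 = 1 + x * geom x m.
Proof. by elim: m => [|m IH]; [rewrite geomS !geom0 mulr0 addrC|
  rewrite geomS {1}IH geomS mulrDr addrA exprS]. Qed.

Lemma geomD x m n : geom x (m + n) = geom x m + x ^+ m * geom x n.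
Proof.
elim: n => [|n IH]; first by rewrite addn0 geom0 mulr0 addr0.
by rewrite addnS !geomS IH mulrDr addrA exprD.
Qed.

Lemma geom_mul x m : (1 - x) * geom x m = 1 - x ^+ m.
Proof.
elim: m => [|m IH]; first by rewrite geom0 mulr0 expr0 subrr.
by rewrite geomS mulrDr IH exprS; ring.
Qed.

Lemma normc_geom x m : normc x = 1 ->
  normc (geom x m) <= min_inv m%:R (normc (1 - x) / 2).
Proof.
move=> x1; rewrite le_min_inv ?divr_ge0 ?normc_ge0 //; apply/andP; split.
  elim: m => [|m IH]; first by rewrite geom0 normc0.
  rewrite geomS (le_trans (le_normcD _ _)) // normcX x1 expr1n -natr1.
  by rewrite lerD2r.
rewrite mulrA ler_pdivrMr // mul1r mulrC -normcM geom_mul.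
by rewrite (le_trans (normcB _ _)) // normc1 normcX x1 expr1n.
Qed.

(* The character of weight (p, q), divided by its highest weight, where
   r, s are the values of the opposite simple roots. *)
Definition weight_sum r s p q :=
  \sum_(0 <= a < p.+1) \sum_(0 <= b < q.+1)
    (r * s) ^+ a * s ^+ b * geom r (p - a + b).+1.

(** Summing the innermost geometric series in closed form makes the double sum factor. This form is
    efficient when r is away from 1. *)
Lemma weight_sum_mul r s p q : (1 - r) * weight_sum r s p q =
  geom (r * s) p.+1 * geom s q.+1
    - r ^+ p.+1 * (geom s p.+1 * geom (r * s) q.+1).
Proof.
rewrite /weight_sum {1 3}/geom !big_distrl /= !big_distrr -sumrB /=.
apply: eq_big_nat => a /andP[_ ap].
rewrite /geom !big_distrr -sumrB /=; apply: eq_bigr => b _.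
rewrite -/(geom r _) mulrCA geom_mul mulrBr mulr1; congr (_ - _).
rewrite !exprMn.
transitivity (r ^+ (a + (p - a + b).+1) * s ^+ a * s ^+ b).
  by rewrite exprD; ring.
by rewrite (_ : a + _ = p.+1 + b)%N; [rewrite exprD; ring | lia].
Qed.

(** The difference quotient (geom s m - geom (r s) m) / (1 - r), written without division so that it
    makes sense at r = 1. *)
Definition geom_conv r s m := \sum_(0 <= a < m) s ^+ a * geom r a.

(** The quotient of [weight_sum_mul] by 1 - r with no division left: every summand is bounded by p +
    1 or q + 1 times bounds for two geometric sums in s, also for r near 1. *)
Lemma weight_sumE r s p q : weight_sum r s p q =
  geom r p.+1 * (geom s p.+1 * geom s q.+1)
  + r ^+ p.+1 * (geom s p.+1 * geom_conv r s q.+1)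
  - geom s q.+1 * geom_conv r s p.+1.
Proof.
have conv (c : R[i]) (u w : nat -> R[i]) m n :
    c * ((\sum_(0 <= a < m) u a) * (\sum_(0 <= b < n) w b)) =
    \sum_(0 <= a < m) \sum_(0 <= b < n) c * (u a * w b).
  rewrite big_distrlr big_distrr; apply: eq_bigr => a _.
  by rewrite big_distrr.
rewrite [geom s q.+1 * _]mulrC -[geom_conv r s p.+1 * _]mul1r !conv.
rewrite -big_split -sumrB /=; apply: eq_big_nat => a /andP[_ ap].
rewrite -big_split -sumrB /=; apply: eq_bigr => b _.
(* The powers from r^a to r^(p+b) are those below r^(p+b+1) minus those below r^a, and the former
   are split at r^(p+1). *)
have E : r ^+ a * geom r (p - a + b).+1
    = geom r p.+1 + r ^+ p.+1 * geom r b - geom r a.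
  rewrite -geomD (_ : p.+1 + b = a + (p - a + b).+1)%N; last by lia.
  by rewrite geomD addrC addKr.
transitivity (s ^+ a * s ^+ b * (r ^+ a * geom r (p - a + b).+1)).
  by rewrite exprMn; ring.
by rewrite E; ring.
Qed.

Lemma normc_geom_conv r s m (g : R) : normc r = 1 -> normc s = 1 ->
  (forall k, (k <= m)%N -> normc (geom s k) <= g) ->
  normc (geom_conv r s m) <= m%:R * g.
Proof.
move=> r1 s1; elim: m => [|m IH] sg; first by rewrite /geom_conv big_geq // normc0 mul0r.
(* Peeling the constant term off every inner sum: each step costs one geometric sum in s, of norm at
   most [g]. *)
have -> : geom_conv r s m.+1 = s * geom s m + r * s * geom_conv r s m.
  rewrite /geom_conv big_nat_recl // geom0 mulr0 add0r /geom !big_distrr.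
  rewrite -big_split /=; apply: eq_bigr => a _.
  by rewrite -/(geom r a) -/(geom r a.+1) geomSl exprS; ring.
rewrite (le_trans (le_normcD _ _)) // !normcM r1 s1 !mul1r -natr1 mulrDl mul1r.
by rewrite addrC lerD ?sg // IH // => k km; rewrite sg // ltnW.
Qed.

Lemma normc_weight_sum r s p q : normc r = 1 -> normc s = 1 ->
  normc (1 - r) <= normc (1 - r * s) -> normc (1 - r) <= normc (1 - s) ->
  normc (weight_sum r s p q) <=
  4 * (min_inv (p.+1 + q.+1)%:R (normc (1 - r) / 2)
       * (min_inv p.+1%:R (normc (1 - r * s) / 2)
       * min_inv q.+1%:R (normc (1 - s) / 2))).
Proof.
move=> r1 s1 d13 d23.
have t1 : normc (r * s) = 1 by rewrite normcM r1 s1 mulr1.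
have d0 x : 0 <= normc (1 - x) / 2 by rewrite divr_ge0 // normc_ge0.
pose g m x := min_inv m%:R (normc (1 - x) / 2) : R.
have g0 m x : 0 <= g m x by rewrite min_inv_ge0.
have gG m x : normc x = 1 -> normc (geom x m) <= g m x by exact: normc_geom.
(* As |1 - r| is the smallest of the three chords, the other two agree up to a factor 2; bounds for
   geometric sums in s and in r s of equal length are then interchangeable at the cost of 2. *)
have tri1 : normc (1 - r * s) <= 2 * normc (1 - s).
  have -> : 1 - r * s = (1 - s) + s * (1 - r) by ring.
  by rewrite (le_trans (le_normcD _ _)) // normcM s1 mul1r mulr_natl mulr2n lerD2l.
have tri2 : normc (1 - s) <= 2 * normc (1 - r * s).
  have -> : 1 - s = (1 - r * s) - s * (1 - r) by ring.
  by rewrite (le_trans (normcB _ _)) // normcM s1 mul1r mulr_natl mulr2n lerD2l.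
have gs m : g m s <= 2 * g m (r * s) by apply: min_inv_double => //; lra.
have gt m : g m (r * s) <= 2 * g m s by apply: min_inv_double => //; lra.
set P := _ * min_inv q.+1%:R _.
have P0 : 0 <= P by rewrite /P mulr_ge0 ?min_inv_ge0.
(* Estimate for the inverse chord. The two products total at most P + 4 P = 5 P, within the 8 P
   allowed after clearing the denominator 2. *)
have z1 : normc (weight_sum r s p q) * (normc (1 - r) / 2) <= 4 * P.
  rewrite mulrA ler_pdivrMr // mulrC -normcM weight_sum_mul.
  apply: le_trans (normcB _ _) _; rewrite !normcM normcX r1 expr1n mul1r.
  have h1 : normc (geom (r * s) p.+1) * normc (geom s q.+1) <= P.
    by apply: ler_pM; rewrite ?normc_ge0 // gG.
  have h2 : normc (geom s p.+1) * normc (geom (r * s) q.+1)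
      <= (2 * g p.+1 (r * s)) * (2 * g q.+1 s).
    by apply: ler_pM; rewrite ?normc_ge0 // (le_trans (gG _ _ _)).
  have {h2} : normc (geom s p.+1) * normc (geom (r * s) q.+1) <= 4 * P.
    by rewrite (le_trans h2) // /P /g; lra.
  lra.
have gk m k : (k <= m)%N -> normc (geom s k) <= g m s.
  move=> km; rewrite (le_trans (gG _ _ _)) //; apply: min_inv_homo => //.
  by rewrite ler_nat.
(* Estimate for the side p + q + 2. The length p + 1 occurs twice, q + 1 once, and passing from s to
   r s in one factor costs 2: this is the origin of the constant 4. *)
have z2 : normc (weight_sum r s p q) <= (p.+1 + q.+1)%:R * (4 * P).
  rewrite weight_sumE; apply: le_trans (normcB _ _) _.
  apply: (@le_trans _ _ (p.+1%:R * (g p.+1 s * g q.+1 s)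
     + (g p.+1 s * (q.+1%:R * g q.+1 s)) + g q.+1 s * (p.+1%:R * g p.+1 s))).
    apply: lerD.
      apply: le_trans (le_normcD _ _) _; rewrite !normcM normcX r1 expr1n mul1r.
      apply: lerD; apply: ler_pM; rewrite ?mulr_ge0 ?normc_ge0 ?gk //.
      - by rewrite (le_trans (gG _ _ r1)) // min_inv_lel.
      - by apply: ler_pM; rewrite ?normc_ge0 // gk.
      - by apply: normc_geom_conv => // k; exact: gk.
    rewrite normcM; apply: ler_pM; rewrite ?normc_ge0 ?gk //.
    by apply: normc_geom_conv => // k; exact: gk.
  have gsP : g p.+1 s * g q.+1 s <= 2 * P.
    by rewrite mulrA; apply: ler_pM => //; exact: gs.
  rewrite natrD; have p0 : 0 <= p.+1%:R :> R by []; have q0 : 0 <= q.+1%:R :> R by [].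
  have e0 : 0 <= g p.+1 s * g q.+1 s by rewrite mulr_ge0.
  move: (_%:R) (_%:R) p0 q0 => A B A0 B0; nra.
rewrite mulrCA; apply: le_mul_min_inv => //; exact: mulr_ge0.
Qed.

End WeightSum.

(** * Convergence of complex matrices *)

Section EntrywiseNorm.
Variable R : realType.

(** A real-valued submultiplicative norm: estimates of powers and of exponential series reduce to
    real series without constants. *)
Definition l1norm m n (A : 'M[R[i]]_(m, n)) : R := \sum_i \sum_j normc (A i j).

Section Basic.
Variables (m n : nat).
Implicit Types A B : 'M[R[i]]_(m, n).

Lemma l1norm_ge0 A : 0 <= l1norm A.
Proof. by apply: sumr_ge0 => i _; apply: sumr_ge0 => j _; exact: normc_ge0. Qed.

Lemma normc_le_l1norm A i j : normc (A i j) <= l1norm A.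
Proof.
rewrite /l1norm (bigD1 i) //= (bigD1 j) //= -addrA lerDl addr_ge0 //.
  by apply: sumr_ge0 => k _; exact: normc_ge0.
by apply: sumr_ge0 => k _; apply: sumr_ge0 => l _; exact: normc_ge0.
Qed.

Lemma l1norm0 : l1norm (0 : 'M[R[i]]_(m, n)) = 0.
Proof. by rewrite /l1norm big1 // => i _; rewrite big1 // => j _; rewrite mxE normc0. Qed.

Lemma l1norm_eq0 A : l1norm A = 0 -> A = 0.
Proof.
move=> A0; apply/matrixP => i j; rewrite mxE; apply: eq0_normc.
by apply/eqP; rewrite eq_le normc_ge0 andbT -A0 normc_le_l1norm.
Qed.

Lemma l1normD A B : l1norm (A + B) <= l1norm A + l1norm B.
Proof.
rewrite /l1norm -big_split /=; apply: ler_sum => i _.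
rewrite -big_split /=; apply: ler_sum => j _.
by rewrite mxE le_normcD.
Qed.

Lemma l1normZ c A : l1norm (c *: A) = normc c * l1norm A.
Proof.
rewrite /l1norm mulr_sumr; apply: eq_bigr => i _.
by rewrite mulr_sumr; apply: eq_bigr => j _; rewrite mxE normcM.
Qed.

Lemma l1normN A : l1norm (- A) = l1norm A.
Proof.
by rewrite /l1norm; do 2!apply: eq_bigr => ? _; rewrite mxE normcN.
Qed.

Lemma l1normB A B : l1norm (A - B) <= l1norm A + l1norm B.
Proof. by rewrite -[l1norm B]l1normN l1normD. Qed.

Lemma l1norm_distC A B : l1norm (A - B) = l1norm (B - A).
Proof. by rewrite -l1normN opprB. Qed.

Lemma l1norm_sum (I : Type) (s : seq I) (G : I -> 'M[R[i]]_(m, n)) :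
  l1norm (\sum_(i <- s) G i) <= \sum_(i <- s) l1norm (G i).
Proof.
elim/big_ind2: _ => //; first by rewrite l1norm0.
by move=> a b c d ab cd; rewrite (le_trans (l1normD _ _)) // lerD.
Qed.

Lemma nbhs_l1norm A (P : set 'M[R[i]]_(m, n)) :
  nbhs A P <-> exists2 e : R, 0 < e & forall B, l1norm (B - A) < e -> P B.
Proof.
split.
  case/nbhs_ballP => -[er ei]; rewrite /= ltcE /= => /andP[/eqP ei0 er0] eP.
  exists er => // B BA; apply: eP; split=> [|i j]; first by rewrite ltcE /= ei0 eqxx.
  rewrite -ball_normE /= normc_def ltcE /= ei0 eqxx /=.
  have := normc_le_l1norm (B - A) i j; rewrite !mxE -normcN opprB /=.
  case: (A i j - B i j) => a b /= h; exact: le_lt_trans h BA.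
case=> e e0 eP; apply/nbhs_ballP.
have mn0 : 0 < (m * n).+1%:R :> R by [].
exists (e / (m * n).+1%:R)%:C; first by rewrite /= ltcR divr_gt0.
move=> B AB; apply: eP.
apply: (@le_lt_trans _ _ (\sum_(i < m) \sum_(j < n) (e / (m * n).+1%:R))).
  apply: ler_sum => i _; apply: ler_sum => j _.
  have := AB.2 i j; rewrite -ball_normE /= normc_def ltcE /= eqxx /= => /ltW.
  rewrite !mxE -[in normc _]opprB normcN /=.
  by case: (A i j - B i j).
rewrite !sumr_const !card_ord -mulrnA -[_ *+ (_ * _)]mulr_natr mulrAC ltr_pdivrMr //.
by rewrite ltr_pM2l // ltr_nat mulnC ltnS.
Qed.

End Basic.

Lemma l1normM m n p (A : 'M[R[i]]_(m, n)) (B : 'M[R[i]]_(n, p)) :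
  l1norm (A *m B) <= l1norm A * l1norm B.
Proof.
rewrite /l1norm mulr_suml; apply: ler_sum => i _.
apply: (@le_trans _ _ (\sum_k \sum_j normc (A i j) * normc (B j k))).
  apply: ler_sum => k _; rewrite mxE (le_trans (normc_sum _ _)) //.
  by apply: ler_sum => j _; rewrite normcM.
rewrite exchange_big /= mulr_suml; apply: ler_sum => j _.
rewrite -mulr_sumr ler_wpM2l ?normc_ge0 // (bigD1 j) //= lerDl.
by apply: sumr_ge0 => k _; apply: sumr_ge0 => l _; exact: normc_ge0.
Qed.

End EntrywiseNorm.

Section SequencesOfMatrices.
Variable R : realType.

(** Convergence as a real null sequence, so that squeezing and limit arithmetic in [R] apply. *)
Definition l1cvg m n (u : nat -> 'M[R[i]]_(m, n)) (L : 'M[R[i]]_(m, n)) :=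
  l1norm (u k - L) @[k --> \oo] --> (0 : R).

Lemma l1cvg_squeeze m n (u : nat -> 'M[R[i]]_(m, n)) L (b : nat -> R) :
  (forall k, l1norm (u k - L) <= b k) -> b k @[k --> \oo] --> (0 : R) -> l1cvg u L.
Proof.
move=> ub b0; apply: squeeze_cvgr b0; last exact: cvg_cst.
by near=> k; rewrite l1norm_ge0 ub.
Unshelve. all: by end_near. Qed.

Lemma l1cvg_cst m n (L : 'M[R[i]]_(m, n)) : l1cvg (fun=> L) L.
Proof. by rewrite /l1cvg; under eq_fun do rewrite subrr l1norm0; exact: cvg_cst. Qed.

Lemma l1cvgD m n (u v : nat -> 'M[R[i]]_(m, n)) L M :
  l1cvg u L -> l1cvg v M -> l1cvg (fun k => u k + v k) (L + M).
Proof.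
move=> uL vM; apply: l1cvg_squeeze.
  by move=> k; rewrite opprD addrACA; exact: l1normD.
by rewrite -[0]addr0; exact: cvgD.
Qed.

Lemma l1cvgZ m n (u : nat -> 'M[R[i]]_(m, n)) L c :
  l1cvg u L -> l1cvg (fun k => c *: u k) (c *: L).
Proof.
move=> uL; apply: (l1cvg_squeeze (b := fun k => normc c * l1norm (u k - L))).
  by move=> k; rewrite -scalerBr l1normZ.
by rewrite -[0](mulr0 (normc c)); apply: cvgM => //; exact: cvg_cst.
Qed.

Lemma l1cvgN m n (u : nat -> 'M[R[i]]_(m, n)) L :
  l1cvg u L -> l1cvg (fun k => - u k) (- L).
Proof.
by move=> uL; rewrite /l1cvg; under eq_fun do rewrite -opprD l1normN.
Qed.

Lemma l1cvgB m n (u v : nat -> 'M[R[i]]_(m, n)) L M :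
  l1cvg u L -> l1cvg v M -> l1cvg (fun k => u k - v k) (L - M).
Proof. by move=> uL /l1cvgN; exact: l1cvgD. Qed.

Lemma l1cvgM m n p (u : nat -> 'M[R[i]]_(m, n)) (v : nat -> 'M[R[i]]_(n, p)) L M :
  l1cvg u L -> l1cvg v M -> l1cvg (fun k => u k *m v k) (L *m M).
Proof.
move=> uL vM.
apply: (l1cvg_squeeze (b := fun k =>
  l1norm (u k - L) * (l1norm (v k - M) + l1norm M) + l1norm L * l1norm (v k - M))).
  move=> k.
  have -> : u k *m v k - L *m M = (u k - L) *m v k + L *m (v k - M).
    by rewrite mulmxBl mulmxBr addrA subrK.
  apply: le_trans (l1normD _ _) (lerD _ _); last exact: l1normM.
  apply: le_trans (l1normM _ _) _; rewrite ler_wpM2l ?l1norm_ge0 //.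
  by rewrite -{1}[v k](subrK M) l1normD.
have -> : (0 : R) = 0 * (0 + l1norm M) + l1norm L * 0 by rewrite mul0r mulr0 addr0.
apply: cvgD; apply: cvgM => //; last exact: cvg_cst.
by apply: cvgD => //; exact: cvg_cst.
Qed.

Lemma l1cvg_bound m n (u : nat -> 'M[R[i]]_(m, n)) L A c (b : nat -> R) :
  l1cvg u L -> b k @[k --> \oo] --> c ->
  (\forall k \near \oo, l1norm (u k - A) <= b k) -> l1norm (L - A) <= c.
Proof.
move=> uL bc uc.
have h : l1norm (u k - L) + b k @[k --> \oo] --> c.
  by rewrite -[c]add0r; exact: cvgD.
apply: (cvgr_to_ge h); near=> k.
have -> : L - A = (u k - A) - (u k - L) by rewrite opprB [RHS]addrC addrA subrK.
apply: le_trans (l1normB _ _) _; rewrite addrC lerD2l.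
by near: k.
Unshelve. all: by end_near. Qed.

Lemma l1cvg_unique m n (u : nat -> 'M[R[i]]_(m, n)) L M :
  l1cvg u L -> l1cvg u M -> L = M.
Proof.
move=> uL uM; apply/eqP; rewrite -subr_eq0; apply/eqP/l1norm_eq0.
apply/eqP; rewrite eq_le l1norm_ge0 andbT.
by apply: (l1cvg_bound uL uM); near=> k.
Unshelve. all: by end_near. Qed.

Lemma l1cvg_shift m n (u : nat -> 'M[R[i]]_(m, n)) L p :
  l1cvg u L <-> l1cvg (fun k => u (k + p)%N) L.
Proof.
split; rewrite /l1cvg => uL; last by rewrite -(cvg_shiftn p).
by rewrite (cvg_shiftn p (fun k => l1norm (u k - L) : R^o)).
Qed.

Lemma cvg_sum0 (I : Type) (s : seq I) (f : nat -> I -> R) :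
  (forall i, f k i @[k --> \oo] --> (0 : R)) ->
  \sum_(i <- s) f k i @[k --> \oo] --> (0 : R).
Proof.
move=> f0; elim: s => [|i s IH].
  by under eq_fun do rewrite big_nil; exact: cvg_cst.
under eq_fun do rewrite big_cons.
have h : f k i + \sum_(j <- s) f k j @[k --> \oo] --> (0 + 0 : R) by exact: cvgD.
by rewrite addr0 in h.
Qed.

Lemma normc_le_ReIm (x y : R) : normc (x +i* y) <= `|x| + `|y|.
Proof.
have -> : x +i* y = x +i* 0 + 0 +i* y by simpc.
rewrite (le_trans (le_normcD _ _)) //= expr0n /= addr0 add0r.
by rewrite !sqrtr_sqr.
Qed.

(** Completeness in the form used below: increments dominated by a summable sequence make the real
    and imaginary parts absolutely convergent telescoping series. *)
Lemma complex_cvg_summable (z : nat -> R[i]) (a : nat -> R) :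
  (forall k, normc (z k.+1 - z k) <= a k) -> cvgn (series a) ->
  exists l, normc (z k - l) @[k --> \oo] --> (0 : R).
Proof.
move=> za ca.
have a0 k : 0 <= a k by apply: le_trans (za k); exact: normc_ge0.
have realcvg (x : nat -> R) : (forall k, `|x k.+1 - x k| <= a k) -> cvgn x.
  move=> xa; have : cvgn (series (fun k => x k.+1 - x k)).
    apply: normed_cvg; apply: series_le_cvg ca => // k /=; exact: normr_ge0.
  have xE : x = (fun k => x 0%N + series (fun k => x k.+1 - x k) k).
    by apply/funext => k; rewrite /series /= telescope_sumr // addrC subrK.
  move=> /cvg_ex[l cl]; rewrite xE; apply/cvg_ex; exists (x 0%N + l).
  by apply: cvgD => //; exact: cvg_cst.
have [cr ci] : cvgn (fun k => complex.Re (z k)) /\ cvgn (fun k => complex.Im (z k)).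
  split; apply: realcvg => k; apply: le_trans (za k);
    case: (z k) (z k.+1) => [a1 b1] [a2 b2] /=; rewrite -sqrtr_sqr ler_wsqrtr //.
    by rewrite lerDl sqr_ge0.
  by rewrite lerDr sqr_ge0.
set lr := lim _ in cr; set li := lim _ in ci.
exists (lr +i* li).
have h : `|complex.Re (z k) - lr| + `|complex.Im (z k) - li| @[k --> \oo] --> (0 : R).
  have -> : (0 : R) = `|lr - lr| + `|li - li| by rewrite !subrr normr0 addr0.
  by apply: cvgD; apply: cvg_norm; apply: cvgB => //; exact: cvg_cst.
apply: squeeze_cvgr h; last exact: cvg_cst.
near=> k; rewrite normc_ge0 /=; case: (z k) => x y.
exact: normc_le_ReIm.
Unshelve. all: by end_near. Qed.

Lemma l1cvg_summable m n (u : nat -> 'M[R[i]]_(m, n)) (a : nat -> R) :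
  (forall k, l1norm (u k.+1 - u k) <= a k) -> cvgn (series a) ->
  exists L, l1cvg u L.
Proof.
move=> ua ca.
have {ua} ex i j : exists l, normc (u k i j - l) @[k --> \oo] --> (0 : R).
  apply: complex_cvg_summable ca => k; apply: le_trans (ua k).
  by have := normc_le_l1norm (u k.+1 - u k) i j; rewrite !mxE.
exists (\matrix_(i, j) projT1 (cid (ex i j))).
apply: cvg_sum0 => i; apply: cvg_sum0 => j; under eq_fun do rewrite !mxE.
exact: projT2 (cid (ex i j)).
Qed.

Lemma l1cvg_cvg m n (u : nat -> 'M[R[i]]_(m, n)) L : l1cvg u L -> u @ \oo --> L.
Proof.
move=> uL P /nbhs_l1norm[e e0 eP].
near=> k; apply: eP; near: k; exact: (cvgr_lt _ uL).
Unshelve. all: by end_near.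
Qed.

End SequencesOfMatrices.

(** * The exponential and SU(3) *)

Section Cis.
Variable R : realType.
Implicit Types a b : R.

Lemma cisD a b : cis (a + b) = cis a * cis b.
Proof.
rewrite /cis sinD cosD; simpc; congr (_ +i* _).
by rewrite addrC mulrC [X in _ + X]mulrC.
Qed.

Lemma cis0 : cis 0 = 1 :> R[i].
Proof. by rewrite /cis cos0 sin0. Qed.

Lemma normc_cis a : normc (cis a) = 1.
Proof. by rewrite /cis /= cos2Dsin2 sqrtr1. Qed.

Lemma cis_neq0 a : cis a != 0.
Proof.
apply/eqP => c0; have := normc_cis a; rewrite c0 normc0 => /eqP.
by rewrite eq_sym oner_eq0.
Qed.

Lemma conjc_cis a : (cis a)^*%R = cis (- a).
Proof. by rewrite /cis cosN sinN. Qed.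

(** Turns the chords of the geometric sums into the sines of the theorem. *)
Lemma normc_1Bcis a : normc (1 - cis a) / 2 = `|sin (a / 2)|.
Proof.
have -> : 1 - cis a = (1 - cos a) +i* (- sin a) by rewrite /cis; simpc.
rewrite /= sqrrN.
have -> : (1 - cos a) ^+ 2 + sin a ^+ 2 = (2 * sin (a / 2)) ^+ 2.
  have -> : sin a = sin (a / 2 *+ 2) by rewrite -mulr_natr divfK.
  have -> : cos a = cos (a / 2 *+ 2) by rewrite -mulr_natr divfK.
  rewrite sin_mulr2n cos_mulr2n.
  have := cos2Dsin2 (a / 2); move: (cos _) (sin _) => c s cs.
  have e : c ^+ 2 = 1 - s ^+ 2 by rewrite -cs addrK.
  transitivity (4 * (1 - c ^+ 2) ^+ 2 + 4 * c ^+ 2 * s ^+ 2); first by ring.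
  by rewrite e; ring.
by rewrite sqrtr_sqr normrM ger0_norm // mulrC mulKf.
Qed.

(** The bound on the angle later presents a torus as the image of a compact square. *)
Lemma cis_surj (x : R[i]) : normc x = 1 -> exists2 a, `|a| <= pi & x = cis a.
Proof.
case: x => x y /= /(congr1 (fun z => z ^+ 2)).
rewrite sqr_sqrtr ?addr_ge0 ?sqr_ge0 // expr1n => xy.
have x1 : -1 <= x <= 1.
  rewrite -ler_norml -(ler_pXn2r (n := 2)) ?nnegrE // expr1n real_normK ?num_real //.
  by rewrite -xy lerDl sqr_ge0.
have sx : Num.sqrt (1 - x ^+ 2) = `|y| by rewrite -xy addrC addKr sqrtr_sqr.
have acos_pi : `|acos x| <= pi by rewrite ger0_norm ?acos_ge0 ?acos_lepi.
have [y0|y0] := leP 0 y.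
  exists (acos x); first exact: acos_pi.
  by rewrite /cis acosK ?in_itv //= sin_acos // [Num.ExtraDef.sqrtr _]sx ger0_norm.
exists (- acos x); first by rewrite normrN.
rewrite /cis cosN sinN acosK ?in_itv //= sin_acos //.
by rewrite [Num.ExtraDef.sqrtr _]sx ltr0_norm // opprK.
Qed.

Lemma cis_coeff a k : (k`!%:R)^-1 * ('i * a%:C) ^+ k = cos_coeff a k +i* sin_coeff a k :> R[i].
Proof.
have ik : ('i : R[i]) ^+ k =
    (~~ odd k)%:R * (-1) ^+ k./2 +i* ((odd k)%:R * (-1) ^+ k.-1./2) :> R[i].
  elim: k => [|k IH]; first by rewrite expr0 /= mul1r mul0r.
  rewrite exprS IH; simpc; rewrite /= ?negbK; congr (_ +i* _).
  case: k {IH} => [|k] /=; first by rewrite !mul0r oppr0.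
  by rewrite exprS mulN1r mulrN.
rewrite exprMn ik -rmorphXn /= -(rmorph_nat (real_complex R)) -fmorphV /=.
rewrite /cos_coeff /sin_coeff /=; simpc.
by congr (_ +i* _); rewrite mulrC.
Qed.

Lemma series_cis a : normc (series (fun k => (k`!%:R)^-1 * ('i * a%:C) ^+ k) k - cis a)
  @[k --> \oo] --> (0 : R).
Proof.
have E k : series (fun k => (k`!%:R)^-1 * ('i * a%:C) ^+ k) k
    = series (cos_coeff a) k +i* series (sin_coeff a) k :> R[i].
  rewrite /series /=; elim: k => [|k IH]; first by rewrite !big_geq.
  by rewrite !big_nat_recr //= IH cis_coeff; simpc.
have hc : series (cos_coeff a) k @[k --> \oo] --> cos a.
  by rewrite unlock; exact: is_cvg_series_cos_coeff.
have hs : series (sin_coeff a) k @[k --> \oo] --> sin a.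
  by rewrite unlock; exact: is_cvg_series_sin_coeff.
have h : `|series (cos_coeff a) k - cos a| + `|series (sin_coeff a) k - sin a|
    @[k --> \oo] --> (0 : R).
  have -> : (0 : R) = `|cos a - cos a| + `|sin a - sin a| by rewrite !subrr normr0 addr0.
  by apply: cvgD; apply: cvg_norm; apply: cvgB => //; exact: cvg_cst.
apply: squeeze_cvgr h; last exact: cvg_cst.
by near=> k; rewrite normc_ge0 E /cis /=; exact: normc_le_ReIm.
Unshelve. all: by end_near. Qed.

End Cis.

Section MatrixExponential.
Variable R : realType.
Local Notation M3 := ('M[R[i]]_3).
Implicit Types X Y : M3.

Definition exp_partial X := series (fun k => (k`!%:R)^-1 *: X ^+ k : M3).

Lemma l1normX X k : l1norm (X ^+ k.+1) <= l1norm X ^+ k.+1.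
Proof.
elim: k => [//|k IH]; rewrite exprS [leRHS]exprS.
by apply: le_trans (l1normM _ _) _; rewrite ler_wpM2l ?l1norm_ge0.
Qed.

Lemma normc_natV k : normc (k%:R^-1 : R[i]) = k%:R^-1.
Proof.
rewrite -(rmorph_nat (real_complex R)) -fmorphV /= expr0n addr0 sqrtr_sqr.
by rewrite ger0_norm // invr_ge0.
Qed.

Lemma l1norm_exp_term X k : l1norm ((k.+1`!%:R)^-1 *: X ^+ k.+1) <= exp_coeff (l1norm X) k.+1.
Proof.
rewrite l1normZ normc_natV /exp_coeff /= mulrC ler_wpM2r ?invr_ge0 //.
exact: l1normX.
Qed.

Lemma expM_cvg X : l1cvg (exp_partial X) (expM X).
Proof.
have [L XL] : exists L, l1cvg (exp_partial X) L.
  apply: (l1cvg_summable (a := fun k => (1 + l1norm (1 : M3)) * exp_coeff (l1norm X) k)).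
    move=> k; rewrite /exp_partial /series /= big_nat_recr //= [_ + _ - _]addrC addKr.
    have N0 := l1norm_ge0 (1 : M3).
    case: k => [|k].
      by rewrite fact0 invr1 scale1r expr0 /exp_coeff /= expr0 divr1 mulr1 lerDr.
    apply: le_trans (l1norm_exp_term _ _) _.
    by rewrite ler_peMl ?lerDl // exp_coeff_ge0 ?l1norm_ge0.
  by apply: is_cvg_seriesZ; exact: is_cvg_series_exp_coeff.
by rewrite /expM (cvg_lim _ (l1cvg_cvg XL)).
Qed.

Lemma expM_remainder X :
  l1norm (expM X - (1 + X)) <= expR (l1norm X) * l1norm X ^+ 2.
Proof.
apply: l1cvg_bound (expM_cvg X) (cvg_cst _) _; near=> k.
have -> : k = (k - 2).+2 by rewrite -addn2 subnK //; near: k; exact: nbhs_infty_ge.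
rewrite /exp_partial /series /= big_nat_recl // big_nat_recl // expr0 expr1.
rewrite fact0 factS fact0 muln1 invr1 !scale1r addrA [_ + _ - _]addrC addKr.
apply: le_trans (l1norm_sum _ _) _.
(* Replacing (j + 2)! by j! factors the tail as the squared norm times a partial sum of the real
   exponential. *)
apply: (@le_trans _ _ (series (exp_coeff (l1norm X)) (k - 2)%N * l1norm X ^+ 2)).
  rewrite /series /= mulr_suml.
  apply: ler_sum => j _; apply: le_trans (l1norm_exp_term _ _) _.
  rewrite /exp_coeff /= -(addn2 j) exprD mulrAC ler_wpM2r ?exprn_ge0 ?l1norm_ge0 //.
  rewrite ler_wpM2l ?exprn_ge0 ?l1norm_ge0 // lef_pV2 ?posrE ?ltr0n ?fact_gt0 //.
  by rewrite ler_nat addn2 !factS mulnA leq_pmull.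
rewrite ler_wpM2r ?exprn_ge0 ?l1norm_ge0 //.
apply: nondecreasing_cvgn_le; last exact: is_cvg_series_exp_coeff.
by apply: nondecreasing_series => j _ _; apply: exp_coeff_ge0; exact: l1norm_ge0.
Unshelve. all: by end_near. Qed.

Lemma expM_conj (A B X : M3) : B *m A = 1%:M -> A *m B = 1%:M ->
  expM (A *m X *m B) = A *m expM X *m B.
Proof.
move=> BA AB; apply: l1cvg_unique (expM_cvg _) _.
have -> : exp_partial (A *m X *m B) = fun k => A *m exp_partial X k *m B.
  have E k : (A *m X *m B) ^+ k = A *m X ^+ k *m B.
    elim: k => [|k IH]; first by rewrite !expr0 mulmx1.
    by rewrite !exprS IH -!mulmxE !mulmxA -(mulmxA _ B A) BA mulmx1.
  apply/funext => k; rewrite /exp_partial /series /= mulmx_sumr mulmx_suml.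
  by apply: eq_bigr => j _; rewrite E -scalemxAr -scalemxAl.
by apply: l1cvgM (l1cvg_cst _); apply: l1cvgM (expM_cvg X); exact: l1cvg_cst.
Qed.

Definition idiag (t : 'I_3 -> R) : M3 := diag_mx (\row_j ('i * (t j)%:C)).
Definition cisdiag (t : 'I_3 -> R) : M3 := diag_mx (\row_j cis (t j)).

Lemma expM_idiag t : expM (idiag t) = cisdiag t.
Proof.
apply: l1cvg_unique (expM_cvg _) _.
rewrite /l1cvg /l1norm; apply: cvg_sum0 => j; apply: cvg_sum0 => l.
have E k : exp_partial (idiag t) k j l =
    (series (fun k => (k`!%:R)^-1 * ('i * (t j)%:C) ^+ k) k) *+ (j == l).
  have -> : exp_partial (idiag t) k =
    diag_mx (\row_j (series (fun k => (k`!%:R)^-1 * ('i * (t j)%:C) ^+ k) k)).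
    rewrite /exp_partial /series /=; elim: k => [|k IH].
      by rewrite big_geq //; apply/matrixP => a b; rewrite !mxE big_geq // mul0rn.
    rewrite big_nat_recr //= IH.
    have -> : idiag t ^+ k = diag_mx (\row_j (('i * (t j)%:C) ^+ k)).
      elim: k {IH} => [|k IH].
        by apply/matrixP => a b; rewrite expr0 !mxE expr0.
      rewrite exprS IH -mulmxE mulmx_diag; congr diag_mx; apply/rowP => a.
      by rewrite !mxE exprS.
    rewrite -linearZ -linearD /=; congr diag_mx; apply/rowP => a.
    by rewrite !mxE big_nat_recr.
  by rewrite !mxE.
move: E; have [<-|jl] := eqVneq j l => E; last first.
  under eq_fun do rewrite mxE E mulr0n !mxE (negbTE jl) mulr0n oppr0 addr0 normc0.
  exact: cvg_cst.
under eq_fun do rewrite mxE E !mxE eqxx mulr1n.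
exact: series_cis.
Qed.

End MatrixExponential.

Local Open Scope sesquilinear_scope.

Section Su3.
Variable R : realType.
Local Notation M3 := ('M[R[i]]_3).
Implicit Types (X Y A B U : M3) (t : 'I_3 -> R).

Definition su3 : set M3 := [set X | X ^t* = - X /\ \tr X = 0].

Lemma SU3_unitary A : @SU3 R A -> A \is unitarymx. Proof. by case. Qed.

Lemma SU3_mul A B : @SU3 R A -> SU3 B -> SU3 (A *m B).
Proof. by case=> uA dA [uB dB]; split; rewrite ?mul_unitarymx // det_mulmx dA dB mulr1. Qed.

Lemma SU3_1 : @SU3 R 1%:M.
Proof. by split; [apply/unitarymxP; rewrite trmx1 map_mx1 mulmx1 | rewrite det1]. Qed.

Lemma SU3_exprn A k : @SU3 R A -> SU3 (A ^+ k).
Proof.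
move=> A3; elim: k => [|k IH]; first by rewrite expr0; exact: SU3_1.
by rewrite exprS -mulmxE; exact: SU3_mul.
Qed.

Lemma unitarymx_tCmul U : U \is unitarymx -> U^t* *m U = 1%:M.
Proof. by move=> uU; rewrite -invmx_unitary // mulVmx // unitarymx_unit. Qed.

Lemma SU3_conj U A : U \is unitarymx -> @SU3 R A -> SU3 (U^t* *m A *m U).
Proof.
move=> uU [uA dA]; split.
  apply: (mul_unitarymx _ uU); apply: (mul_unitarymx _ uA).
  by rewrite trmxC_unitary; exact: uU.
rewrite !det_mulmx dA mulr1 -det_mulmx (unitarymx_tCmul uU); exact: det1.
Qed.

Lemma adjmxE X i j : (X ^t*) i j = ((X j i)^*)%R.
Proof. by rewrite !mxE. Qed.

Lemma unitarymx_normc A i j : A \is unitarymx -> normc (A i j) <= 1.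
Proof.
move/unitarymxP/matrixP/(_ i i); rewrite mxE [RHS]mxE eqxx => S1.
have S1' : \sum_k (normc (A i k)) ^+ 2 = 1 :> R.
  apply: complexI; rewrite rmorph_sum rmorph1 -[RHS]S1; apply: eq_bigr => k _.
  by rewrite adjmxE rmorphXn /= -normCK.
have := normc_ge0 (A i j) => A0.
rewrite -(ler_pXn2r (n := 2)) ?nnegrE // expr1n -S1' (bigD1 j) //= lerDl.
by apply: sumr_ge0 => k _; rewrite exprn_ge0 // normc_ge0.
Qed.

(** One bound for the whole group; as powers stay in the group it bounds every power too, as the
    telescoping of [l1norm_subX] requires. *)
Lemma unitarymx_l1norm A : A \is unitarymx -> l1norm A <= 9.
Proof.
move=> uA; rewrite /l1norm.
apply: (@le_trans _ _ (\sum_(i < 3) \sum_(j < 3) (1 : R))).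
  by apply: ler_sum => i _; apply: ler_sum => j _; exact: unitarymx_normc.
by rewrite !sumr_const !card_ord -mulrnA.
Qed.

Lemma cisdiag_adj t : cisdiag t ^t* = cisdiag (fun i => - t i).
Proof.
apply/matrixP => i j; rewrite adjmxE !mxE eq_sym; case: eqVneq => [->|_].
  by rewrite !mulr1n conjc_cis.
by rewrite !mulr0n rmorph0.
Qed.

Lemma cisdiag_SU3 t : \sum_i t i = 0 -> SU3 (cisdiag t).
Proof.
move=> t0; split.
  apply/unitarymxP.
  rewrite cisdiag_adj mulmx_diag -[1%:M]diag_const_mx; congr diag_mx; apply/rowP => i.
  by rewrite !mxE -cisD subrr cis0.
rewrite det_diag; under eq_bigr do rewrite mxE.
transitivity (cis (\sum_i t i)); last by rewrite t0 cis0.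
by rewrite !big_ord_recl !big_ord0 mulr1 addr0 !cisD.
Qed.

Lemma idiag_su3 t : \sum_i t i = 0 -> su3 (idiag t).
Proof.
move=> t0; split.
  apply/matrixP => i j; rewrite adjmxE !mxE eq_sym; case: eqVneq => [->|_].
    rewrite !mulr1n; apply/eqP; rewrite eq_complex /=.
    by apply/andP; split; apply/eqP; ring.
  by rewrite !mulr0n rmorph0 oppr0.
rewrite mxtrace_diag; under eq_bigr do rewrite mxE.
by rewrite -mulr_sumr -rmorph_sum t0 rmorph0 mulr0.
Qed.

Lemma su3_idiag X : su3 X -> exists U t,
  [/\ U \is unitarymx, \sum_i t i = 0 & X = U^t* *m idiag t *m U].
Proof.
case=> skX trX.
have nX : X \is normalmx.
  by apply/normalmxP; rewrite skX mulmxN mulNmx.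
have /orthomx_spectralP := nX; set U := spectralmx X; set d := spectral_diag X => Xd.
have uU : U \is unitarymx by exact: spectral_unitarymx.
have {}Xd : X = U^t* *m diag_mx d *m U by rewrite -invmx_unitary.
have dX : diag_mx d = U *m X *m U^t*.
  rewrite Xd -!mulmxA [U *m U^t*](unitarymxP uU) mulmx1.
  by rewrite !mulmxA (unitarymxP uU) mul1mx.
pose t i := complex.Im (d 0 i).
have dt : diag_mx d = idiag t.
  have ud : (diag_mx d) ^t* = - diag_mx d.
    rewrite dX !trmx_mul !map_mxM trmxCK -!mulmxA.
    by rewrite skX mulNmx mulmxN.
  congr diag_mx; apply/rowP => k; rewrite mxE.
  have := congr1 (fun M : M3 => M k k) ud; rewrite adjmxE !mxE eqxx !mulr1n /t.
  case: (d 0 k) => a b /eqP; rewrite eq_complex /= => /andP[/eqP a0 _].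
  have -> : a = 0 by lra.
  by apply/eqP; rewrite eq_complex /=; apply/andP; split; apply/eqP; ring.
exists U, t; split; [exact: uU | | by rewrite -dt].
move: trX; rewrite Xd dt mxtrace_mulC mulmxA (unitarymxP uU) mul1mx mxtrace_diag.
under eq_bigr do rewrite mxE.
rewrite -mulr_sumr -rmorph_sum => /eqP; rewrite mulf_eq0 eq_complex /= oner_eq0 andbF /=.
by rewrite fmorph_eq0 => /eqP.
Qed.

Lemma su3D X Y : su3 X -> su3 Y -> su3 (X + Y).
Proof.
case=> sX tX [sY tY]; split; last by rewrite mxtraceD tX tY addr0.
by rewrite linearD /= map_mxD sX sY opprD.
Qed.

Lemma conjc_realM (x : R) (z : R[i]) : ((x%:C * z)^*)%R = x%:C * (z^*)%R.
Proof.
by case: z => a b; apply/eqP; rewrite eq_complex /=; apply/andP; split; apply/eqP; ring.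
Qed.

Lemma su3Z (x : R) X : su3 X -> su3 (x%:C *: X).
Proof.
case=> sX tX; split; last by rewrite mxtraceZ tX mulr0.
apply/matrixP => i j; have := congr1 (fun M : M3 => M i j) sX.
rewrite !adjmxE !mxE conjc_realM => ->; exact: mulrN.
Qed.

Lemma su3N X : su3 X -> su3 (- X).
Proof. by move=> /(su3Z (-1)); rewrite rmorphN1 scaleN1r. Qed.

Lemma su3_conj U X : U \is unitarymx -> su3 X -> su3 (U *m X *m U^t*).
Proof.
move=> uU [sX tX]; split.
  by rewrite !trmx_mul !map_mxM trmxCK sX !mulmxA mulmxN mulNmx.
by rewrite mxtrace_mulC mulmxA unitarymx_tCmul // mul1mx.
Qed.

Lemma idiagZ (x : R) t : x%:C *: idiag t = idiag (fun i => x * t i).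
Proof.
rewrite /idiag -linearZ /=; congr diag_mx; apply/rowP => i; rewrite !mxE rmorphM.
by rewrite mulrCA.
Qed.

Lemma cisdiagM t t' : cisdiag t *m cisdiag t' = cisdiag (fun i => t i + t' i).
Proof. by rewrite mulmx_diag; congr diag_mx; apply/rowP => i; rewrite !mxE cisD. Qed.

Lemma expM_conj_idiag U t : U \is unitarymx ->
  expM (U^t* *m idiag t *m U) = U^t* *m cisdiag t *m U.
Proof.
by move=> uU; rewrite expM_conj ?expM_idiag ?unitarymx_tCmul //; exact/unitarymxP.
Qed.

Lemma expM_SU3 X : su3 X -> SU3 (expM X).
Proof.
move=> /su3_idiag[U [t [uU t0 ->]]]; rewrite (expM_conj_idiag _ uU).
exact: (SU3_conj uU (cisdiag_SU3 t0)).
Qed.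

Lemma expM_scaleD X (x y : R) : su3 X ->
  expM ((x + y)%:C *: X) = expM (x%:C *: X) *m expM (y%:C *: X).
Proof.
move=> /su3_idiag[U [t [uU t0 ->]]].
have E z : expM (z%:C *: (U^t* *m idiag t *m U))
    = U^t* *m cisdiag (fun i => z * t i) *m U.
  by rewrite scalemxAl scalemxAr idiagZ (expM_conj_idiag _ uU).
rewrite !E !mulmxA -(mulmxA _ U) (unitarymxP uU) mulmx1.
rewrite -[in RHS](mulmxA (U^t*)) cisdiagM.
have <- : (fun i => (x + y) * t i) = (fun i => x * t i + y * t i).
  by apply/funext => i; rewrite mulrDl.
by [].
Qed.

Lemma expM_exprn X (x : R) m : su3 X ->
  expM (x%:C *: X) ^+ m = expM ((m%:R * x)%:C *: X).
Proof.
move=> sX; elim: m => [|m IH].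
  have [U [t [uU _ E]]] := su3_idiag sX.
  rewrite expr0 mul0r E scalemxAl scalemxAr idiagZ (expM_conj_idiag _ uU).
  rewrite (_ : cisdiag _ = 1%:M) ?mulmx1 ?unitarymx_tCmul //.
  by rewrite -[1%:M]diag_const_mx; congr diag_mx; apply/rowP => i; rewrite !mxE mul0r cis0.
have -> : m.+1%:R * x = m%:R * x + x by rewrite -natr1 mulrDl mul1r.
by rewrite (expM_scaleD _ _ sX) exprSr IH.
Qed.

Definition angles3 (a b : R) (i : 'I_3) : R :=
  if i == 0 then a else if i == 1 then b else - (a + b).

Lemma angles3_sum a b : \sum_i angles3 a b i = 0.
Proof. by rewrite !big_ord_recl big_ord0 /angles3 /=; ring. Qed.

Lemma SU3_diag_mx (d : 'rV[R[i]]_3) : SU3 (diag_mx d) ->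
  exists a b, [/\ `|a| <= pi, `|b| <= pi & diag_mx d = cisdiag (angles3 a b)].
Proof.
case=> ud detd.
have d1 i : normc (d 0 i) = 1.
  have := unitarymxP ud => /matrixP/(_ i i).
  have -> : (diag_mx d) ^t* = diag_mx (\row_i (d 0 i)^*%R).
    apply/matrixP => j k; rewrite adjmxE !mxE eq_sym; case: eqVneq => [->|_].
      by rewrite !mulr1n.
    by rewrite !mulr0n rmorph0.
  rewrite mulmx_diag !mxE eqxx !mulr1n -normCK => h.
  have /eqP : normc (d 0 i) ^+ 2 = 1 by apply: complexI; rewrite rmorphXn rmorph1; exact: h.
  by rewrite sqrf_eq1 => /orP[/eqP //|/eqP hN]; have := normc_ge0 (d 0 i); rewrite hN; lra.
have dd : d 0 0 * (d 0 1 * d 0 2%:R) = 1.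
  move: detd; rewrite det_diag !big_ord_recl big_ord0 mulr1 => <-.
  by congr (d _ _ * (d _ _ * d _ _)); apply: val_inj.
have [a api da] := cis_surj (d1 0); have [b bpi db] := cis_surj (d1 1).
exists a, b; split; [exact: api | exact: bpi | ].
congr diag_mx; apply/rowP => i; rewrite mxE /angles3.
case: eqP => [->|i0]; first by rewrite da.
case: eqP => [->|i1]; first by rewrite db.
have -> : i = 2%:R.
  case: i i0 i1 => [[|[|[|m]]] hm] // i0 i1; first by case: i0; exact: val_inj.
    by case: i1; exact: val_inj.
  exact: val_inj.
apply: (mulfI (cis_neq0 (a + b))); rewrite -[RHS]cisD subrr cis0 -dd.
by rewrite cisD -da -db mulrA.
Qed.

(** A unitary matrix is diagonalised, and the last angle is taken to be minus the sum of the others,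
    so that the logarithm has trace 0. *)
Lemma expM_surj A : SU3 A -> exists2 X, su3 X & expM X = A.
Proof.
case=> uA dA.
have nA : A \is normalmx.
  by apply/normalmxP; rewrite (unitarymxP uA) (unitarymx_tCmul uA).
have /orthomx_spectralP := nA; set U := spectralmx A; set d := spectral_diag A => Ad.
have uU : U \is unitarymx by exact: spectral_unitarymx.
have {}Ad : A = U^t* *m diag_mx d *m U by rewrite -invmx_unitary.
have dE : diag_mx d = U *m A *m U^t*.
  rewrite Ad -!mulmxA [U *m U^t*](unitarymxP uU) mulmx1.
  by rewrite !mulmxA (unitarymxP uU) mul1mx.
have [|a [b [_ _ dt]]] := SU3_diag_mx (d := d).
  split; last by rewrite dE !det_mulmx dA mulr1 mulrC -det_mulmx (unitarymx_tCmul uU); exact: det1.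
  rewrite dE; apply: (mul_unitarymx (mul_unitarymx uU uA)).
  by rewrite trmxC_unitary; exact: uU.
exists (U^t* *m idiag (angles3 a b) *m U).
  have [||h1 h2] := @su3_conj (U^t*) (idiag (angles3 a b)).
  - by rewrite trmxC_unitary.
  - by apply: idiag_su3; exact: angles3_sum.
  by rewrite trmxCK in h1 h2.
by rewrite (expM_conj_idiag _ uU) -dt; exact: esym Ad.
Qed.

(** Derivatives are taken along these times only: passing to the next one is a square root in the
    one-parameter subgroup, and limits become limits of sequences. *)
Definition dyadic k : R := 2^-1 ^+ k.

Lemma dyadic_gt0 k : 0 < dyadic k. Proof. by rewrite exprn_gt0. Qed.

Lemma dyadic_le1 k : dyadic k <= 1.
Proof. by rewrite exprn_ile1 // invf_le1 // ler1n. Qed.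

Lemma dyadic0 : dyadic 0 = 1. Proof. by rewrite /dyadic expr0. Qed.

Lemma dyadicM j k : dyadic j * dyadic k = dyadic (j + k).
Proof. by rewrite /dyadic exprD. Qed.

Lemma dyadicS k : dyadic k.+1 + dyadic k.+1 = dyadic k.
Proof. by rewrite /dyadic exprS; field. Qed.

Lemma dyadicV k : (2 ^ k)%:R * dyadic k = 1.
Proof. by rewrite natrX -exprMn mulfV // expr1n. Qed.

Lemma dyadic_cvg : dyadic k @[k --> \oo] --> (0 : R).
Proof. by apply: cvg_expr; rewrite ger0_norm // invf_lt1 // ltr1n. Qed.

Lemma normc_real (x : R) : normc x%:C = `|x|.
Proof. by rewrite /= expr0n addr0 sqrtr_sqr. Qed.

Lemma l1cvg_dyadicZ m n (A : 'M[R[i]]_(m, n)) : l1cvg (fun k => (dyadic k)%:C *: A) 0.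
Proof.
apply: (l1cvg_squeeze (b := fun k => dyadic k * l1norm A)).
  by move=> k; rewrite subr0 l1normZ normc_real ger0_norm // ltW ?dyadic_gt0.
rewrite -(mul0r (l1norm A)); apply: cvgM; [exact: dyadic_cvg | exact: cvg_cst].
Qed.

Lemma expM_deriv X :
  l1cvg (fun k => (2 ^ k)%:R *: (expM ((dyadic k)%:C *: X) - 1)) X.
Proof.
pose c := expR (l1norm X) * l1norm X ^+ 2.
apply: (l1cvg_squeeze (b := fun k => dyadic k * c)); last first.
  rewrite -(mul0r c); apply: cvgM; [exact: dyadic_cvg | exact: cvg_cst].
move=> k; have d0 := dyadic_gt0 k.
have {2}-> : X = (2 ^ k)%:R *: ((dyadic k)%:C *: X).
  by rewrite scalerA -(rmorph_nat (real_complex R)) -rmorphM dyadicV scale1r.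
rewrite -scalerBr l1normZ -addrA -opprD -(rmorph_nat (real_complex R)) normc_real.
rewrite ger0_norm // -(ler_pM2l d0) mulrA [_ * _%:R]mulrC dyadicV mul1r.
apply: le_trans (expM_remainder _) _.
rewrite l1normZ normc_real (ger0_norm (ltW d0)) exprMn mulrCA [leRHS]mulrA -expr2.
rewrite ler_wpM2l ?exprn_ge0 ?(ltW d0) // ler_wpM2r ?exprn_ge0 ?l1norm_ge0 //.
by rewrite ler_expR ler_piMl ?l1norm_ge0 // dyadic_le1.
Qed.

Lemma l1cvg_dyadicM m n (u : nat -> 'M[R[i]]_(m, n)) L :
  l1cvg u L -> l1cvg (fun k => (dyadic k)%:C *: u k) 0.
Proof.
move=> uL; have := l1cvgM (l1cvg_dyadicZ 1%:M) uL; rewrite mul0mx.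
by congr l1cvg; apply/funext => k; rewrite -scalemxAl mul1mx.
Qed.

Lemma dyadicCV k : (dyadic k)%:C * (2 ^ k)%:R = 1 :> R[i].
Proof. by rewrite -(rmorph_nat (real_complex R)) -rmorphM mulrC dyadicV. Qed.

Lemma expM_dyadic_cvg1 X : l1cvg (fun k => expM ((dyadic k)%:C *: X)) 1.
Proof.
have := l1cvgD (l1cvg_cst 1) (l1cvg_dyadicM (expM_deriv X)); rewrite addr0.
congr l1cvg; apply/funext => k; rewrite scalerA dyadicCV scale1r addrC.
exact: subrK.
Qed.

(** Telescoping: A^p - B^p is the sum of the terms A^i (A - B) B^(p-1-i). *)
Lemma l1norm_subX n (A B : 'M[R[i]]_n) K p :
  (forall i, (i <= p)%N -> l1norm (A ^+ i) <= K) ->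
  (forall i, (i <= p)%N -> l1norm (B ^+ i) <= K) ->
  l1norm (A ^+ p - B ^+ p) <= p%:R * (K * l1norm (A - B) * K).
Proof.
move=> AK BK.
have K0 : 0 <= K by apply: le_trans (l1norm_ge0 _) (AK 0%N _).
have N0 := l1norm_ge0 (A - B).
(* The trailing factor B^j makes the induction go through; m + j <= p keeps all exponents within the
   range of the hypotheses. *)
suff H m j : (m + j <= p)%N ->
    l1norm ((A ^+ m - B ^+ m) *m B ^+ j) <= m%:R * (K * l1norm (A - B) * K).
  by have := H p 0%N; rewrite addn0 expr0 mulmx1; exact.
elim: m j => [|m IH] j mj; first by rewrite !expr0 subrr mul0mx l1norm0 mul0r.
have -> : (A ^+ m.+1 - B ^+ m.+1) *m B ^+ j =
    (A ^+ m - B ^+ m) *m B ^+ j.+1 + A ^+ m *m (A - B) *m B ^+ j.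
  have -> : A ^+ m.+1 = A ^+ m *m A by rewrite exprSr.
  have -> : B ^+ m.+1 = B ^+ m *m B by rewrite exprSr.
  have -> : B ^+ j.+1 = B *m B ^+ j by rewrite exprS.
  rewrite mulmxA -mulmxDl; congr (_ *m _).
  by rewrite mulmxBl mulmxBr [RHS]addrC addrA subrK.
rewrite -natr1 mulrDl mul1r.
apply: le_trans (l1normD _ _) (lerD _ _); first by apply: IH; rewrite addnS.
apply: le_trans (l1normM _ _) _; apply: ler_pM; rewrite ?l1norm_ge0 //.
  apply: le_trans (l1normM _ _) _; rewrite ler_wpM2r //.
  by apply: AK; rewrite (leq_trans _ mj) // ltnW // addSn ltnS leq_addr.
by apply: BK; rewrite (leq_trans _ mj) // leq_addl.
Qed.

(** An error o(2^-k) between the bases is multiplied by 2^k in [l1norm_subX], so it still tends to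
    0. *)
Lemma l1cvg_subX n (A B : nat -> 'M[R[i]]_n) K :
  (forall k i, (i <= 2 ^ k)%N -> l1norm (A k ^+ i) <= K) ->
  (forall k i, (i <= 2 ^ k)%N -> l1norm (B k ^+ i) <= K) ->
  l1cvg (fun k => (2 ^ k)%:R *: (A k - B k)) 0 ->
  l1cvg (fun k => A k ^+ (2 ^ k) - B k ^+ (2 ^ k)) 0.
Proof.
move=> AK BK AB.
apply: (l1cvg_squeeze (b := fun k => K * K * l1norm ((2 ^ k)%:R *: (A k - B k) - 0))).
  move=> k; rewrite !subr0; apply: le_trans (l1norm_subX (AK k) (BK k)) _.
  rewrite l1normZ -[in leRHS](rmorph_nat (real_complex R)) normc_real ger0_norm //.
  by rewrite le_eqVlt; apply/orP; left; apply/eqP; ring.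
rewrite -(mulr0 (K * K)); apply: cvgM => //; exact: cvg_cst.
Qed.

Lemma expM_dyadic_exprn X k : su3 X ->
  expM ((dyadic k)%:C *: X) ^+ (2 ^ k) = expM X.
Proof. by move=> sX; rewrite (expM_exprn _ _ sX) dyadicV scale1r. Qed.

(** The Lie-Trotter formula: exp(X/2^k) exp(Y/2^k) and exp((X+Y)/2^k) have the same first-order
    term, and [l1cvg_subX] carries this over to the 2^k-th powers. *)
Lemma trotter X Y : su3 X -> su3 Y ->
  l1cvg (fun k => (expM ((dyadic k)%:C *: X) *m expM ((dyadic k)%:C *: Y)) ^+ (2 ^ k))
    (expM (X + Y)).
Proof.
move=> sX sY; have sXY := su3D sX sY.
pose A k := expM ((dyadic k)%:C *: X) *m expM ((dyadic k)%:C *: Y).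
pose B k := expM ((dyadic k)%:C *: (X + Y)).
have A3 k : SU3 (A k) by apply: SU3_mul; apply: expM_SU3; exact: su3Z.
have B3 k : SU3 (B k) by apply: expM_SU3; exact: su3Z.
have AB : l1cvg (fun k => (2 ^ k)%:R *: (A k - B k)) 0.
  have := l1cvgB (l1cvgD (l1cvgM (expM_deriv X) (expM_dyadic_cvg1 Y)) (expM_deriv Y))
    (expM_deriv (X + Y)).
  rewrite mulmx1 subrr; congr l1cvg; apply/funext => k.
  rewrite -scalemxAl -scalerDr -scalerBr mulmxBl mul1mx addrA subrK.
  by rewrite opprB addrA subrK.
have := l1cvgD (l1cvg_subX (K := 9) _ _ AB) (l1cvg_cst (expM (X + Y))).
rewrite add0r => h.
have {}h := h (fun k i _ => unitarymx_l1norm (SU3_unitary (SU3_exprn i (A3 k))))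
  (fun k i _ => unitarymx_l1norm (SU3_unitary (SU3_exprn i (B3 k)))).
move: h; congr l1cvg; apply/funext => k.
by rewrite /B (expM_dyadic_exprn _ sXY) subrK.
Qed.

End Su3.

(* Keeps the unifier from comparing limits by unfolding them. *)
Global Opaque expM dyadic.

(** * Continuity of a representation in the entrywise norm *)

Section ContinuousRepresentation.
Variables (R : realType) (n : nat) (sigma : 'M[R[i]]_3 -> 'M[R[i]]_n).
Hypothesis rep : representation sigma.

Lemma rep_mul A B : SU3 A -> SU3 B -> sigma (A *m B) = sigma A *m sigma B.
Proof. by case: rep => _ _ h; exact: h. Qed.

Lemma rep_exprn A k : SU3 A -> sigma (A ^+ k) = sigma A ^+ k.
Proof.
move=> A3; elim: k => [|k IH]; first by rewrite !expr0; case: rep.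
have -> : A ^+ k.+1 = A *m A ^+ k by rewrite exprS.
by rewrite (rep_mul A3 (SU3_exprn k A3)) IH exprS.
Qed.

Lemma rep_eps_delta A e : SU3 A -> 0 < e -> exists2 d, 0 < d &
  forall B, SU3 B -> l1norm (B - A) < d -> l1norm (sigma B - sigma A) < e.
Proof.
move=> A3 e0; case: rep => sc _ _.
have /(sc A) : nbhs (sigma A) [set M | l1norm (M - sigma A) < e].
  by apply/nbhs_l1norm; exists e.
rewrite /nbhs /= -nbhs_subspace_in //.
by move=> /nbhs_l1norm[d d0 dP]; exists d => // B B3 BA; exact: dP.
Qed.

Lemma rep_cvg (u : nat -> 'M[R[i]]_3) A : (forall k, SU3 (u k)) -> SU3 A ->
  l1cvg u A -> l1cvg (fun k => sigma (u k)) (sigma A).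
Proof.
move=> u3 A3 uA; apply/cvgrPdist_lt => e e0.
have [d d0 dP] := rep_eps_delta A3 e0.
near=> k; rewrite sub0r normrN ger0_norm ?l1norm_ge0 //.
apply: dP => //; near: k; exact: (cvgr_lt _ uA).
Unshelve. all: by end_near. Qed.

End ContinuousRepresentation.

(** * The differential of a representation *)

Section DyadicPowers.
Variables (R : realType) (n : nat).
Implicit Types A B F : 'M[R[i]]_n.

Lemma l1norm_triangle A B F : l1norm (A - B) <= l1norm (A - F) + l1norm (F - B).
Proof. by apply: le_trans (l1normD _ _); rewrite addrA subrK. Qed.

Lemma mulmx_sub1 F : F *m F - 1 = 2%:R *: (F - 1) + (F - 1) *m (F - 1).
Proof.
have -> : (1 : 'M[R[i]]_n) = 1%:M by [].
rewrite mulmxBl !mulmxBr !mulmx1 mul1mx scaler_nat mulr2n.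
by rewrite [RHS]addrACA subrr addr0 [RHS]addrC addrA subrK.
Qed.

Lemma dyadic_quotient_step F G k : G = F *m F ->
  (2 ^ k.+1)%:R *: (F - 1) - (2 ^ k)%:R *: (G - 1) = - ((2 ^ k)%:R *: ((F - 1) *m (F - 1))).
Proof.
move=> ->; rewrite expnSr natrM -scalerA -scalerBr -scalerN; congr (_ *: _).
by rewrite mulmx_sub1 opprD addrA subrr add0r.
Qed.

(** The ratio of the whole convergence argument: halving the time shrinks sigma - 1 by 4/7, and the
    difference quotient multiplies its square by 2 at each step. *)
Lemma expr_32_49 k : (32 / 49 : R) ^+ k = 2 ^+ k * ((4 / 7) ^+ k) ^+ 2.
Proof. by rewrite -exprM mulnC exprM -exprMn; congr (_ ^+ k); field. Qed.

(* f(2t) = 2 f(t) + f(t)^2 for f = F - 1 makes f(t) nearly linear under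
   repeated halving. *)
Lemma dyadic_powers F k :
  (forall i, (i <= k)%N -> l1norm (F ^+ (2 ^ i) - 1) <= 4^-1) ->
  l1norm (F - 1) <= (4 / 7) ^+ k * l1norm (F ^+ (2 ^ k) - 1) /\
  l1norm (F ^+ (2 ^ k) - 1 - (2 ^ k)%:R *: (F - 1))
    <= (1 - (32 / 49) ^+ k) * l1norm (F ^+ (2 ^ k) - 1) ^+ 2.
Proof.
elim: k F => [|k IH] F Fk.
  by rewrite expn0 expr1 expr0 mul1r scale1r !subrr l1norm0 mul0r.
have E j : (F ^+ 2) ^+ (2 ^ j) = F ^+ (2 ^ j.+1) by rewrite -exprM expnS.
have [|IHa IHb] := IH (F ^+ 2).
  by move=> i ik; rewrite E; apply: Fk.
rewrite !E in IHa IHb.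
have F1 : l1norm (F - 1) <= 4^-1 by have := Fk 0%N isT; rewrite expn0 expr1.
have FF : F ^+ 2 - 1 = 2%:R *: (F - 1) + (F - 1) *m (F - 1).
  by rewrite expr2; exact: mulmx_sub1.
have N0 := l1norm_ge0 (F - 1).
have N1 := l1normM (F - 1) (F - 1).
have N2 : 2 * l1norm (F - 1) <= l1norm (F ^+ 2 - 1) + l1norm (F - 1) * l1norm (F - 1).
  have -> : 2 * l1norm (F - 1) = l1norm (2%:R *: (F - 1)).
    by rewrite l1normZ -(rmorph_nat (real_complex R)) normc_real ger0_norm.
  have -> : 2%:R *: (F - 1) = (F ^+ 2 - 1) - (F - 1) *m (F - 1) by rewrite FF addrK.
  by apply: le_trans (l1normB _ _) _; rewrite lerD2l.
(* With |F - 1| <= 1/4 the quadratic term of [N2] is at most |F - 1| / 4, which leaves 7/4 |F - 1|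
   on the left. *)
have a : l1norm (F - 1) <= 4 / 7 * l1norm (F ^+ 2 - 1) by nra.
have M0 := l1norm_ge0 (F ^+ (2 ^ k.+1) - 1).
move: (l1norm (F ^+ (2 ^ k.+1) - 1)) M0 IHa IHb (Fk k.+1 (leqnn _)) => M M0 IHa IHb M4.
have a' : l1norm (F - 1) <= (4 / 7) ^+ k.+1 * M by rewrite exprS -mulrA; lra.
split=> //.
have -> : F ^+ (2 ^ k.+1) - 1 - (2 ^ k.+1)%:R *: (F - 1) =
   (F ^+ (2 ^ k.+1) - 1 - (2 ^ k)%:R *: (F ^+ 2 - 1)) + (2 ^ k)%:R *: ((F - 1) *m (F - 1)).
  rewrite FF; move: (F - 1) (F ^+ _ - 1) => f g.
  by rewrite scalerDr scalerA -natrM -expnSr opprD addrA subrK.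
apply: le_trans (l1normD _ _) _.
rewrite l1normZ -[in _ * l1norm (_ *m _)](rmorph_nat (real_complex R)) normc_real ger0_norm //.
(* The new error is 16/49 of (32/49)^k, below the room 1 - 32/49 = 17/49 gained when k grows by
   1. *)
have : (2 ^ k)%:R * l1norm ((F - 1) *m (F - 1)) <= 16 / 49 * (32 / 49) ^+ k * M ^+ 2.
  apply: (@le_trans _ _ ((2 ^ k)%:R * ((4 / 7) ^+ k.+1 * M) ^+ 2)).
    rewrite ler_wpM2l //; apply: le_trans N1 _; rewrite -expr2.
    by rewrite ler_pXn2r ?nnegrE // mulr_ge0 // exprn_ge0.
  rewrite expr_32_49.
  rewrite natrX (exprS (4 / 7) k); move: ((4 / 7) ^+ k) (2 ^+ k) => p q.
  by rewrite le_eqVlt; apply/orP; left; apply/eqP; field.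
have P0 : 0 <= (32 / 49 : R) ^+ k by rewrite exprn_ge0.
have MM : 0 <= M ^+ 2 by rewrite exprn_ge0.
move: (l1norm _) ((2 ^ k)%:R * _) IHb => u v; rewrite [in (32 / 49) ^+ k.+1]exprS.
move: ((32 / 49) ^+ k) P0 (M ^+ 2) MM => P P0 M2 MM; nra.
Qed.

End DyadicPowers.

Section Differential.
Variables (R : realType) (n : nat) (sigma : 'M[R[i]]_3 -> 'M[R[i]]_n).
Hypothesis rep : representation sigma.
Local Notation M3 := ('M[R[i]]_3).
Local Notation dy k X := ((dyadic _ k)%:C *: X).
Implicit Types (X Y : M3).

Definition dyadic_quotient X k : 'M[R[i]]_n :=
  (2 ^ k)%:R *: (sigma (expM (dy k X)) - 1).

(** The differential at 1, meant for X in su(3); if the quotients diverge, [get] returns a default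
    value. *)
Definition drep X : 'M[R[i]]_n := get [set L | l1cvg (dyadic_quotient X) L].

Lemma dyZ k X : su3 X -> su3 (dy k X). Proof. exact: su3Z. Qed.

Lemma dyadicD j k X : dy j (dy k X) = dy (k + j)%N X.
Proof. by rewrite scalerA -rmorphM mulrC dyadicM. Qed.

Lemma sigma1 : sigma 1 = 1. Proof. by case: rep. Qed.

Lemma l1norm_dy k X : l1norm (dy k X) = dyadic R k * l1norm X.
Proof. by rewrite l1normZ normc_real ger0_norm // ltW ?dyadic_gt0. Qed.

Lemma expM_near1 X : l1norm X <= 1 ->
  l1norm (expM X - 1) <= (1 + expR 1) * l1norm X.
Proof.
move=> X1; have N0 := l1norm_ge0 X.
have -> : expM X - 1 = X + (expM X - (1 + X)).
  by rewrite opprD [RHS]addrC -!addrA addNr addr0.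
apply: le_trans (l1normD _ _) _; rewrite mulrDl mul1r lerD2l.
apply: le_trans (expM_remainder _) _; rewrite expr2 mulrA ler_wpM2r //.
by rewrite -[leRHS]mulr1 ler_pM ?expR_ge0 ?ler_expR.
Qed.

(** A radius within which sigma stays at distance 1/4 from 1, uniformly in the subdivision. Two
    matrices occur so that Trotter products are covered together with one-parameter subgroups, the
    case Y = 0. *)
Definition rep_small (d : R) := 0 < d /\ forall X Y, su3 X -> su3 Y ->
  l1norm X <= d -> l1norm Y <= d -> forall k i, (i <= 2 ^ k)%N ->
  l1norm (sigma ((expM (dy k X) *m expM (dy k Y)) ^+ i) - 1) <= 4^-1.

Lemma rep_small_ex : exists d, rep_small d.
Proof.
(* 810 = 9 * 10 * 9 is rounded up to 1000: the outer factors are the norm bound of the group in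
   [l1norm_subX], and 10 = 9 + 1 comes from comparing a product of two factors with 1. *)
have aux (x y e : R) : 0 < y -> x <= y -> 10 * (10 * (10 * y)) <= e ->
    9 * (10 * x) * 9 < e by lra.
have [|e e0 eP] := @rep_eps_delta _ _ _ rep 1 4^-1 (SU3_1 R); first by rewrite invr_gt0.
pose K : R := 1 + expR 1.
have K0 : 0 < K by rewrite addr_gt0 // expR_gt0.
pose d := Num.min 1 (e / (10 * (10 * (10 * K)))).
have K10 : 0 < 10 * (10 * (10 * K)) by do 3!(apply: mulr_gt0 => //).
have d0 : 0 < d by rewrite lt_min ltr01 divr_gt0.
have d1 : d <= 1 by rewrite ge_min lexx.
have de : 10 * (10 * (10 * K)) * d <= e.
  by rewrite mulrC -ler_pdivlMr // ge_min lexx orbT.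
exists d; split=> // X Y sX sY Xd Yd k i ik.
have X3 := expM_SU3 (dyZ k sX); have Y3 := expM_SU3 (dyZ k sY).
rewrite -sigma1; apply/ltW/eP; first exact: SU3_exprn _ (SU3_mul X3 Y3).
have D0 := dyadic_gt0 R k.
have D1 : dyadic R k <= 1 by rewrite dyadic_le1.
have bnd Z : l1norm Z <= d -> l1norm (expM (dy k Z) - 1) <= K * (dyadic R k * d).
  move=> Zd; have Z0 := l1norm_ge0 Z.
  have Z1 : dyadic R k * l1norm Z <= dyadic R k * d by rewrite ler_pM2l.
  apply: le_trans (expM_near1 _) _; rewrite l1norm_dy; first by nra.
  by rewrite ler_pM2l.
have AB : l1norm (expM (dy k X) *m expM (dy k Y) - 1) <= 10 * (K * (dyadic R k * d)).
  have -> : expM (dy k X) *m expM (dy k Y) - 1 =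
     (expM (dy k X) - 1) *m expM (dy k Y) + (expM (dy k Y) - 1).
    by rewrite mulmxBl mul1mx addrA subrK.
  have bX := bnd X Xd; have bY := bnd Y Yd.
  move: (K * _) bX bY => c bX bY.
  have -> : 10 * c = c * 9 + c by ring.
  apply: le_trans (l1normD _ _) (lerD _ bY); apply: le_trans (l1normM _ _) _.
  apply: ler_pM bX _; rewrite ?l1norm_ge0 //.
  exact: unitarymx_l1norm (SU3_unitary Y3).
have := @l1norm_subX R 3 (expM (dy k X) *m expM (dy k Y)) 1 9 i.
rewrite expr1n => h; apply: le_lt_trans (h _ _) _.
- by move=> j _; apply: unitarymx_l1norm; apply: SU3_unitary; apply: SU3_exprn; exact: SU3_mul.
- by move=> j _; rewrite expr1n; apply: unitarymx_l1norm; apply: SU3_unitary; exact: SU3_1.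
have iD : i%:R * dyadic R k <= 1.
  by rewrite -[leRHS](dyadicV R k) ler_pM2r // ler_nat.
apply: (@le_lt_trans _ _ (i%:R * (9 * (10 * (K * (dyadic R k * d))) * 9))).
  by rewrite ler_wpM2l // ler_wpM2r // ler_wpM2l.
have Kd : 0 < K * d by rewrite mulr_gt0.
have iKd : i%:R * dyadic R k * (K * d) <= K * d by rewrite ler_piMl // ltW.
have -> : i%:R * (9 * (10 * (K * (dyadic R k * d))) * 9) =
  9 * (10 * (i%:R * dyadic R k * (K * d))) * 9 by ring.
by apply: aux Kd iKd _; rewrite !mulrA in de *.
Qed.

Section Small.
Variable d : R.
Hypothesis dS : rep_small d.

Lemma small_dy k X : l1norm X <= d -> l1norm (dy k X) <= d.
Proof.
move=> Xd; rewrite l1norm_dy; apply: le_trans Xd.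
by rewrite ler_piMl ?l1norm_ge0 // dyadic_le1.
Qed.

Lemma expM0 : expM (0 : M3) = 1.
Proof.
have := @expM_remainder R 0; rewrite l1norm0 expr0n mulr0 addr0 => h.
apply/eqP; rewrite -subr_eq0; apply/eqP/l1norm_eq0/eqP.
by rewrite eq_le h l1norm_ge0.
Qed.

Lemma su3_0 : su3 (0 : M3).
Proof. by split; rewrite ?mxtrace0 // oppr0 trmx0 map_mx0. Qed.

Lemma small_exprn X k i : su3 X -> l1norm X <= d -> (i <= 2 ^ k)%N ->
  l1norm (sigma (expM (dy k X)) ^+ i - 1) <= 4^-1.
Proof.
move=> sX Xd ik; have [d0 dP] := dS.
have := dP X 0 sX su3_0 Xd _ k i ik.
rewrite scaler0 expM0 mulmx1 l1norm0 (rep_exprn rep) ?(ltW d0); first exact.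
by apply: expM_SU3; exact: dyZ.
Qed.

Lemma small_dyadic X k : su3 X -> l1norm X <= d ->
  l1norm (sigma (expM (dy k X)) - 1) <= (4 / 7) ^+ k * l1norm (sigma (expM X) - 1) /\
  l1norm (sigma (expM X) - 1 - dyadic_quotient X k)
    <= l1norm (sigma (expM X) - 1) ^+ 2.
Proof.
move=> sX Xd; have X3 : SU3 (expM (dy k X)) by apply: expM_SU3; exact: dyZ.
have E : sigma (expM (dy k X)) ^+ (2 ^ k) = sigma (expM X).
  by rewrite -(rep_exprn rep _ X3) (expM_dyadic_exprn _ sX).
have [i ik|a b] := dyadic_powers (F := sigma (expM (dy k X))) (k := k).
  by apply: small_exprn; rewrite // leq_exp2l.
rewrite E in a b; split; first exact: a.
apply: le_trans b _; rewrite ler_piMl ?exprn_ge0 ?l1norm_ge0 //.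
Qed.

Lemma small_sigma X : su3 X -> l1norm X <= d -> l1norm (sigma (expM X) - 1) <= 4^-1.
Proof.
move=> sX Xd; have := @small_exprn X 0 1 sX Xd isT.
by rewrite expr1 dyadic0 scale1r.
Qed.

(** By [dyadic_quotient_step] consecutive quotients differ by 2^k times a square of norm at most
    (4/7)^(2k), which is geometric of ratio 32/49. *)
Lemma small_quotient_cvg X : su3 X -> l1norm X <= d -> exists L, l1cvg (dyadic_quotient X) L.
Proof.
have aux (m : R) : 0 <= m -> m <= 4^-1 -> m * (4 / 7) <= 1 by lra.
move=> sX Xd; apply: (l1cvg_summable (a := geometric 1 (32 / 49))); last first.
  by apply: is_cvg_geometric_series; rewrite ger0_norm //; lra.
move=> k /=; rewrite mul1r.
have X3 : SU3 (expM (dy k.+1 X)) by apply: expM_SU3; exact: dyZ.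
have FF : sigma (expM (dy k X)) = sigma (expM (dy k.+1 X)) *m sigma (expM (dy k.+1 X)).
  rewrite -(rep_mul rep X3 X3) -(expM_scaleD _ _ sX); congr (sigma (expM (_%:C *: X))).
  by rewrite dyadicS.
rewrite [X in l1norm X](dyadic_quotient_step k FF).
rewrite l1normN l1normZ -(rmorph_nat (real_complex R)) normc_real ger0_norm //.
have a := (small_dyadic k.+1 sX Xd).1; have b := small_sigma sX Xd.
have c := l1norm_ge0 (sigma (expM X) - 1).
apply: (@le_trans _ _ ((2 ^ k)%:R * ((4 / 7) ^+ k) ^+ 2)); last by rewrite expr_32_49 natrX.
rewrite ler_wpM2l //; apply: le_trans (l1normM _ _) _; rewrite -expr2.
rewrite ler_pXn2r ?nnegrE ?l1norm_ge0 ?exprn_ge0 //; apply: le_trans a _.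
rewrite exprS mulrC mulrA ler_piMl ?exprn_ge0 //.
exact: aux.
Qed.

(** Shifting the sequence amounts to shrinking X, so a limit for small X gives one for every X in
    su(3). *)
Lemma quotient_shift X j : (fun k => dyadic_quotient X (k + j)%N) =
  (fun k => (2 ^ j)%:R *: dyadic_quotient (dy j X) k).
Proof.
apply/funext => k.
rewrite /dyadic_quotient dyadicD addnC scalerA -natrM -expnD.
by rewrite addnC [(k + j)%N]addnC.
Qed.

Lemma small_dy_ex X c : 0 < c -> exists j, l1norm (dy j X) <= c.
Proof.
move=> c0; have h : dyadic R k * l1norm X @[k --> \oo] --> (0 : R).
  by rewrite -(mul0r (l1norm X)); apply: cvgM; [exact: dyadic_cvg | exact: cvg_cst].
near \oo => j; exists j; rewrite l1norm_dy; near: j.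
exact: (cvgr_le _ h).
Unshelve. all: by end_near. Qed.

Lemma drep_eq X L : l1cvg (dyadic_quotient X) L -> drep X = L.
Proof.
move=> XL; apply: (l1cvg_unique _ XL).
exact: (@getPex _ [set L | l1cvg (dyadic_quotient X) L] (ex_intro _ L XL)).
Qed.

Lemma drep_cvg X : su3 X -> l1cvg (dyadic_quotient X) (drep X).
Proof.
move=> sX; have [j Xj] := small_dy_ex X dS.1.
have [L dL] := small_quotient_cvg (dyZ j sX) Xj.
have XL : l1cvg (dyadic_quotient X) ((2 ^ j)%:R *: L).
  by apply/(l1cvg_shift _ _ j); rewrite (quotient_shift X j); exact: l1cvgZ.
by rewrite (drep_eq XL).
Qed.

Lemma drep_dy X j : su3 X -> drep (dy j X) = (dyadic R j)%:C *: drep X.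
Proof.
move=> sX; apply: drep_eq.
have := l1cvgZ (dyadic R j)%:C ((l1cvg_shift _ _ j).1 (drep_cvg sX)).
have -> : (fun k => (dyadic R j)%:C *: dyadic_quotient X (k + j)%N) =
    dyadic_quotient (dy j X).
  rewrite -[LHS]/(fun k => (dyadic R j)%:C *: (fun k => dyadic_quotient X (k + j)%N) k).
  rewrite (quotient_shift X j); apply/funext => k.
  by rewrite scalerA dyadicCV scale1r.
exact.
Qed.

Lemma small_drep X : su3 X -> l1norm X <= d ->
  l1norm (drep X - (sigma (expM X) - 1)) <= l1norm (sigma (expM X) - 1) ^+ 2.
Proof.
move=> sX Xd; apply: l1cvg_bound (drep_cvg sX) (cvg_cst _) _; near=> k.
by rewrite l1norm_distC; exact: (small_dyadic k sX Xd).2.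
Unshelve. all: by end_near. Qed.

Lemma drep_le1 X : su3 X -> l1norm X <= d -> l1norm (drep X) <= 1.
Proof.
have aux (m e : R) : 0 <= m -> m <= 4^-1 -> e <= m ^+ 2 -> e + m <= 1.
  by rewrite expr2 => m0 m4 e2; have := mulr_ile1 m0 m0; nra.
move=> sX Xd; rewrite -[drep X](subrK (sigma (expM X) - 1)).
apply: le_trans (l1normD _ _) _; apply: (aux _ _ (l1norm_ge0 _) (small_sigma sX Xd)).
exact: small_drep.
Qed.

(** The estimate of [dyadic_powers] for the Trotter products: their 2^k-th powers tend to
    sigma(exp(X + Y)), their quotients to drep X + drep Y. *)
Lemma small_drepD X Y : su3 X -> su3 Y -> l1norm X <= d -> l1norm Y <= d ->
  l1norm (sigma (expM (X + Y)) - 1 - (drep X + drep Y))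
    <= l1norm (sigma (expM (X + Y)) - 1) ^+ 2.
Proof.
move=> sX sY Xd Yd; have sXY := su3D sX sY.
pose A k := expM (dy k X) *m expM (dy k Y).
have X3 k := expM_SU3 (dyZ k sX); have Y3 k := expM_SU3 (dyZ k sY).
have A3 k : SU3 (A k) by exact: SU3_mul.
have EA k : sigma (A k) ^+ (2 ^ k) = sigma (A k ^+ (2 ^ k)) by rewrite (rep_exprn rep).
have cA : l1cvg (fun k => sigma (A k) ^+ (2 ^ k)) (sigma (expM (X + Y))).
  under [X in l1cvg X]eq_fun do rewrite EA.
  exact: (rep_cvg rep (fun k => SU3_exprn (2 ^ k) (A3 k)) (expM_SU3 sXY) (trotter sX sY)).
have cQ : l1cvg (fun k => (2 ^ k)%:R *: (sigma (A k) - 1)) (drep X + drep Y).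
  have Y1 : l1cvg (fun k => sigma (expM (dy k Y))) 1.
    by rewrite -sigma1; exact: (rep_cvg rep Y3 (SU3_1 R) (expM_dyadic_cvg1 Y)).
  have := l1cvgD (l1cvgM (drep_cvg sX) Y1) (drep_cvg sY).
  rewrite mulmx1; congr l1cvg; apply/funext => k.
  rewrite /dyadic_quotient (rep_mul rep (X3 k) (Y3 k)) -scalemxAl -scalerDr.
  by rewrite mulmxBl mul1mx addrA subrK.
set S := sigma (expM (X + Y)).
have := l1cvgB (l1cvgB cA (l1cvg_cst 1)) cQ => cAll.
rewrite -[X in l1norm X <= _]subr0.
apply: (l1cvg_bound
  (b := fun k => (l1norm (sigma (A k) ^+ (2 ^ k) - S) + l1norm (S - 1)) ^+ 2) cAll).
  have ct : l1norm (sigma (A k) ^+ (2 ^ k) - S) + l1norm (S - 1)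
      @[k --> \oo] --> l1norm (S - 1).
    by rewrite -[X in _ --> X]add0r; apply: cvgD => //; exact: cvg_cst.
  by rewrite expr2; under eq_fun do rewrite expr2; exact: cvgM.
near=> k; rewrite subr0.
have [i ik|_ b] := dyadic_powers (F := sigma (A k)) (k := k).
  rewrite -(rep_exprn rep _ (A3 k)); apply: dS.2 => //; exact: leq_pexp2l.
apply: le_trans b _; apply: (@le_trans _ _ (l1norm (sigma (A k) ^+ (2 ^ k) - 1) ^+ 2)).
  by rewrite ler_piMl ?exprn_ge0 ?l1norm_ge0.
rewrite ler_pXn2r ?nnegrE ?addr_ge0 ?l1norm_ge0 //.
have -> : sigma (A k) ^+ (2 ^ k) - 1 = (sigma (A k) ^+ (2 ^ k) - S) + (S - 1).
  by rewrite addrA subrK.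
exact: l1normD.
Unshelve. all: by end_near. Qed.

(** When X and Y are halved, the defect of additivity scales by 1/2, whereas [small_drep] and
    [small_drepD] bound it by squares that scale by (4/7)^2 < 1/2; so it is 0. *)
Lemma small_additive X Y : su3 X -> su3 Y -> l1norm X <= d / 2 -> l1norm Y <= d / 2 ->
  drep (X + Y) = drep X + drep Y.
Proof.
move=> sX sY Xd Yd; have sXY := su3D sX sY; have d0 := dS.1.
have Xd' : l1norm X <= d by apply: le_trans Xd _; lra.
have Yd' : l1norm Y <= d by apply: le_trans Yd _; lra.
have XYd : l1norm (X + Y) <= d.
  by apply: le_trans (l1normD _ _) _; rewrite [leRHS]splitr lerD.
have aux (x a b m q : R) : 0 <= m -> 0 <= q -> x <= a + b -> a <= m ^+ 2 -> b <= m ^+ 2 ->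
   m <= q * 4^-1 -> x <= q ^+ 2 by move=> *; nra.
apply/eqP; rewrite -subr_eq0 -[_ - _]subr0; apply/eqP.
have cst := @l1cvg_cst R n n (drep (X + Y) - (drep X + drep Y)).
have c0 : (32 / 49 : R) ^+ k @[k --> \oo] --> (0 : R).
  by apply: cvg_expr; rewrite ger0_norm //; lra.
apply: l1norm_eq0; apply/eqP; rewrite eq_le l1norm_ge0 andbT.
apply: (l1cvg_bound cst c0); near=> k.
have Z : drep (dy k (X + Y)) - (drep (dy k X) + drep (dy k Y)) =
    (dyadic R k)%:C *: (drep (X + Y) - (drep X + drep Y)).
  rewrite [RHS]scalerBr [in RHS]scalerDr; congr (_ - (_ + _)); exact: drep_dy.
have := small_drep (dyZ k sXY) (small_dy k XYd).
have := small_drepD (dyZ k sX) (dyZ k sY) (small_dy k Xd') (small_dy k Yd').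
rewrite -(scalerDr (dyadic R k)%:C X Y); set S := sigma _ => hb ha.
rewrite expr_32_49 subr0 -(ler_pM2l (dyadic_gt0 R k)).
have -> : dyadic R k * (2 ^+ k * ((4 / 7) ^+ k) ^+ 2) = ((4 / 7) ^+ k) ^+ 2.
  by rewrite mulrA [dyadic R k * _]mulrC -natrX dyadicV mul1r.
have <- : l1norm (drep (dy k (X + Y)) - (drep (dy k X) + drep (dy k Y))) =
    dyadic R k * l1norm (drep (X + Y) - (drep X + drep Y)).
  apply: etrans (congr1 (@l1norm R n n) Z) _; rewrite l1normZ normc_real ger0_norm //.
  exact: ltW (dyadic_gt0 R k).
apply: (aux _ _ _ _ _ (l1norm_ge0 (S - 1)) _ _ ha hb); first exact: exprn_ge0.
  exact: l1norm_triangle.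
apply: le_trans (small_dyadic k sXY XYd).1 _; rewrite ler_wpM2l ?exprn_ge0 //.
exact: small_sigma.
Unshelve. all: by end_near. Qed.

Lemma drepD X Y : su3 X -> su3 Y -> drep (X + Y) = drep X + drep Y.
Proof.
move=> sX sY; have d0 := dS.1.
have d2 : 0 < d / 2 by rewrite divr_gt0.
have [i Xi] := small_dy_ex X d2; have [j Yj] := small_dy_ex Y d2.
have sm (Z : M3) k l : l1norm (dy k Z) <= d / 2 -> l1norm (dy (k + l)%N Z) <= d / 2.
  move=> Zk; rewrite -(dyadicD l k Z) l1norm_dy; apply: le_trans Zk.
  by rewrite ler_piMl ?l1norm_ge0 // dyadic_le1.
have Yi := sm _ _ i Yj; have {}Xi := sm _ _ j Xi; rewrite addnC in Yi.
have := small_additive (dyZ _ sX) (dyZ _ sY) Xi Yi.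
rewrite -(scalerDr (dyadic R (i + j))%:C X Y).
rewrite (drep_dy _ (su3D sX sY)) (drep_dy _ sX) (drep_dy _ sY).
rewrite -scalerDr => /scalerI; apply.
by rewrite fmorph_eq0 gt_eqF // dyadic_gt0.
Qed.

End Small.
End Differential.

Global Opaque drep.

(** Meant for [a] the image of Ad(g) X, [x] that of X and [s] = sigma(g): divided by the time, the
    identity becomes the bracket relation in the limit. *)
Lemma conj_commutator (K : comNzRingType) m (a x s : 'M[K]_m) :
  a *m s = s *m x -> (a - x) *m s + x *m (s - 1) - (s - 1) *m x = 0.
Proof.
have -> : (1 : 'M[K]_m) = 1%:M by [].
move=> as_sx; rewrite !mulmxBl as_sx mulmxBr mulmx1 mul1mx.
by rewrite addrA subrK opprB addrA subrK subrr.
Qed.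

Lemma addrB_eq0 (V : zmodType) (a b c : V) : a + b - c = 0 -> a = c - b.
Proof. by move/eqP; rewrite subr_eq0 => /eqP <-; rewrite addrK. Qed.

Lemma l1cvgM1 (R : realType) m n (u : nat -> 'M[R[i]]_(m, n)) L v :
  l1cvg u L -> l1cvg v 1%:M -> l1cvg (fun k => u k *m v k) L.
Proof. by move=> uL v1; rewrite -[L]mulmx1; exact: l1cvgM. Qed.

(** * The differential as a homomorphism of real Lie algebras *)

Section LieAlgebraRepresentation.
Variables (R : realType) (n : nat) (sigma : 'M[R[i]]_3 -> 'M[R[i]]_n).
Hypothesis rep : representation sigma.
Local Notation M3 := ('M[R[i]]_3).
Local Notation dy k X := ((dyadic _ k)%:C *: X).
Local Notation drep := (drep sigma).
Implicit Types (X Y : M3).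

Lemma drep_add X Y : su3 X -> su3 Y -> drep (X + Y) = drep X + drep Y.
Proof. by have [d dS] := rep_small_ex rep; exact: (drepD rep dS). Qed.

Lemma drep_lim X : su3 X -> l1cvg (dyadic_quotient sigma X) (drep X).
Proof. by have [d dS] := rep_small_ex rep; exact: (drep_cvg rep dS). Qed.

Lemma drep_0 : drep 0 = 0.
Proof.
have := drep_add (su3_0 R) (su3_0 R); rewrite addr0 => /eqP.
by rewrite -subr_eq0 opprD addrA subrr sub0r oppr_eq0 => /eqP.
Qed.

Lemma drepN X : su3 X -> drep (- X) = - drep X.
Proof.
move=> sX; have := drep_add sX (su3N sX); rewrite subrr drep_0 => /esym/eqP.
by rewrite addrC addr_eq0 => /eqP.
Qed.

Lemma drepMn X m : su3 X -> drep (m%:R%:C *: X) = m%:R%:C *: drep X.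
Proof.
move=> sX; elim: m => [|m IH]; first by rewrite !scale0r drep_0.
rewrite -natr1 rmorphD !scalerDl (drep_add (su3Z _ sX) (su3Z _ sX)) IH.
by rewrite rmorph1 !scale1r.
Qed.

Lemma drep_bounded_segment X : su3 X -> exists M : R, forall t : R, 0 <= t <= 1 ->
  l1norm (drep (t%:C *: X)) <= M.
Proof.
move=> sX; have [d dS] := rep_small_ex rep; have [j Xj] := small_dy_ex X dS.1.
exists (2 ^ j)%:R => t /andP[t0 t1].
have Xt : l1norm (dy j (t%:C *: X)) <= d.
  rewrite scalerA mulrC -scalerA l1normZ normc_real ger0_norm //.
  by apply: le_trans Xj; rewrite ler_piMl ?l1norm_ge0.
have := drep_le1 rep dS (su3Z _ (su3Z t sX)) Xt.
rewrite (drep_dy rep dS _ (su3Z t sX)) l1normZ normc_real (ger0_norm (ltW (dyadic_gt0 R j))).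
by rewrite -(ler_pM2l (x := (2 ^ j)%:R)) ?ltr0n ?expn_gt0 // mulrA dyadicV mul1r mulr1.
Qed.

(** The defect [g] of homogeneity is additive and vanishes at the naturals, so its bound on [0, 1]
    holds on the whole half-line; as g(m t) = m g(t), it is 0. *)
Lemma drepZ_ge0 X t : su3 X -> 0 <= t -> drep (t%:C *: X) = t%:C *: drep X.
Proof.
move=> sX t0; have [M XM] := drep_bounded_segment sX.
pose g (s : R) := drep (s%:C *: X) - s%:C *: drep X.
have gD s s' : g (s + s') = g s + g s'.
  rewrite /g rmorphD !scalerDl (drep_add (su3Z _ sX) (su3Z _ sX)).
  by rewrite opprD addrACA.
have gn m : g m%:R = 0 by rewrite /g drepMn // subrr.
have gM (m : nat) s : g (m%:R * s) = m%:R%:C *: g s.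
  elim: m => [|m IH]; first by rewrite mul0r scale0r -[0]/(0%:R) gn.
  by rewrite -natr1 mulrDl mul1r gD IH rmorphD scalerDl rmorph1 scale1r.
have gb s : 0 <= s -> l1norm (g s) <= M + l1norm (drep X).
  move=> s0; have [m [r [r0 r1 ->]]] : exists m : nat, exists r, [/\ 0 <= r, r <= 1 & s = m%:R + r].
    exists (Num.truncn s), (s - (Num.truncn s)%:R).
    have /andP[h1 h2] := truncn_itv s0.
    by split; rewrite ?subr_ge0 // ?lerBlDr ?[_ + s]addrC ?subrKC //; rewrite addrC natr1 ltW.
  rewrite gD gn add0r /g; apply: le_trans (l1normB _ _) (lerD _ _).
    by apply: XM; rewrite r0.
  by rewrite l1normZ normc_real ger0_norm // ler_piMl ?l1norm_ge0.
have c0 : (m.+1%:R)^-1 * (M + l1norm (drep X)) @[m --> \oo] --> (0 : R).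
  rewrite -(mul0r (M + l1norm (drep X))); apply: cvgM; last exact: cvg_cst.
  exact: cvg_harmonic.
have : l1norm (g t) <= 0.
  apply: (cvgr_to_ge c0); near=> m.
  have := gb (m.+1%:R * t); rewrite gM l1normZ normc_real ger0_norm // => h.
  by rewrite -ler_pdivrMl ?invrK ?h ?mulr_ge0 // invr_gt0.
rewrite le_eqVlt ltNge l1norm_ge0 orbF => /eqP/l1norm_eq0/eqP.
by rewrite subr_eq0 => /eqP.
Unshelve. all: by end_near. Qed.

Lemma drepZ X t : su3 X -> drep (t%:C *: X) = t%:C *: drep X.
Proof.
move=> sX; have [t0|t0] := leP 0 t; first exact: drepZ_ge0.
have nt0 : 0 <= - t by rewrite oppr_ge0 ltW.
have := drepZ_ge0 sX nt0; rewrite rmorphN !scaleNr (drepN (su3Z t sX)).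
exact: oppr_inj.
Qed.

Lemma drep_bounded : exists2 K : R, 0 <= K &
  forall X, su3 X -> l1norm (drep X) <= K * l1norm X.
Proof.
have [d dS] := rep_small_ex rep; have d0 := dS.1.
exists d^-1; first by rewrite invr_ge0 ltW.
move=> X sX; have [X0|X0] := eqVneq (l1norm X) 0.
  by rewrite X0 mulr0 (l1norm_eq0 X0) drep_0 l1norm0.
have Xp : 0 < l1norm X by rewrite lt_def X0 l1norm_ge0.
have s0 : 0 < d / l1norm X by rewrite divr_gt0.
have Xd : l1norm ((d / l1norm X)%:C *: X) <= d.
  by rewrite l1normZ normc_real ger0_norm ?(ltW s0) // divfK.
have := drep_le1 rep dS (su3Z _ sX) Xd.
rewrite (drepZ _ sX) l1normZ normc_real ger0_norm ?(ltW s0) // => h.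
by rewrite mulrC -(ler_pM2l s0) mulrA divfK // divff // gt_eqF.
Qed.

Lemma drep_continuous (u : nat -> M3) X : (forall k, su3 (u k)) -> su3 X ->
  l1cvg u X -> l1cvg (fun k => drep (u k)) (drep X).
Proof.
move=> su sX uX; have [K K0 bK] := drep_bounded.
apply: (l1cvg_squeeze (b := fun k => K * l1norm (u k - X))).
  move=> k; rewrite -(drepN sX) -(drep_add (su k) (su3N sX)).
  exact: bK (su3D (su k) (su3N sX)).
by rewrite -(mulr0 K); apply: cvgM => //; exact: cvg_cst.
Qed.

Lemma drep_conj A B X : SU3 A -> SU3 B -> A *m B = 1%:M -> B *m A = 1%:M ->
  su3 X -> su3 (A *m X *m B) -> drep (A *m X *m B) *m sigma A = sigma A *m drep X.
Proof.
move=> A3 B3 AB BA sX sAX.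
apply: l1cvg_unique (l1cvgM (drep_lim sAX) (l1cvg_cst (sigma A))) _.
have := l1cvgM (l1cvg_cst (sigma A)) (drep_lim sX).
congr l1cvg; apply/funext => k; have X3 := expM_SU3 (su3Z (dyadic R k) sX).
rewrite /dyadic_quotient -scalemxAr -scalemxAl; congr (_ *: _).
have -> : dy k (A *m X *m B) = A *m (dy k X) *m B.
  by rewrite -scalemxAr -scalemxAl.
have -> : expM (A *m (dy k X) *m B) = A *m expM (dy k X) *m B.
  exact: expM_conj BA AB.
have -> : sigma (A *m expM (dy k X) *m B) = sigma A *m sigma (expM (dy k X)) *m sigma B.
  by rewrite (rep_mul rep (SU3_mul A3 X3) B3) (rep_mul rep A3 X3).
have BA' : sigma B *m sigma A = 1%:M.
  by rewrite -(rep_mul rep B3 A3) BA; case: rep.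
rewrite mulmxBl -[_ *m sigma B *m sigma A]mulmxA BA' mulmx1 mul1mx.
by rewrite [LHS]mulmxBr mulmx1.
Qed.

Lemma drep_Ad A X : SU3 A -> su3 X ->
  drep (A *m X *m A^t*) *m sigma A = sigma A *m drep X.
Proof.
move=> A3 sX; have uA := SU3_unitary A3.
have sAX := su3_conj uA sX.
have A3' : SU3 (A^t*).
  have := SU3_conj uA A3; rewrite -mulmxA; move/unitarymxP: uA => uA'.
  case: (A3) => uA dA _; split; first by rewrite trmxC_unitary; exact: uA.
  have := congr1 determinant uA'; rewrite det_mulmx dA mul1r det1; exact.
exact: drep_conj A3 A3' (unitarymxP uA) (unitarymx_tCmul uA) sX sAX.
Qed.

Lemma expM_mulN X : su3 X -> expM X *m expM (- X) = 1%:M.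
Proof.
move=> sX; have := expM_scaleD 1 (-1) sX.
by rewrite subrr rmorph0 scale0r expM0 rmorphN1 rmorph1 scale1r scaleN1r => <-.
Qed.

Lemma expM_adj X : su3 X -> (expM X)^t* = expM (- X).
Proof.
move=> sX; have uX := SU3_unitary (expM_SU3 sX).
by rewrite -[LHS]mulmx1 -(expM_mulN sX) mulmxA (unitarymx_tCmul uX) mul1mx.
Qed.

Lemma su3_bracket X Y : su3 X -> su3 Y -> su3 (Y *m X - X *m Y).
Proof.
case=> sX _ [sY _]; split; last by rewrite mxtraceD linearN /= mxtrace_mulC subrr.
rewrite linearB /= map_mxB !trmx_mul !map_mxM sX sY !mulmxN !mulNmx !opprK.
by rewrite opprB.
Qed.

(** Differentiates drep(g X g^-1) sigma(g) = sigma(g) drep(X) along g = exp(2^-k Y): [W] is the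
    difference quotient of the conjugation, and [drep] is continuous. *)
Lemma drep_bracket X Y : su3 X -> su3 Y ->
  drep (Y *m X - X *m Y) = drep Y *m drep X - drep X *m drep Y.
Proof.
move=> sX sY; have sB := su3_bracket sX sY; have sNY := su3N sY.
pose g k := expM (dy k Y).
have sYk k : su3 (dy k Y) by exact: su3Z.
have g3 k : SU3 (g k) by exact: expM_SU3.
have gX k : su3 (g k *m X *m (g k)^t*) by exact: su3_conj (SU3_unitary (g3 k)) sX.
have c2 k : ((2 ^ k)%:R : R)%:C = (2 ^ k)%:R by rewrite rmorph_nat.
pose W k := (2 ^ k)%:R *: (g k *m X *m (g k)^t* - X).
have WE k : drep (W k) = (2 ^ k)%:R *: (drep (g k *m X *m (g k)^t*) - drep X).
  rewrite /W -c2 (drepZ _ (su3D (gX k) (su3N sX))).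
  by rewrite (drep_add (gX k) (su3N sX)) (drepN sX).
have sW k : su3 (W k) by rewrite /W -c2; exact: su3Z (su3D (gX k) (su3N sX)).
have cg := expM_dyadic_cvg1 Y.
have gN k : (g k)^t* = expM (dy k (- Y)).
  by rewrite (expM_adj (sYk k)) scalerN.
have cW : l1cvg W (Y *m X - X *m Y).
  have := l1cvgD (l1cvgM (l1cvgM (expM_deriv Y) (l1cvg_cst X)) (expM_dyadic_cvg1 (- Y)))
    (l1cvgM (l1cvg_cst X) (expM_deriv (- Y))).
  rewrite mulmx1 mulmxN; congr l1cvg; apply/funext => k.
  rewrite /W gN -/(g k); move: (expM (dy k (- Y))) => h.
  rewrite -scalemxAr -!scalemxAl -scalerDr; congr (_ *: _).
  by rewrite mulmxBr mulmx1 !mulmxBl mul1mx addrA subrK.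
have c1 : l1cvg (fun k => drep (W k) *m sigma (g k)) (drep (Y *m X - X *m Y)).
  apply: l1cvgM1 (drep_continuous sW sB cW) _.
  have <- : sigma 1%:M = 1%:M by case: rep.
  exact: (rep_cvg rep g3 (SU3_1 R) cg).
have := l1cvgB (l1cvgD c1 (l1cvgM (l1cvg_cst (drep X)) (drep_lim sY)))
    (l1cvgM (drep_lim sY) (l1cvg_cst (drep X))).
have -> : (fun k => drep (W k) *m sigma (g k) + drep X *m dyadic_quotient sigma Y k
    - dyadic_quotient sigma Y k *m drep X) = fun=> 0.
  apply/funext => k; rewrite WE /dyadic_quotient -/(g k).
  rewrite -scalemxAr -!scalemxAl -scalerDr -scalerBr.
  by rewrite (conj_commutator (drep_Ad (g3 k) sX)) scaler0.
move=> h; exact: addrB_eq0 (l1cvg_unique h (l1cvg_cst 0)).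
Qed.

End LieAlgebraRepresentation.

(** * Estimates for invariant subspaces *)

Section InvariantSubspaces.
Variables (R : realType) (n : nat) (sigma : 'M[R[i]]_3 -> 'M[R[i]]_n).
Hypothesis rep : representation sigma.
Local Notation dy k X := ((dyadic _ k)%:C *: X).
Local Notation drep := (drep sigma).

Lemma l1norm_expr1D (C : 'M[R[i]]_n) i :
  l1norm ((1 + C) ^+ i - 1) <= expR (i%:R * l1norm C) - 1.
Proof.
have C0 := l1norm_ge0 C.
suff h : l1norm ((1 + C) ^+ i - 1) <= (1 + l1norm C) ^+ i - 1.
  apply: le_trans h _; rewrite lerD2r expRM_natl.
  by apply: lerXn2r; rewrite ?nnegrE ?addr_ge0 ?expR_ge0 ?expR_ge1Dx.
elim: i => [|i IH]; first by rewrite !expr0 subrr l1norm0 subrr.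
have -> : (1 + C) ^+ i.+1 - 1 = ((1 + C) ^+ i - 1) + ((1 + C) ^+ i - 1) *m C + C.
  have -> : (1 + C) ^+ i.+1 = (1 + C) ^+ i *m (1 + C) by rewrite exprSr.
  have -> : (1 + C) = 1%:M + C by [].
  rewrite mulmxDr mulmx1 mulmxBl mul1mx -[in RHS]addrA subrK.
  by rewrite addrAC.
rewrite exprSr mulrDr mulr1 [leRHS]addrAC.
have h1 := l1normM ((1 + C) ^+ i - 1) C.
apply: le_trans (l1normD _ _) _; apply: le_trans (lerD (l1normD _ _) (lexx _)) _.
set D := (1 + C) ^+ i - 1 in IH h1 *.
apply: (@le_trans _ _ (l1norm D + l1norm D * l1norm C + l1norm C)).
  by rewrite lerD2r lerD2l.
have := ler_wpM2r C0 IH; rewrite mulrBl mul1r => h2.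
apply: le_trans (lerD (lerD IH h2) (lexx _)) _.
by rewrite -[leLHS]addrA subrK.
Qed.

(** A subspace is the kernel of 1 minus a projection onto it, and this map is a matrix, hence
    continuous. *)
Lemma vspace_l1closed (U : {vspace 'cV[R[i]]_n}) (u : nat -> 'cV[R[i]]_n) v :
  (forall k, u k \in U) -> l1cvg u v -> v \in U.
Proof.
move=> uU uv; pose f : 'End('cV[R[i]]_n) := (\1 - projv U)%VF.
have fE w : (w \in U) = (f w == 0).
  rewrite add_lfunE opp_lfunE id_lfunE subr_eq0.
  by apply/idP/eqP => [/projv_id -> //|->]; rewrite memv_proj.
pose K : 'M[R[i]]_n := \matrix_(i, j) f (delta_mx j 0) i 0.
have fK w : f w = K *m w.
  rewrite {1}[w]matrix_sum_delta linear_sum; apply/matrixP => a b.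
  rewrite !mxE summxE; apply: eq_bigr => j _.
  by rewrite big_ord1 linearZ !mxE !ord1 mulrC.
rewrite fE fK; apply/eqP.
apply: l1cvg_unique (l1cvgM (l1cvg_cst K) uv) _.
have -> : (fun k => K *m u k) = fun=> 0; last exact: l1cvg_cst.
by apply/funext => k; rewrite -fK; apply/eqP; rewrite -fE.
Qed.

End InvariantSubspaces.

(** * Highest weight modules of sl_3 *)

Section JointEigenvectors.
Variables (F : fieldType) (V : vectType F) (I : eqType) (T : Type).
Variables (u : I -> V) (A : T -> {linear V -> V}) (lam : T -> I -> F).

(** Independence from pairwise separation: each pair of indices may be told apart by an operator of
    its own. *)
Lemma free_joint_eigenvectors (s : seq I) :
  uniq s -> (forall i, i \in s -> u i != 0) ->
  (forall t i, i \in s -> A t (u i) = lam t i *: u i) ->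
  (forall i j, i \in s -> j \in s -> i != j -> exists t, lam t i != lam t j) ->
  free [seq u i | i <- s].
Proof.
elim: s => [|i s IH] /=; first by rewrite nil_free.
case/andP=> nis us u0 Au sep.
rewrite free_cons IH ?andbT //; last 3 first.
- by move=> j js; apply: u0; rewrite inE js orbT.
- by move=> t j js; apply: Au; rewrite inE js orbT.
- by move=> j k js ks; apply: sep; rewrite inE ?js ?ks orbT.
have {sep} sep (j : I) : j \in s -> exists t, lam t i != lam t j.
  move=> js; apply: sep; rewrite ?inE ?eqxx ?js ?orbT //.
  by apply: contraNneq nis => ->.
have Aui t : A t (u i) = lam t i *: u i by apply: Au; rewrite inE eqxx.
have Aus t j : j \in s -> A t (u j) = lam t j *: u j.
  by move=> js; apply: Au; rewrite inE js orbT.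
(* A product of factors [A t - lam t j], with [t] separating i from j, kills each [u j] of the tail
   and multiplies [u i] by a nonzero scalar. *)
have [B [Bs [c c0 Bi]]] : exists B : 'End(V),
    (forall j, j \in s -> B (u j) = 0) /\ exists2 c, c != 0 & B (u i) = c *: u i.
  elim: s {us nis IH Au u0} sep Aus => [|j s IH] sep Aus.
    by exists \1%VF; split=> //; exists 1; rewrite ?oner_eq0 // id_lfunE scale1r.
  have [||B [Bs [c c0 Bi]]] := IH.
  - by move=> k ks; apply: sep; rewrite inE ks orbT.
  - by move=> t k ks; apply: Aus; rewrite inE ks orbT.
  have [t tij] := sep j (mem_head _ _).
  exists (B \o (linfun (A t) - lam t j *: \1))%VF; split=> [k|].
    rewrite inE comp_lfunE add_lfunE opp_lfunE scale_lfunE id_lfunE lfunE /=.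
    case/predU1P=> [->|ks]; first by rewrite Aus ?mem_head // subrr linear0.
    by rewrite Aus ?inE ?ks ?orbT // -scalerBl linearZ /= Bs // scaler0.
  exists ((lam t i - lam t j) * c).
    by rewrite mulf_neq0 // subr_eq0.
  rewrite comp_lfunE add_lfunE opp_lfunE scale_lfunE id_lfunE lfunE /= Aui.
  by rewrite -scalerBl linearZ /= Bi scalerA.
apply/negP=> uis.
have : u i \in lker B.
  apply: (subvP _ _ uis); apply/span_subvP => _ /mapP[j js ->].
  by rewrite memv_ker Bs.
rewrite memv_ker Bi scaler_eq0 (negbTE c0) /=.
by apply/negP/u0; rewrite mem_head.
Qed.

End JointEigenvectors.

Section Sl2.
Variables (F : numFieldType) (V : vectType F) (e f h : {linear V -> V}).
Hypothesis ef : forall u, e (f u) = f (e u) + h u.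
Hypothesis hf : forall u, h (f u) = f (h u) - f u *+ 2.

Section String.
Variables (x : F) (v : V).
Hypotheses (ev : e v = 0) (hv : h v = x *: v).

Lemma sl2_weight k : h (iter k f v) = (x - k%:R *+ 2) *: iter k f v.
Proof.
elim: k => [|k IH] /=; first by rewrite mul0rn subr0.
rewrite hf IH linearZ /= -[f _ *+ 2]scaler_nat -scalerBl; congr (_ *: _).
by rewrite -natr1; ring.
Qed.

Lemma sl2_raise k :
  e (iter k.+1 f v) = (k.+1%:R * (x - k%:R)) *: iter k f v.
Proof.
elim: k => [|k IH]; first by rewrite /= ef ev linear0 add0r hv subr0 mul1r.
rewrite iterS ef IH sl2_weight linearZ /= -scalerDl; congr (_ *: _).
by rewrite -!natr1; ring.
Qed.

Hypothesis v0 : v != 0.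

(** The nonzero vectors f^k v have distinct h-eigenvalues, so in finite dimension some power kills
    v; at the first such power [sl2_raise] forces the weight to be p. *)
Lemma sl2_nat : exists2 p : nat, x = p%:R & iter p.+1 f v = 0.
Proof.
have exk : exists k, iter k f v == 0.
  pose s := iota 0 (\dim (fullv : {vspace V})).+1.
  have [/allP s0|] := boolP (all (fun k => iter k f v != 0) s); last first.
    by case/allPn=> k _; rewrite negbK; exists k.
  have : free [seq iter k f v | k <- s].
    apply: (@free_joint_eigenvectors F V nat unit (fun k => iter k f v)
      (fun=> h) (fun _ k => x - k%:R *+ 2)) => //.
    - exact: iota_uniq.
    - by move=> _ k _; exact: sl2_weight.
    - move=> i j _ _ ij; exists tt; apply: contra ij => /eqP /addrI /oppr_inj.
      by rewrite -!mulrnA => /eqP; rewrite eqr_nat eqn_pmul2r.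
  rewrite /free size_map size_iota => /eqP d.
  have := dimvS (subvf <<[seq iter k f v | k <- s]>>%VS).
  by rewrite d ltnn.
have [[|p] /eqP fp min] := ex_minnP exk; first by case/negP: v0; apply/eqP.
exists p => //; apply/eqP; rewrite -subr_eq0.
have := sl2_raise p; rewrite fp linear0 => /esym/eqP.
rewrite scaler_eq0 mulf_eq0 pnatr_eq0 /= => /orP[//|/min].
by rewrite ltnn.
Qed.

End String.

Lemma sl2_string_end (m : nat) v : e v = 0 -> h v = m%:R *: v ->
  iter m.+1 f v = 0.
Proof.
move=> ev hv; have [->|v0] := eqVneq v 0.
  by elim: m.+1 => //= k ->; rewrite linear0.
by have [p /eqP] := sl2_nat ev hv v0; rewrite eqr_nat => /eqP ->.
Qed.

Lemma sl2_string_neq0 (m : nat) v k : e v = 0 -> h v = m%:R *: v ->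
  v != 0 -> (k <= m)%N -> iter k f v != 0.
Proof.
move=> ev hv v0; elim: k => // k IH km.
apply: contraNneq (IH (ltnW km)) => fk.
have := sl2_raise ev hv k; rewrite fk linear0 => /esym/eqP.
by rewrite scaler_eq0 mulf_eq0 pnatr_eq0 /= subr_eq0 eqr_nat gtn_eqF.
Qed.

(** Weight -1 is the one that the vector just beyond the range a <= p would have at b = 0. *)
Lemma sl2_neg1 v : e v = 0 -> h v = - v -> v = 0.
Proof.
move=> ev hv; apply/eqP/negPn/negP => v0.
have hv' : h v = (-1) *: v by rewrite hv scaleN1r.
have [p /eqP] := sl2_nat ev hv' v0.
by rewrite eq_sym -subr_eq0 opprK natr1 pnatr_eq0.
Qed.

End Sl2.

Lemma coord_vbasis_inj (F : fieldType) (V : vectType F) (x y : V) :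
  (forall i, coord (vbasis fullv) i x = coord (vbasis fullv) i y) -> x = y.
Proof.
move=> xy; rewrite (coord_vbasis (memvf x)) (coord_vbasis (memvf y)).
by apply: eq_bigr => i _; rewrite xy.
Qed.

(* Decides identities in a vector space by passing to coordinates. *)
Ltac module :=
  apply: coord_vbasis_inj => ?;
  rewrite ?(linearD, linearN, linearZ, linearMn, linear0) /=;
  rewrite -?[_ *: _]/(_ * _); ring.

(** Gelfand-Tsetlin patterns with rows (p+q, q, 0), (p+q-a, q-b) and (p+q-a-j). *)
Definition gt_index p q : seq (nat * nat * nat) :=
  [seq (ab, j) | ab <- [seq (a, b) | a <- iota 0 p.+1, b <- iota 0 q.+1],
                 j <- iota 0 (p - ab.1 + ab.2).+1].

Lemma mem_gt_index p q i : (i \in gt_index p q) =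
  [&& i.1.1 <= p, i.1.2 <= q & i.2 <= p - i.1.1 + i.1.2]%N.
Proof.
case: i => -[a b] j; rewrite /gt_index; apply/idP/and3P => H.
  have [[a' b'] /flatten_mapP[a1 ha hb] hj] := flatten_mapP H.
  case/mapP: hb hj => b1 hb [-> ->] /mapP[j' hj [-> -> ->]].
  by move: ha hb hj; rewrite !mem_iota !add0n !ltnS.
case: H => ap bq jm; apply/flatten_mapP; exists (a, b).
  apply/flatten_mapP; exists a; rewrite ?mem_iota ?ltnS //.
  by apply/mapP; exists b; rewrite ?mem_iota ?ltnS.
by apply/mapP; exists j; rewrite ?mem_iota ?ltnS.
Qed.

Lemma gt_index_uniq p q : uniq (gt_index p q).
Proof.
apply: allpairs_uniq_dep => [|ab _|]; last by case=> ? ? [? ?] _ _ [-> ->].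
  by apply: allpairs_uniq_dep => [|a _|]; rewrite ?iota_uniq // => -[? ?] [? ?] _ _ [-> ->].
exact: iota_uniq.
Qed.

Lemma big_gt_index (M : nmodType) p q (G : nat * nat * nat -> M) :
  \sum_(i <- gt_index p q) G i =
  \sum_(0 <= a < p.+1) \sum_(0 <= b < q.+1) \sum_(0 <= j < (p - a + b).+1) G (a, b, j).
Proof.
rewrite /gt_index big_allpairs_dep big_allpairs_dep /index_iota subn0.
by apply: eq_bigr => a _; apply: eq_bigr => b _; rewrite subn0.
Qed.

(** * The Gelfand-Tsetlin basis *)

Section Sl3.
Variables (F : numFieldType) (V : vectType F).
Variables (e1 f1 h1 e2 f2 h2 f3 : {linear V -> V}).
Hypotheses (ef11 : forall u, e1 (f1 u) = f1 (e1 u) + h1 u)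
  (ef22 : forall u, e2 (f2 u) = f2 (e2 u) + h2 u)
  (ef12 : forall u, e1 (f2 u) = f2 (e1 u))
  (ef21 : forall u, e2 (f1 u) = f1 (e2 u))
  (ef13 : forall u, e1 (f3 u) = f3 (e1 u) - f2 u)
  (ef23 : forall u, e2 (f3 u) = f3 (e2 u) + f1 u)
  (ff21 : forall u, f2 (f1 u) = f1 (f2 u) + f3 u)
  (ff31 : forall u, f3 (f1 u) = f1 (f3 u))
  (ff32 : forall u, f3 (f2 u) = f2 (f3 u))
  (hf11 : forall u, h1 (f1 u) = f1 (h1 u) - f1 u *+ 2)
  (hf12 : forall u, h1 (f2 u) = f2 (h1 u) + f2 u)
  (hf13 : forall u, h1 (f3 u) = f3 (h1 u) - f3 u)
  (hf21 : forall u, h2 (f1 u) = f1 (h2 u) + f1 u)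
  (hf22 : forall u, h2 (f2 u) = f2 (h2 u) - f2 u *+ 2)
  (hf23 : forall u, h2 (f3 u) = f3 (h2 u) - f3 u).

(* The Gelfand-Tsetlin lowering operator: it preserves the kernel of e1. *)
Definition gt_lower u := f3 (h1 u + u) + f1 (f2 u).
Local Notation z := gt_lower.

Lemma gt_lower_linear : linear z.
Proof.
move=> c u v; rewrite /gt_lower; module.
Qed.
HB.instance Definition _ := GRing.isLinear.Build F V V _ z gt_lower_linear.

Lemma e1_gt_lower u : e1 u = 0 -> (exists c, h1 u = c *: u) -> e1 (z u) = 0.
Proof.
move=> eu [c hu].
by rewrite /gt_lower linearD /= ef13 ef11 ef12 hf12 hu !linearD !linearZ /= eu; module.
Qed.

Lemma f2_gt_lower u : f2 (z u) = z (f2 u).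
Proof. by rewrite /gt_lower linearD ff21 -ff32 hf12; module. Qed.

Lemma h1_gt_lower u : h1 (z u) = z (h1 u) - z u.
Proof. rewrite /gt_lower linearD /= hf13 hf11 hf12; module. Qed.

(** The last term vanishes on joint eigenvectors of [h1] and [h2], to which this is applied. *)
Lemma h2_gt_lower u : h2 (z u) = z (h2 u) - z u + f3 (h2 (h1 u) - h1 (h2 u)).
Proof. rewrite /gt_lower linearD /= hf23 hf21 hf22; module. Qed.

Section HighestWeightVector.
Variables (p q : nat) (v : V).
Hypotheses (e1v : e1 v = 0) (e2v : e2 v = 0) (v0 : v != 0).
Hypotheses (h1v : h1 v = p%:R *: v) (h2v : h2 v = q%:R *: v).

(** Highest weight vectors for the sl_2 of [e1] and [f1]; each of them starts one string of the
    module restricted to it. *)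
Definition gt_top a b := iter a z (iter b f2 v).
Arguments gt_top : simpl never.
Local Notation w := gt_top.

Lemma gt_top_h1 a b : h1 (w a b) = (p%:R - a%:R + b%:R) *: w a b.
Proof.
rewrite /w; elim: a => [|a IH] /=.
  elim: b => [|b IH] /=; first by rewrite h1v subr0 addr0.
  by rewrite hf12 IH -natr1; module.
by rewrite h1_gt_lower IH -natr1; module.
Qed.

Lemma gt_top_h2 a b : h2 (w a b) = (q%:R - a%:R - b%:R *+ 2) *: w a b.
Proof.
have h2b : h2 (iter b f2 v) = (q%:R - b%:R *+ 2) *: iter b f2 v.
  exact: (sl2_weight hf22).
elim: a => [|a IH]; first by rewrite /w /= h2b subr0.
have -> : w a.+1 b = z (w a b) by [].
by rewrite h2_gt_lower IH gt_top_h1 !linearZ /= IH gt_top_h1 -natr1; module.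
Qed.

Lemma e1_gt_top a b : e1 (w a b) = 0.
Proof.
elim: a => [|a IH]; last first.
  by apply: e1_gt_lower => //; exists (p%:R - a%:R + b%:R); exact: gt_top_h1.
by rewrite /w /=; elim: b => //= b IH; rewrite ef12 IH linear0.
Qed.

Lemma f2_gt_top a b : f2 (w a b) = w a b.+1.
Proof. by rewrite /w; elim: a => //= a IH; rewrite f2_gt_lower IH. Qed.

Lemma gt_top_nat a b : (a <= p)%N -> h1 (w a b) = (p - a + b)%:R *: w a b.
Proof. by move=> ap; rewrite gt_top_h1 natrD natrB. Qed.

Lemma gt_top_eq0r a : w a q.+1 = 0.
Proof.
rewrite /w (sl2_string_end ef22 hf22 e2v h2v).
by elim: a => //= a ->; rewrite linear0.
Qed.

(** At b = 0 the vector is killed by [e1] and has h1-weight p - (p + 1) = -1; larger b follow by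
    applying [f2]. *)
Lemma gt_top_eq0l b : w p.+1 b = 0.
Proof.
elim: b => [|b IH]; last by rewrite -f2_gt_top IH linear0.
apply: (sl2_neg1 ef11 hf11); first exact: e1_gt_top.
by rewrite gt_top_h1 -natr1; module.
Qed.

Lemma f3_gt_top a b : (a <= p)%N ->
  (p - a + b).+1%:R *: f3 (w a b) = w a.+1 b - f1 (w a b.+1).
Proof.
move=> ap; have -> : w a.+1 b = z (w a b) by [].
by rewrite /gt_lower gt_top_nat // f2_gt_top -natr1; module.
Qed.

Lemma e2_gt_lower u m k : h1 u = m *: u -> h2 u = k *: u ->
  e2 (z u) = (m + 1) *: f3 (e2 u) + f1 (f2 (e2 u)) + (m + 1 + k) *: f1 u.
Proof.
by move=> hu ku; rewrite /gt_lower linearD /= ef23 ef21 ef22 ku hu; module.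
Qed.

(** The factor is nonzero for 0 < a <= p, so the nonvanishing at a - 1 carries over to a. *)
Lemma e2_gt_top0 a : (a <= p)%N ->
  e2 (w a 0) = (a * (p + q + 2 - a))%:R *: f1 (w a.-1 0).
Proof.
elim: a => [|a IH] ap; first by rewrite mul0n scale0r.
have -> : w a.+1 0 = z (w a 0) by [].
rewrite (e2_gt_lower (gt_top_h1 a 0) (gt_top_h2 a 0)) IH 1?ltnW //= !linearZ /=.
case: a ap {IH} => [|a] ap /=.
  rewrite !mul0n !scale0r !add0r mul1n natrB ?natrD; last by lia.
  by congr (_ *: _); ring.
rewrite ff21 ff31; have -> : w a.+1 0 = z (w a 0) by [].
rewrite /gt_lower gt_top_h1 !natrM !natrB ?natrD -?natr1; try lia.
by move: (w a 0) => u; module.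
Qed.

(** The coefficient of w a b is nonzero for b < q, which carries the nonvanishing from b to b + 1.
    The scalar [d] is left implicit, except that it is 0 at a = 0, where [a.-1] is only a default
    value. *)
Lemma e2_gt_topS a b : (a <= p)%N -> exists2 d, (a = 0%N -> d = 0) &
  e2 (w a b.+1) = (b.+1%:R * (q%:R - b%:R) * (p + b.+2)%:R
                    / (p - a + b.+2)%:R) *: w a b + d *: f1 (w a.-1 b.+1).
Proof.
have dw k d : (k = 0%N -> d = 0) ->
    d *: ((p%:R - k%:R + b%:R + 1 + 1) *: f3 (f1 (w k.-1 b.+1))
      + f1 (f2 (f1 (w k.-1 b.+1)))) = d *: f1 (w k b.+1).
  case: k => [->|k _] //; first by rewrite !scale0r.
  rewrite ff21 ff31; have -> : w k.+1 b.+1 = z (w k b.+1) by [].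
  by rewrite /gt_lower gt_top_h1 -!natr1 /=; move: (w k b.+1) => u; module.
elim: a => [|a IH] ap.
  exists 0 => //; rewrite scale0r addr0 subn0 mulfK ?pnatr_eq0 ?addnS //.
  exact: (sl2_raise ef22 hf22).
have [d d0 E] := IH (ltnW ap).
set c := (X in e2 _ = X *: _ + _) in E.
have -> : w a.+1 b.+1 = z (w a b.+1) by [].
rewrite (e2_gt_lower (gt_top_h1 a _) (gt_top_h2 a _)) E.
set M : F := (p - a + b).+1%:R.
have M0 : M != 0 by rewrite pnatr_eq0.
have fw : f3 (w a b) = M^-1 *: (w a.+1 b - f1 (w a b.+1)).
  by rewrite -f3_gt_top 1?ltnW // scalerA mulVf // scale1r.
have Mp : M = p%:R - a%:R + b%:R + 1 by rewrite /M -natr1 natrD natrB // ltnW.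
have -> : (p - a.+1 + b.+2)%:R = M :> F by congr _%:R; lia.
have Mc : c = b.+1%:R * (q%:R - b%:R) * (p + b.+2)%:R / (M + 1).
  by rewrite /c; congr (_ / _); rewrite /M natr1; congr _%:R; lia.
have M10 : M + 1 != 0 by rewrite natr1 pnatr_eq0.
have -> : b.+1%:R * (q%:R - b%:R) * (p + b.+2)%:R / M = c * (M + 1) / M.
  by rewrite Mc divfK.
exists (d + (M + 1 + q%:R - a%:R - b.+1%:R *+ 2) - c / M) => //=.
transitivity (c *: ((M + 1) *: f3 (w a b) + f1 (f2 (w a b))) +
   d *: ((M + 1) *: f3 (f1 (w a.-1 b.+1)) + f1 (f2 (f1 (w a.-1 b.+1)))) +
   (M + 1 + q%:R - a%:R - b.+1%:R *+ 2) *: f1 (w a b.+1)).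
  by rewrite Mp -!natr1; module.
have := dw a d d0; rewrite -Mp => ->; rewrite fw f2_gt_top.
have -> : (M + 1) *: (M^-1 *: (w a.+1 b - f1 (w a b.+1))) =
  ((M + 1) / M) *: w a.+1 b - (M^-1 + 1) *: f1 (w a b.+1).
  by rewrite scalerA scalerBr; congr (_ - _ *: _); rewrite mulrDl divff // mul1r addrC.
by move: (M + 1) (M^-1) (w a.+1 b) (w a b.+1) => M1 M' u u'; module.
Qed.

Lemma gt_top_neq0 a b : (a <= p)%N -> (b <= q)%N -> w a b != 0.
Proof.
move=> ap; elim: b => [_|b IH bq].
  elim: a ap => //= a IH ap.
  apply/eqP => wa0; have := e2_gt_top0 ap; rewrite wa0 linear0 => /esym/eqP.
  rewrite scaler_eq0 pnatr_eq0 muln_eq0 /= subn_eq0 leqNgt.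
  rewrite (_ : (a.+1 < _)%N) /=; last by lia.
  apply/negP; rewrite -[f1 _]/(iter 1 f1 (w a 0)).
  apply: (sl2_string_neq0 ef11 hf11 (e1_gt_top _ _) (gt_top_nat _ (ltnW ap))).
    exact: IH (ltnW ap).
  lia.
apply: contraNneq (IH (ltnW bq)) => wb0.
have [d d0] := e2_gt_topS b ap; rewrite wb0 linear0 => E.
(* [e1] kills w a b and turns the other term into a positive multiple of d w (a-1) (b+1), which is
   therefore 0; what remains contradicts the nonvanishing at b. *)
have := congr1 e1 E; rewrite linear0 linearD !linearZ /= e1_gt_top scaler0 add0r.
rewrite ef11 e1_gt_top linear0 add0r => /esym/eqP.
have dw : d *: h1 (w a.-1 b.+1) = 0 -> d *: w a.-1 b.+1 = 0.
  rewrite gt_top_nat; last by lia.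
  move/eqP; rewrite !scaler_eq0 pnatr_eq0 addnS /= => /orP[/eqP->|/eqP->].
    by rewrite scale0r.
  by rewrite scaler0.
move/eqP/dw => dw0; move: E.
rewrite -[d *: _]linearZ /= dw0 linear0 addr0 => /esym/eqP.
rewrite scaler_eq0 !mulf_eq0 invr_eq0 !pnatr_eq0 !addnS /= orbF subr_eq0.
by rewrite eqr_nat gtn_eqF.
Qed.

Definition gt_vector (i : nat * nat * nat) := iter i.2 f1 (w i.1.1 i.1.2).
Definition gt_basis := [seq gt_vector i | i <- gt_index p q].

Lemma gt_vector_eigen (i : nat * nat * nat) : i \in gt_index p q ->
  [/\ h1 (gt_vector i) = ((p - i.1.1 + i.1.2)%:R - i.2%:R *+ 2) *: gt_vector i,
      h2 (gt_vector i) = (q%:R - i.1.1%:R - i.1.2%:R *+ 2 + i.2%:R) *: gt_vector i &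
      (f1 \o e1) (gt_vector i) = (i.2 * ((p - i.1.1 + i.1.2).+1 - i.2))%:R *: gt_vector i].
Proof.
case: i => -[a b] j; rewrite mem_gt_index /gt_vector /= => /and3P[ap bq jm].
have h1w := gt_top_nat b ap; have e1w := e1_gt_top a b.
split; first exact: (sl2_weight hf11).
  elim: j {jm} => [|j IH] /=; first by rewrite gt_top_h2 addr0.
  by rewrite hf21 IH -natr1; module.
case: j jm => [|j] jm; first by rewrite /= e1w linear0 mul0n scale0r.
rewrite (sl2_raise ef11 hf11 e1w h1w) linearZ /=; congr (_ *: _).
by rewrite subSS natrM [X in _ = _ * X]natrB // ltnW.
Qed.

Lemma gt_basis_free : free gt_basis.
Proof.
pose A (t : option bool) : {linear V -> V} :=
  if t is Some b then if b then h1 else h2 else (f1 \o e1).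
pose lam (t : option bool) (i : nat * nat * nat) : F :=
  if t is Some b then
    if b then (p - i.1.1 + i.1.2)%:R - i.2%:R *+ 2
    else q%:R - i.1.1%:R - i.1.2%:R *+ 2 + i.2%:R
  else (i.2 * ((p - i.1.1 + i.1.2).+1 - i.2))%:R.
apply: (free_joint_eigenvectors (A := A) (lam := lam)).
- exact: gt_index_uniq.
- case=> -[a b] j; rewrite mem_gt_index /gt_vector /= => /and3P[ap bq jm].
  apply: (sl2_string_neq0 ef11 hf11 (e1_gt_top a b) (gt_top_nat b ap)) => //.
  exact: gt_top_neq0.
- by move=> t i /gt_vector_eigen[]; case: t => [[]|].
move=> [[a b] j] [[a' b'] j']; rewrite !mem_gt_index /=.
move=> /and3P[ap bq jm] /and3P[ap' bq' jm'] ij.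
have [E1|] := eqVneq (lam (Some true) (a, b, j)) (lam (Some true) (a', b', j'));
  last by exists (Some true).
have [E2|] := eqVneq (lam (Some false) (a, b, j)) (lam (Some false) (a', b', j'));
  last by exists (Some false).
exists None; apply: contra ij => /eqP E3.
have {}E1 : (p - a + b + j'.*2 = p - a' + b' + j.*2)%N.
  apply/eqP; rewrite -(eqr_nat F) -subr_eq0 !natrD -!muln2 !natrM.
  move/eqP: E1; rewrite /lam /= -subr_eq0 !natrD => /eqP E.
  by apply/eqP; rewrite -E; ring.
have {}E2 : (j + a' + b'.*2 = j' + a + b.*2)%N.
  apply/eqP; rewrite -(eqr_nat F) -subr_eq0 !natrD -!muln2 !natrM.
  move/eqP: E2; rewrite /lam /= -subr_eq0 => /eqP E.
  by apply/eqP; rewrite -E; ring.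
move/eqP: E3; rewrite /lam /= eqr_nat => /eqP E3.
(* With p - a + b = j + k, equal h1-weights fix k - j, and the third eigenvalue j (k + 1) is
   strictly increasing in j when k - j is fixed. *)
have jj : j = j'.
  have [k mk] : exists k, (p - a + b = j + k)%N.
    by exists (p - a + b - j)%N; rewrite subnKC.
  have [k' mk'] : exists k', (p - a' + b' = j' + k')%N.
    by exists (p - a' + b' - j')%N; rewrite subnKC.
  have E4 : (k + j' = k' + j)%N by lia.
  have {}E3 : (j * k.+1 = j' * k'.+1)%N.
    by move: E3; rewrite mk mk' -!addnS ![(_ + _.+1)%N]addnC !addnK.
  nia.
by apply/eqP; congr (_, _, _) => //; lia.
Qed.

(** The ranges exceed those of the basis by 1 and j is arbitrary: the extra vectors are 0, which
    spares the stability proof its boundary cases. *)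
Lemma mem_gt_span a b j : (a <= p.+1)%N -> (b <= q.+1)%N ->
  iter j f1 (w a b) \in <<gt_basis>>%VS.
Proof.
have i0 k : iter k f1 (0 : V) = 0 by elim: k => //= k ->; rewrite linear0.
rewrite leq_eqVlt => /predU1P[->|]; first by rewrite gt_top_eq0l i0 mem0v.
rewrite ltnS => ap.
rewrite leq_eqVlt => /predU1P[->|]; first by rewrite gt_top_eq0r i0 mem0v.
rewrite ltnS => bq.
have [jm|jm] := leqP j (p - a + b).
  apply: memv_span; apply/mapP; exists (a, b, j) => //.
  by rewrite mem_gt_index ap bq.
rewrite -(subnK jm) iterD (sl2_string_end ef11 hf11 (e1_gt_top a b)) ?i0 ?mem0v //.
exact: gt_top_nat.
Qed.

Lemma span_stable (g : {linear V -> V}) :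
  (forall i, i \in gt_index p q -> g (gt_vector i) \in <<gt_basis>>%VS) ->
  forall u, u \in <<gt_basis>>%VS -> g u \in <<gt_basis>>%VS.
Proof.
move=> gX u uX; have : u \in (linfun g @^-1: <<gt_basis>>)%VS; last first.
  by rewrite -memv_preim lfunE.
apply: (subvP _ _ uX); apply/span_subvP => _ /mapP[i iX ->].
by rewrite -memv_preim lfunE; exact: gX.
Qed.

Let iter_f1D j c x d y :
  iter j f1 (c *: x + d *: y) = c *: iter j f1 x + d *: iter j f1 y.
Proof. by elim: j => //= j ->; rewrite linearD !linearZ. Qed.

Lemma gt_span_stable u : u \in <<gt_basis>>%VS ->
  [/\ e1 u \in <<gt_basis>>%VS, f1 u \in <<gt_basis>>%VS,
      e2 u \in <<gt_basis>>%VS & f2 u \in <<gt_basis>>%VS].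
Proof.
move=> uX; split; apply: span_stable uX => -[[a b] j];
  rewrite mem_gt_index /gt_vector /= => /and3P[ap bq jm].
- case: j jm => [|j] jm; first by rewrite /= e1_gt_top mem0v.
  rewrite (sl2_raise ef11 hf11 (e1_gt_top a b) (gt_top_nat b ap)) memvZ //.
  by apply: mem_gt_span; lia.
- by rewrite -iterS; apply: mem_gt_span; lia.
- have -> : e2 (iter j f1 (w a b)) = iter j f1 (e2 (w a b)).
    by elim: j {jm} => //= j IH; rewrite ef21 IH.
  have f1w k l : (k <= p)%N -> (l <= q)%N ->
      iter j f1 (f1 (w k l)) \in <<gt_basis>>%VS.
    by move=> kp lq; rewrite -iterSr mem_gt_span //; lia.
  case: b bq jm => [|b] bq jm.
    rewrite e2_gt_top0 // -[_ *: _]addr0 -(scale0r 0) iter_f1D scale0r addr0.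
    by rewrite memvZ // f1w //; lia.
  have [d _ ->] := e2_gt_topS b ap.
  by rewrite iter_f1D memvD // memvZ ?f1w ?mem_gt_span //; lia.
(* Moving [f2] past f1^j leaves j terms with [f3], which [f3_gt_top] expresses through the basis
   after division by p - a + b + 1. *)
- have -> : f2 (iter j f1 (w a b)) =
      iter j f1 (f2 (w a b)) + j%:R *: iter j.-1 f1 (f3 (w a b)).
    elim: j {jm} => [|j IH] /=; first by rewrite scale0r addr0.
    rewrite ff21 IH !linearD /= !linearZ /=.
    have -> : f3 (iter j f1 (w a b)) = iter j f1 (f3 (w a b)).
      by elim: (j) => //= k IHk; rewrite ff31 IHk.
    case: j {IH} => [|j]; first by rewrite /= scale0r addr0 scale1r.
    by rewrite -(natr1 j.+1) /=; module.
  apply: memvD; first by rewrite f2_gt_top mem_gt_span // ltnW.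
  apply: memvZ.
  have M0 : (p - a + b).+1%:R != 0 :> F by rewrite pnatr_eq0.
  have -> : f3 (w a b) = (p - a + b).+1%:R^-1 *: w a.+1 b
      + - (p - a + b).+1%:R^-1 *: f1 (w a b.+1).
    by rewrite scaleNr -scalerBr -f3_gt_top // scalerA mulVf // scale1r.
  by rewrite iter_f1D memvD // memvZ // -?iterSr mem_gt_span //; lia.
Qed.

End HighestWeightVector.

Theorem gelfand_tsetlin (x y : F) (v : V) :
  e1 v = 0 -> e2 v = 0 -> h1 v = x *: v -> h2 v = y *: v -> v != 0 ->
  exists p q : nat, [/\ x = p%:R, y = q%:R, free (gt_basis p q v) &
    forall u, u \in <<gt_basis p q v>>%VS ->
    [/\ e1 u \in <<gt_basis p q v>>%VS, f1 u \in <<gt_basis p q v>>%VS,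
        e2 u \in <<gt_basis p q v>>%VS & f2 u \in <<gt_basis p q v>>%VS]].
Proof.
move=> e1v e2v h1v h2v v0.
have [p xp _] := sl2_nat ef11 hf11 e1v h1v v0.
have [q yq _] := sl2_nat ef22 hf22 e2v h2v v0.
exists p, q; rewrite xp in h1v; rewrite yq in h2v; split=> //.
  exact: gt_basis_free.
exact: gt_span_stable.
Qed.

End Sl3.

Lemma mxtrace_eigenbasis (F : fieldType) n (S : 'M[F]_n) (I : eqType)
    (s : seq I) (u : I -> 'cV[F]_n) (lam : I -> F) :
  basis_of fullv [seq u i | i <- s] ->
  (forall i, i \in s -> S *m u i = lam i *: u i) ->
  \tr S = \sum_(i <- s) lam i.
Proof.
move=> us Su.
case: s us Su => [|i0 s'].
  move=> us _; have n0 : n = 0%N.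
    have := eqP (basis_free us); rewrite (span_basis us) dimvf /dim /= muln1.
    exact.
  by rewrite big_nil /mxtrace big1 // => i; have := ltn_ord i; rewrite {2}n0.
set s := i0 :: s' => us Su.
pose m := size s.
pose X : m.-tuple 'cV[F]_n := Tuple (introT eqP (size_map u s)).
have uE (k : 'I_m) : X`_k = u (nth i0 s k) by rewrite (nth_map i0).
(* [m] equals n only propositionally, so the change of basis is typed as a rectangular matrix and
   both products with its inverse are computed. *)
pose B : 'M[F]_(n, m) := \matrix_(k, l) X`_l k 0.
pose B' : 'M[F]_(m, n) := \matrix_(l, k) coord X l (delta_mx k 0).
have colB l : col l B = X`_l.
  by apply/colP => k; rewrite !mxE.
have BB' : B *m B' = 1%:M.
  apply/matrixP => k l; rewrite !mxE.
  have := coord_span (X := X) (v := delta_mx l 0).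
  rewrite (span_basis us) memvf => /(_ isT) /matrixP /(_ k 0).
  rewrite !mxE eqxx andbT => ->; rewrite summxE; apply: eq_bigr => t _.
  by rewrite !mxE mulrC.
have B'B : B' *m B = 1%:M.
  apply/matrixP => k l; rewrite !mxE.
  have fX : free X by exact: basis_free us.
  rewrite (eq_sym k) -(coord_free l k fX).
  rewrite [in RHS](_ : X`_l = \sum_j X`_l j 0 *: delta_mx j 0); last first.
    by apply/colP => j; rewrite summxE (bigD1 j) //= big1 ?addr0 => [|t tj];
      rewrite !mxE ?eqxx ?mulr1 // eq_sym (negbTE tj) mulr0.
  by rewrite linear_sum; apply: eq_bigr => j _; rewrite linearZ !mxE mulrC.
pose D : 'M[F]_m := diag_mx (\row_k lam (nth i0 s k)).
have SB : S *m B = B *m D.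
  apply/matrixP => k l; rewrite mul_mx_diag !mxE.
  have := Su (nth i0 s l) (mem_nth _ (ltn_ord l)); rewrite -uE.
  move=> /matrixP /(_ k 0); rewrite !mxE mulrC => <-.
  by apply: eq_bigr => t _; rewrite !mxE.
rewrite -[S]mulmx1 -BB' mulmxA SB -mulmxA mxtrace_mulC -mulmxA B'B mulmx1.
rewrite mxtrace_diag (big_nth i0) big_mkord.
by apply: eq_bigr => k _; rewrite mxE.
Qed.

Lemma complex_scale_split (R : realType) m p (X Y X' Y' : 'M[R[i]]_(m, p)) (x y : R) :
  (x +i* y) *: (X + 'i *: Y) + (X' + 'i *: Y') =
  (x%:C *: X - y%:C *: Y + X') + 'i *: (x%:C *: Y + y%:C *: X + Y').
Proof.
apply/matrixP => i j; rewrite !mxE.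
case: (X i j) (Y i j) (X' i j) (Y' i j) => a1 a2 [b1 b2] [c1 c2] [d1 d2].
by apply/eqP; rewrite eq_complex /=; apply/andP; split; apply/eqP; ring.
Qed.

(** * The character of a representation *)

Section Complexification.
Variables (R : realType) (n : nat) (sigma : 'M[R[i]]_3 -> 'M[R[i]]_n).
Hypothesis rep : representation sigma.
Local Notation M3 := ('M[R[i]]_3).
Local Notation dy k X := ((dyadic _ k)%:C *: X).
Local Notation drep := (drep sigma).
Implicit Types (X Y Z W A : M3).

(** sigma(exp Z) is the limit of (1 + 2^-k drep Z)^(2^k) for small Z, subspaces are closed, and the
    exponential maps onto SU(3). *)
Lemma rep_stable (U : {vspace 'cV[R[i]]_n}) :
  (forall X u, su3 X -> u \in U -> drep X *m u \in U) ->
  forall A u, SU3 A -> u \in U -> sigma A *m u \in U.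
Proof.
move=> dU A u /expM_surj[X sX <-].
have [d dS] := rep_small_ex rep; have [j Zd] := small_dy_ex X dS.1.
have sZ := su3Z (dyadic R j) sX.
have Z3 := expM_SU3 sZ.
rewrite -(expM_dyadic_exprn j sX) (rep_exprn rep _ Z3).
move: ((dyadic R j)%:C *: X) sZ Z3 Zd => Z sZ Z3 Zd.
suff stab w : w \in U -> sigma (expM Z) *m w \in U.
  elim: (2 ^ j)%N u => [|k IH] w wU; first by rewrite expr0 mul1mx.
  have -> : sigma (expM Z) ^+ k.+1 = sigma (expM Z) ^+ k *m sigma (expM Z) by rewrite exprSr.
  by rewrite -mulmxA; apply/IH/stab.
move=> wU.
pose a k := sigma (expM (dy k Z)); pose b k := 1 + (dyadic R k)%:C *: drep Z.
pose N1 : R := l1norm (1 : 'M[R[i]]_n); pose e : R := expR (l1norm (drep Z)).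
pose K : R := N1 + (4^-1 + e).
have e0 : 0 < e by exact: expR_gt0.
have aK k i : (i <= 2 ^ k)%N -> l1norm (a k ^+ i) <= K.
  move=> ik; rewrite -[X in l1norm X](subrK 1) addrC; apply: le_trans (l1normD _ _) _.
  rewrite lerD2l; apply: le_trans (small_exprn rep dS sZ Zd ik) _.
  by rewrite lerDl ltW.
have bK k i : (i <= 2 ^ k)%N -> l1norm (b k ^+ i) <= K.
  move=> ik; rewrite -[X in l1norm X](subrK 1) addrC; apply: le_trans (l1normD _ _) _.
  rewrite lerD2l; apply: le_trans (l1norm_expr1D _ _) _.
  apply: (@le_trans _ _ e); last by rewrite lerDr invr_ge0.
  apply: (@le_trans _ _ (expR (i%:R * l1norm ((dyadic R k)%:C *: drep Z)))).
    by rewrite gerBl.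
  rewrite ler_expR l1normZ normc_real (ger0_norm (ltW (dyadic_gt0 R k))) mulrA.
  rewrite ler_piMl ?l1norm_ge0 // -[leRHS](dyadicV R k) ler_wpM2r ?(ltW (dyadic_gt0 R k)) //.
  by rewrite ler_nat.
have ab : l1cvg (fun k => (2 ^ k)%:R *: (a k - b k)) 0.
  have := l1cvgB (drep_lim rep sZ) (l1cvg_cst (drep Z)); rewrite subrr.
  congr l1cvg; apply/funext => k; rewrite /dyadic_quotient /b opprD addrA.
  by rewrite [RHS]scalerBr scalerA mulrC dyadicCV scale1r.
have := l1cvgB (l1cvg_cst (sigma (expM Z))) (l1cvg_subX aK bK ab).
rewrite subr0 => c.
have {}c : l1cvg (fun k => b k ^+ (2 ^ k)) (sigma (expM Z)).
  move: c; congr l1cvg; apply/funext => k.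
  rewrite /a -(rep_exprn rep _ (expM_SU3 (su3Z _ sZ))) (expM_dyadic_exprn _ sZ).
  by rewrite opprB addrC subrK.
apply: (vspace_l1closed _ (l1cvgM c (l1cvg_cst w))) => k.
elim: (2 ^ k)%N => [|i IH]; first by rewrite expr0 mul1mx.
have -> : b k ^+ i.+1 = b k *m b k ^+ i by rewrite exprS.
rewrite -mulmxA; move: (b k ^+ i *m w) IH => y yU.
rewrite /b mulmxDl mul1mx memvD // -scalemxAl memvZ //; exact: dU.
Qed.

(** sl_3 is su(3) + i su(3); the differential is extended complex-linearly through this
    splitting. *)
Definition skewRe Z : M3 := 2^-1 *: (Z - Z^t*).
Definition skewIm Z : M3 := (- 'i / 2) *: (Z + Z^t*).
Definition drepC Z : 'M[R[i]]_n := drep (skewRe Z) + 'i *: drep (skewIm Z).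

Lemma skew_split Z : \tr Z = 0 ->
  [/\ su3 (skewRe Z), su3 (skewIm Z) & Z = skewRe Z + 'i *: skewIm Z].
Proof.
move=> tZ.
have tZ' : \tr (Z^t*) = 0.
  have -> : \tr (Z^t*) = ((\tr Z)^*)%R.
    by rewrite /mxtrace rmorph_sum; apply: eq_bigr => i _; rewrite adjmxE.
  by rewrite tZ rmorph0.
split; [split|split|].
- apply/matrixP => i j; rewrite adjmxE !mxE.
  case: (Z i j) (Z j i) => a b [c e]; apply/eqP; rewrite eq_complex /=.
  by apply/andP; split; apply/eqP; field.
- by rewrite mxtraceZ mxtraceD linearN /= tZ tZ' subrr mulr0.
- apply/matrixP => i j; rewrite adjmxE !mxE.
  case: (Z i j) (Z j i) => a b [c e]; apply/eqP; rewrite eq_complex /=.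
  by apply/andP; split; apply/eqP; field.
- by rewrite mxtraceZ mxtraceD tZ tZ' addr0 mulr0.
apply/matrixP => i j; rewrite !mxE.
case: (Z i j) (Z j i) => a b [c e]; apply/eqP; rewrite eq_complex /=.
by apply/andP; split; apply/eqP; field.
Qed.

Lemma drepCE X Y : su3 X -> su3 Y -> drepC (X + 'i *: Y) = drep X + 'i *: drep Y.
Proof.
move=> sX sY.
have XE : skewRe (X + 'i *: Y) = X.
  apply/matrixP => i j; rewrite !mxE.
  have := congr1 (fun M : M3 => M i j) sX.1; have := congr1 (fun M : M3 => M i j) sY.1.
  rewrite !adjmxE [(- X) i j]mxE [(- Y) i j]mxE.
  case: (X i j) (X j i) (Y i j) (Y j i) => a b [c e] [a' b'] [c' e'].
  move=> /eqP; rewrite eq_complex /= => /andP[/eqP h1 /eqP h2].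
  move=> /eqP; rewrite eq_complex /= => /andP[/eqP h3 /eqP h4].
  have -> : c = - a by lra.
  have -> : e = b by lra.
  have -> : c' = - a' by lra.
  have -> : e' = b' by lra.
  by apply/eqP; rewrite eq_complex /=; apply/andP; split; apply/eqP; field.
have YE : skewIm (X + 'i *: Y) = Y.
  apply/matrixP => i j; rewrite !mxE.
  have := congr1 (fun M : M3 => M i j) sX.1; have := congr1 (fun M : M3 => M i j) sY.1.
  rewrite !adjmxE [(- X) i j]mxE [(- Y) i j]mxE.
  case: (X i j) (X j i) (Y i j) (Y j i) => a b [c e] [a' b'] [c' e'].
  move=> /eqP; rewrite eq_complex /= => /andP[/eqP h1 /eqP h2].
  move=> /eqP; rewrite eq_complex /= => /andP[/eqP h3 /eqP h4].
  have -> : c = - a by lra.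
  have -> : e = b by lra.
  have -> : c' = - a' by lra.
  have -> : e' = b' by lra.
  by apply/eqP; rewrite eq_complex /=; apply/andP; split; apply/eqP; field.
by rewrite /drepC XE YE.
Qed.

Lemma drepC_su3 X : su3 X -> drepC X = drep X.
Proof.
move=> sX; have := drepCE sX (su3_0 R).
by rewrite scaler0 addr0 (drep_0 rep) scaler0 addr0.
Qed.

Lemma drepC_lin (c : R[i]) Z W : \tr Z = 0 -> \tr W = 0 ->
  drepC (c *: Z + W) = c *: drepC Z + drepC W.
Proof.
move=> /skew_split[]; move: (skewRe Z) (skewIm Z) => X Y sX sY ->.
move=> /skew_split[]; move: (skewRe W) (skewIm W) => X' Y' sX' sY' ->.
case: c => x y.
rewrite complex_scale_split.
rewrite (drepCE (su3D (su3D (su3Z _ sX) (su3N (su3Z _ sY))) sX')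
  (su3D (su3D (su3Z _ sY) (su3Z _ sX)) sY')).
rewrite (drepCE sX sY) (drepCE sX' sY').
rewrite (drep_add rep (su3D (su3Z x sX) (su3N (su3Z y sY))) sX').
rewrite (drep_add rep (su3Z x sX) (su3N (su3Z y sY))) (drepN rep (su3Z y sY)).
rewrite (drep_add rep (su3D (su3Z x sY) (su3Z y sX)) sY').
rewrite (drep_add rep (su3Z x sY) (su3Z y sX)).
rewrite (drepZ rep x sX) (drepZ rep x sY) (drepZ rep y sX) (drepZ rep y sY).
by rewrite complex_scale_split.
Qed.

Lemma drepC_0 : drepC 0 = 0.
Proof. by rewrite drepC_su3 ?(drep_0 rep) //; exact: su3_0. Qed.

Lemma drepCZ c Z : \tr Z = 0 -> drepC (c *: Z) = c *: drepC Z.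
Proof.
by move=> tZ; have := drepC_lin c tZ (mxtrace0 _ _); rewrite drepC_0 !addr0.
Qed.

Lemma drepC_bracket Z W : \tr Z = 0 -> \tr W = 0 ->
  drepC (Z *m W - W *m Z) = drepC Z *m drepC W - drepC W *m drepC Z.
Proof.
have br m (X Y X' Y' : 'M[R[i]]_m) :
    (X + 'i *: Y) *m (X' + 'i *: Y') - (X' + 'i *: Y') *m (X + 'i *: Y) =
    (X *m X' - X' *m X - (Y *m Y' - Y' *m Y))
    + 'i *: (X *m Y' - Y' *m X + (Y *m X' - X' *m Y)).
  rewrite !mulmxDl !mulmxDr -!scalemxAl -!scalemxAr !scalerA -expr2 sqr_i !scaleN1r.
  move: (X *m X') (X' *m X) (Y *m Y') (Y' *m Y) => a1 a2 a3 a4.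
  move: (X *m Y') (Y' *m X) (Y *m X') (X' *m Y) => a5 a6 a7 a8.
  by apply/matrixP => i j; rewrite !mxE; ring.
move=> /skew_split[]; move: (skewRe Z) (skewIm Z) => X Y sX sY ->.
move=> /skew_split[]; move: (skewRe W) (skewIm W) => X' Y' sX' sY' ->.
have b X1 X2 : su3 X1 -> su3 X2 -> su3 (X1 *m X2 - X2 *m X1).
  by move=> s1 s2; exact: su3_bracket.
rewrite br (drepCE (su3D (b _ _ sX sX') (su3N (b _ _ sY sY')))
  (su3D (b _ _ sX sY') (b _ _ sY sX'))) (drepCE sX sY) (drepCE sX' sY').
rewrite (drep_add rep (b _ _ sX sX') (su3N (b _ _ sY sY'))) (drepN rep (b _ _ sY sY')).
rewrite (drep_add rep (b _ _ sX sY') (b _ _ sY sX')).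
rewrite (drep_bracket rep sX' sX) (drep_bracket rep sY' sY).
by rewrite (drep_bracket rep sY' sX) (drep_bracket rep sX' sY) -br.
Qed.

Lemma drepC_Ad A Z : SU3 A -> \tr Z = 0 ->
  drepC (A *m Z *m A^t*) *m sigma A = sigma A *m drepC Z.
Proof.
move=> A3 /skew_split[]; move: (skewRe Z) (skewIm Z) => X Y sX sY ->.
have uA := SU3_unitary A3.
have -> : A *m (X + 'i *: Y) *m A^t* = A *m X *m A^t* + 'i *: (A *m Y *m A^t*).
  by rewrite mulmxDr mulmxDl -scalemxAr -scalemxAl.
rewrite (drepCE (su3_conj uA sX) (su3_conj uA sY)) (drepCE sX sY) mulmxDl mulmxDr.
congr (_ + _); first exact: drep_Ad.
by rewrite -scalemxAl -scalemxAr; congr (_ *: _); exact: drep_Ad.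
Qed.

End Complexification.

Global Opaque drepC.

Lemma mulmx_commE (K : pzRingType) m p (a b c : 'M[K]_m) (u : 'M[K]_(m, p)) :
  c = a *m b - b *m a -> a *m (b *m u) = b *m (a *m u) + c *m u.
Proof. by move=> ->; rewrite mulmxBl !mulmxA addrC subrK. Qed.

Lemma sum_ord3 (U : nmodType) (G : 'I_3 -> U) : \sum_i G i = G 0 + G 1 + G 2%:R.
Proof.
rewrite !big_ord_recl big_ord0 addr0 addrA.
by congr (G _ + G _ + G _); apply: val_inj.
Qed.

Lemma mxtrace_delta (K : pzSemiRingType) m (i j : 'I_m) :
  \tr (delta_mx i j : 'M[K]_m) = (i == j)%:R.
Proof.
rewrite /mxtrace (bigD1 i) //= big1 => [|k ki]; rewrite mxE ?eqxx ?addr0 //.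
by rewrite (negbTE ki).
Qed.

(** * Modules of sl_3 in terms of matrix units *)

Section Sl3Action.
Variables (K : numFieldType) (V : vectType K) (op : 'M[K]_3 -> {linear V -> V}).
Hypothesis op_lin : forall (c : K) Z W u, \tr Z = 0 -> \tr W = 0 ->
  op (c *: Z + W) u = c *: op Z u + op W u.
Hypothesis op_bracket : forall Z W Y u, \tr Z = 0 -> \tr W = 0 ->
  Z *m W - W *m Z = Y -> op Z (op W u) = op W (op Z u) + op Y u.
Implicit Types (u : V).

Let o0 : 'I_3 := 0.
Let o1 : 'I_3 := 1.
Let o2 : 'I_3 := 2%:R.

Lemma ord3P (P : 'I_3 -> Prop) : P o0 -> P o1 -> P o2 -> forall i, P i.
Proof.
move=> P0 P1 P2 [[|[|[|m]]] hm] //.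
- by rewrite (_ : Ordinal hm = o0) //; exact: val_inj.
- by rewrite (_ : Ordinal hm = o1) //; exact: val_inj.
- by rewrite (_ : Ordinal hm = o2) //; exact: val_inj.
Qed.

Let E (i j : 'I_3) : 'M[K]_3 := delta_mx i j.
Let H1 := E o0 o0 - E o1 o1.
Let H2 := E o1 o1 - E o2 o2.

Lemma tr_E i j : i != j -> \tr (E i j) = 0.
Proof. by move=> ij; rewrite mxtrace_delta (negbTE ij). Qed.

Lemma tr_EE i j : \tr (E i i - E j j) = 0.
Proof. by rewrite mxtraceD linearN /= !mxtrace_delta !eqxx subrr. Qed.

Lemma op0 u : op 0 u = 0.
Proof.
have := op_lin 1 u (mxtrace0 _ _) (mxtrace0 _ _); rewrite !scale1r addr0 => /eqP.
by rewrite -subr_eq0 opprD addrA subrr sub0r oppr_eq0 => /eqP.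
Qed.

Lemma opZ c Z u : \tr Z = 0 -> op (c *: Z) u = c *: op Z u.
Proof. by move=> tZ; have := op_lin c u tZ (mxtrace0 _ _); rewrite op0 !addr0. Qed.

(** Listed in the order in which [gelfand_tsetlin] takes them, with the matrix unit (2, 0) as
    [f3]. *)
Lemma sl3_relations :
  [/\ (forall u, op (E o0 o1) (op (E o1 o0) u) = op (E o1 o0) (op (E o0 o1) u) + op H1 u),
      (forall u, op (E o1 o2) (op (E o2 o1) u) = op (E o2 o1) (op (E o1 o2) u) + op H2 u),
      (forall u, op (E o0 o1) (op (E o2 o1) u) = op (E o2 o1) (op (E o0 o1) u)),
      (forall u, op (E o1 o2) (op (E o1 o0) u) = op (E o1 o0) (op (E o1 o2) u)) &
      (forall u, op (E o0 o1) (op (E o2 o0) u) = op (E o2 o0) (op (E o0 o1) u) - op (E o2 o1) u)]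
  /\
  [/\ (forall u, op (E o1 o2) (op (E o2 o0) u) = op (E o2 o0) (op (E o1 o2) u) + op (E o1 o0) u),
      (forall u, op (E o2 o1) (op (E o1 o0) u) = op (E o1 o0) (op (E o2 o1) u) + op (E o2 o0) u),
      (forall u, op (E o2 o0) (op (E o1 o0) u) = op (E o1 o0) (op (E o2 o0) u)) &
      (forall u, op (E o2 o0) (op (E o2 o1) u) = op (E o2 o1) (op (E o2 o0) u))]
  /\
  [/\ (forall u, op H1 (op (E o1 o0) u) = op (E o1 o0) (op H1 u) - op (E o1 o0) u *+ 2),
      (forall u, op H1 (op (E o2 o1) u) = op (E o2 o1) (op H1 u) + op (E o2 o1) u) &
      (forall u, op H1 (op (E o2 o0) u) = op (E o2 o0) (op H1 u) - op (E o2 o0) u)]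
  /\
  [/\ (forall u, op H2 (op (E o1 o0) u) = op (E o1 o0) (op H2 u) + op (E o1 o0) u),
      (forall u, op H2 (op (E o2 o1) u) = op (E o2 o1) (op H2 u) - op (E o2 o1) u *+ 2) &
      (forall u, op H2 (op (E o2 o0) u) = op (E o2 o0) (op H2 u) - op (E o2 o0) u)].
Proof.
have z Z W u : \tr Z = 0 -> \tr W = 0 -> Z *m W - W *m Z = 0 ->
    op Z (op W u) = op W (op Z u).
  by move=> tZ tW b; rewrite (op_bracket _ tZ tW b) op0 addr0.
have c (c : K) Z W Y u : \tr Z = 0 -> \tr W = 0 -> \tr Y = 0 -> Z *m W - W *m Z = c *: Y ->
    op Z (op W u) = op W (op Z u) + c *: op Y u.
  by move=> tZ tW tY b; rewrite (op_bracket _ tZ tW b) opZ.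
have T i j : i != j -> \tr (E i j) = 0 := @tr_E i j.
have T1 : \tr H1 = 0 by exact: tr_EE.
have T2 : \tr H2 = 0 by exact: tr_EE.
have comm i j k l Y : (delta_mx i l *+ (j == k) - delta_mx k j *+ (l == i) = Y) ->
    E i j *m E k l - E k l *m E i j = Y.
  by rewrite /E !mul_delta_mx_cond.
have commD i j k l Y : (delta_mx i l *+ (i == k) - delta_mx j l *+ (j == k)
    - (delta_mx k i *+ (l == i) - delta_mx k j *+ (l == j)) = Y) ->
    (E i i - E j j) *m E k l - E k l *m (E i i - E j j) = Y.
  by rewrite /E mulmxBl mulmxBr !mul_delta_mx_cond.
split; [split|split; [split|split; split]] => u.
- by apply: op_bracket; rewrite ?T //; apply: comm; rewrite /= !mulr1n.
- by apply: op_bracket; rewrite ?T //; apply: comm; rewrite /= !mulr1n.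
- by apply: z; rewrite ?T //; apply: comm; rewrite /= !mulr0n subr0.
- by apply: z; rewrite ?T //; apply: comm; rewrite /= !mulr0n subr0.
- rewrite -scaleN1r; apply: c; rewrite ?T //; apply: comm.
  by rewrite /= mulr0n mulr1n sub0r scaleN1r.
- by apply: op_bracket; rewrite ?T //; apply: comm; rewrite /= mulr0n mulr1n subr0.
- by apply: op_bracket; rewrite ?T //; apply: comm; rewrite /= mulr0n mulr1n subr0.
- by apply: z; rewrite ?T //; apply: comm; rewrite /= !mulr0n subr0.
- by apply: z; rewrite ?T //; apply: comm; rewrite /= !mulr0n subr0.
- rewrite -scaler_nat -scaleNr; apply: c; rewrite ?T1 ?T //; apply: commD.
  by rewrite /= !mulr0n !mulr1n sub0r subr0 scaleNr scaler_nat mulr2n opprD.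
- apply: op_bracket; rewrite ?T1 ?T //; apply: commD.
  by rewrite /= ?(mulr0n, mulr1n, subr0, sub0r, opprK).
- rewrite -scaleN1r; apply: c; rewrite ?T1 ?T //; apply: commD.
  by rewrite /= ?(mulr0n, mulr1n, subr0, sub0r, opprK) scaleN1r.
- apply: op_bracket; rewrite ?T2 ?T //; apply: commD.
  by rewrite /= ?(mulr0n, mulr1n, subr0, sub0r, opprK).
- rewrite -scaler_nat -scaleNr; apply: c; rewrite ?T2 ?T //; apply: commD.
  by rewrite /= !mulr0n !mulr1n sub0r subr0 scaleNr scaler_nat mulr2n opprD.
- rewrite -scaleN1r; apply: c; rewrite ?T2 ?T //; apply: commD.
  by rewrite /= ?(mulr0n, mulr1n, subr0, sub0r, opprK) scaleN1r.
Qed.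

Lemma sl3_decomp (Z : 'M[K]_3) : \tr Z = 0 ->
  Z = Z o0 o1 *: E o0 o1 + (Z o1 o0 *: E o1 o0 + (Z o1 o2 *: E o1 o2 +
    (Z o2 o1 *: E o2 o1 + (Z o0 o2 *: E o0 o2 + (Z o2 o0 *: E o2 o0 +
    (Z o0 o0 *: H1 + (Z o0 o0 + Z o1 o1) *: H2)))))).
Proof.
rewrite /mxtrace sum_ord3 => tZ.
have {}tZ : Z o2 o2 = - (Z o0 o0 + Z o1 o1) by apply/eqP; rewrite -addr_eq0 addrC tZ.
apply/matrixP; apply: ord3P; apply: ord3P; rewrite !mxE /= ?tZ; ring.
Qed.

(** The four simple root vectors generate sl_3: the Cartan elements and the two remaining matrix
    units are brackets of them. *)
Lemma sl3_stable (U : {vspace V}) :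
  (forall u, u \in U -> [/\ op (E o0 o1) u \in U, op (E o1 o0) u \in U,
    op (E o1 o2) u \in U & op (E o2 o1) u \in U]) ->
  forall Z u, \tr Z = 0 -> u \in U -> op Z u \in U.
Proof.
move=> stab Z u tZ uU.
have h01 w : w \in U -> op (E o0 o1) w \in U by case/stab.
have h10 w : w \in U -> op (E o1 o0) w \in U by case/stab.
have h12 w : w \in U -> op (E o1 o2) w \in U by case/stab.
have h21 w : w \in U -> op (E o2 o1) w \in U by case/stab.
have T i j : i != j -> \tr (E i j) = 0 := @tr_E i j.
have br A B Y : \tr A = 0 -> \tr B = 0 -> A *m B - B *m A = Y ->
    (forall w, w \in U -> op A w \in U) -> (forall w, w \in U -> op B w \in U) ->
    op Y u \in U.
  move=> tA tB AB sA sB; have := op_bracket u tA tB AB => /eqP.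
  rewrite addrC -subr_eq => /eqP <-.
  by rewrite memvB //; [apply/sA/sB | apply/sB/sA].
have comm i j k l Y : (delta_mx i l *+ (j == k) - delta_mx k j *+ (l == i) = Y) ->
    E i j *m E k l - E k l *m E i j = Y.
  by rewrite /E !mul_delta_mx_cond.
have hH1 : op H1 u \in U.
  apply: (br (E o0 o1) (E o1 o0)) => //; rewrite ?T //.
  by apply: comm; rewrite /= !mulr1n.
have hH2 : op H2 u \in U.
  apply: (br (E o1 o2) (E o2 o1)) => //; rewrite ?T //.
  by apply: comm; rewrite /= !mulr1n.
have h02 : op (E o0 o2) u \in U.
  apply: (br (E o0 o1) (E o1 o2)) => //; rewrite ?T //.
  by apply: comm; rewrite /= mulr1n mulr0n subr0.
have h20 : op (E o2 o0) u \in U.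
  apply: (br (E o2 o1) (E o1 o0)) => //; rewrite ?T //.
  by apply: comm; rewrite /= mulr1n mulr0n subr0.
have T1 : \tr H1 = 0 by exact: tr_EE.
have T2 : \tr H2 = 0 by exact: tr_EE.
have lin c A B : \tr A = 0 -> \tr B = 0 -> op A u \in U -> op B u \in U ->
    \tr (c *: A + B) = 0 /\ op (c *: A + B) u \in U.
  move=> tA tB uA uB; split; first by rewrite mxtraceD mxtraceZ tA tB mulr0 addr0.
  by rewrite op_lin // memvD // memvZ.
have lst : \tr ((Z o0 o0 + Z o1 o1) *: H2) = 0 /\ op ((Z o0 o0 + Z o1 o1) *: H2) u \in U.
  by rewrite mxtraceZ T2 mulr0 opZ // memvZ.
have stp c i j B : i != j -> op (E i j) u \in U -> \tr B = 0 /\ op B u \in U ->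
    \tr (c *: E i j + B) = 0 /\ op (c *: E i j + B) u \in U.
  by move=> ij hu [tB uB]; apply: lin => //; exact: T.
rewrite [Z in op Z](sl3_decomp tZ).
set Z' := (X in op X); suff [] : \tr Z' = 0 /\ op Z' u \in U by [].
rewrite /Z'.
do 6!(apply: (stp _ _ _ _) => //; try by [exact: h01|exact: h10|exact: h12|exact: h21]).
exact: (lin _ _ _ T1 lst.1 hH1 lst.2).
Qed.

(** A torus element enters as an abstract operator [S] that rescales the lowering operators by r, s
    and r s. Each Gelfand-Tsetlin vector is homogeneous in them, so its eigenvalue under [S] is read
    off from its index. *)
Theorem sl3_character (x y : K) (v : V) :
  op (E o0 o1) v = 0 -> op (E o1 o2) v = 0 ->
  op H1 v = x *: v -> op H2 v = y *: v -> v != 0 ->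
  exists (p q : nat) (w : nat * nat * nat -> V), [/\ x = p%:R, y = q%:R,
    free [seq w i | i <- gt_index p q] /\ v \in <<[seq w i | i <- gt_index p q]>>%VS,
    forall Z u, \tr Z = 0 -> u \in <<[seq w i | i <- gt_index p q]>>%VS ->
      op Z u \in <<[seq w i | i <- gt_index p q]>>%VS &
    forall (S : {linear V -> V}) (c r s : K), S v = c *: v ->
      (forall u, S (op (E o1 o0) u) = r *: op (E o1 o0) (S u)) ->
      (forall u, S (op (E o2 o1) u) = s *: op (E o2 o1) (S u)) ->
      (forall u, S (op (E o2 o0) u) = (r * s) *: op (E o2 o0) (S u)) ->
      (forall u, S (op H1 u) = op H1 (S u)) ->
      forall i, S (w i) = (c * (r * s) ^+ i.1.1 * s ^+ i.1.2 * r ^+ i.2) *: w i].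
Proof.
have [[r1 r2 r3 r4 r5] [[r6 r7 r8 r9] [[r10 r11 r12] [r13 r14 r15]]]] := sl3_relations.
move=> e1v e2v h1v h2v v0.
have [p [q [xp yq fr st]]] := gelfand_tsetlin r1 r2 r3 r4 r5 r6 r7 r8 r9 r10 r11 r12
  r13 r14 r15 e1v e2v h1v h2v v0.
exists p, q, (gt_vector (op (E o1 o0)) (op H1) (op (E o2 o1)) (op (E o2 o0)) v).
split=> //; first split=> //.
- apply: memv_span; apply/mapP; exists (0%N, 0%N, 0%N); last by [].
  by rewrite mem_gt_index.
- by move=> Z u tZ; apply: sl3_stable.
move=> S c r s Sv S1 S2 S3 Sh [[a b] j] /=.
rewrite /gt_vector /=.
have Sz w k : S w = k *: w ->
    S (gt_lower (op (E o1 o0)) (op H1) (op (E o2 o1)) (op (E o2 o0)) w) =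
    (r * s * k) *: gt_lower (op (E o1 o0)) (op H1) (op (E o2 o1)) (op (E o2 o0)) w.
  move=> Sw; rewrite /gt_lower [LHS]linearD /= S3 S1 S2 [S (_ + _)]linearD /= Sh Sw.
  by module.
have Sw : S (gt_top (op (E o1 o0)) (op H1) (op (E o2 o1)) (op (E o2 o0)) v a b) =
    (c * (r * s) ^+ a * s ^+ b) *:
      gt_top (op (E o1 o0)) (op H1) (op (E o2 o1)) (op (E o2 o0)) v a b.
  rewrite /gt_top; elim: a => [|a IH].
    rewrite /= expr0 mulr1; elim: b => [|b IH]; first by rewrite expr0 mulr1.
    by rewrite /= S2 IH linearZ scalerA exprS; congr (_ *: _); rewrite mulrCA.
  rewrite !iterS (Sz _ _ IH); congr (_ *: _).
  by rewrite exprS; ring.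
elim: j => [|j IH] /=; first by rewrite Sw expr0 mulr1.
by rewrite S1 IH linearZ scalerA exprS; congr (_ *: _); rewrite mulrCA.
Qed.

End Sl3Action.

Section CharacterFormula.
Variables (R : realType) (n : nat) (sigma : 'M[R[i]]_3 -> 'M[R[i]]_n).
Hypothesis rep : representation sigma.
Local Notation M3 := ('M[R[i]]_3).
Local Notation C := (R[i]).
Local Notation dy k X := ((dyadic _ k)%:C *: X).
Implicit Types (u v : 'cV[C]_n) (t : 'I_3 -> R).

(** One entry of [expM_deriv] for a scalar matrix. *)
Lemma cis_deriv (x : R) :
  normc ((2 ^ k)%:R * (cis (dyadic R k * x) - 1) - 'i * x%:C) @[k --> \oo] --> (0 : R).
Proof.
apply: squeeze_cvgr (expM_deriv (idiag (fun=> x))); last exact: cvg_cst.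
near=> k; rewrite normc_ge0 /= idiagZ expM_idiag.
set A := (X in l1norm X); have := normc_le_l1norm A 0 0.
have -> // : A 0 0 = (2 ^ k)%:R * (cis (dyadic R k * x) - 1) - 'i * x%:C.
have ent (a : C) (D F G : M3) : (a *: (D - F) - G) 0 0 = a * (D 0 0 - F 0 0) - G 0 0.
  by rewrite !mxE.
have diag0 (d : 'rV[C]_3) : diag_mx d 0 0 = d 0 0 by rewrite mxE eqxx.
have one0 : (1 : M3) 0 0 = 1 by rewrite mxE eqxx.
by rewrite /A ent one0 /cisdiag /idiag !diag0 !mxE.
Unshelve. all: by end_near. Qed.

Lemma drep_weight t v (x : R) : \sum_i t i = 0 ->
  (forall y : R, sigma (cisdiag (fun i => y * t i)) *m v = cis (y * x) *: v) ->
  drep sigma (idiag t) *m v = ('i * x%:C) *: v.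
Proof.
move=> t0 tv; have st := idiag_su3 t0.
apply: l1cvg_unique (l1cvgM (drep_lim rep st) (l1cvg_cst v)) _.
apply: (l1cvg_squeeze (b := fun k =>
  normc ((2 ^ k)%:R * (cis (dyadic R k * x) - 1) - 'i * x%:C) * l1norm v)).
  move=> k; rewrite /dyadic_quotient idiagZ expM_idiag -scalemxAl.
  have -> : (1 : 'M[C]_n) = 1%:M by [].
  rewrite mulmxBl tv mul1mx.
  have -> : cis (dyadic R k * x) *: v - v = (cis (dyadic R k * x) - 1) *: v.
    by rewrite scalerBl scale1r.
  by rewrite scalerA -scalerBl l1normZ.
by rewrite -(mul0r (l1norm v)); apply: cvgM; [exact: cis_deriv | exact: cvg_cst].
Qed.

Lemma cisdiag_conj_delta t i j :
  cisdiag t *m delta_mx i j *m (cisdiag t)^t* = cis (t i - t j) *: delta_mx i j.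
Proof.
rewrite cisdiag_adj mul_mx_diag mul_diag_mx; apply/matrixP => k l; rewrite !mxE.
case: (eqVneq k i) => [->|_] /=; last by rewrite mulr0 mul0r mulr0.
case: (eqVneq l j) => [->|_] /=; last by rewrite mulr0 mul0r mulr0.
by rewrite !mulr1 cisD.
Qed.

Lemma sigma_root t i j u : \sum_i t i = 0 -> i != j ->
  sigma (cisdiag t) *m (drepC sigma (delta_mx i j) *m u) =
  cis (t i - t j) *: (drepC sigma (delta_mx i j) *m (sigma (cisdiag t) *m u)).
Proof.
move=> t0 ij; have trE : \tr (delta_mx i j : M3) = 0 by rewrite mxtrace_delta (negbTE ij).
have := drepC_Ad rep (cisdiag_SU3 t0) trE.
rewrite cisdiag_conj_delta (drepCZ rep _ trE) => h.
by rewrite [LHS]mulmxA -h -scalemxAl mulmxA -scalemxAl.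
Qed.

Lemma sigma_cartan t i j u : \sum_i t i = 0 ->
  sigma (cisdiag t) *m (drepC sigma (delta_mx i i - delta_mx j j) *m u) =
  drepC sigma (delta_mx i i - delta_mx j j) *m (sigma (cisdiag t) *m u).
Proof.
move=> t0; have trE : \tr (delta_mx i i - delta_mx j j : M3) = 0 by exact: tr_EE.
have := drepC_Ad rep (cisdiag_SU3 t0) trE.
have -> : cisdiag t *m (delta_mx i i - delta_mx j j) *m (cisdiag t)^t* =
    delta_mx i i - delta_mx j j.
  rewrite mulmxBr mulmxBl (cisdiag_conj_delta t i i) (cisdiag_conj_delta t j j).
  by rewrite [t i - t i]subrr [t j - t j]subrr cis0 !scale1r.
by move=> h; rewrite [LHS]mulmxA -h mulmxA.
Qed.

Definition coroot (i j : 'I_3) (k : 'I_3) : R := (k == i)%:R - (k == j)%:R.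

Lemma coroot_sum i j : \sum_k coroot i j k = 0.
Proof.
by rewrite sumrB (bigD1 i) //= (bigD1 (P := xpredT) j) //= !eqxx !big1 ?subrr //
  => k /negbTE ->.
Qed.

Lemma idiag_coroot i j : 'i *: (delta_mx i i - delta_mx j j : M3) = idiag (coroot i j).
Proof.
apply/matrixP => k l; rewrite !mxE /coroot.
case: (eqVneq k l) => [<-|kl]; rewrite /= ?mulr1n ?mulr0n.
  by rewrite !andbb rmorphB !rmorph_nat.
case: (eqVneq k i) => [ki|_]; case: (eqVneq k j) => [kj|_] //=;
  rewrite ?[l == _]eq_sym -?ki -?kj ?(negbTE kl) ?subrr ?mulr0 //.
Qed.

Hypothesis irr : irreducible sigma.

(** [m] is the weight of [v] as a function of the angles. The last two hypotheses say that its sum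
    with a simple root is no weight, so the simple raising operators kill [v]. *)
Theorem char_formula (m : ('I_3 -> R) -> R) v :
  v != 0 ->
  (forall t, \sum_i t i = 0 -> sigma (cisdiag t) *m v = cis (m t) *: v) ->
  (forall x t, \sum_i t i = 0 -> m (fun i => x * t i) = x * m t) ->
  (forall u, (forall t, \sum_i t i = 0 ->
     sigma (cisdiag t) *m u = cis (t 0 - t 1 + m t) *: u) -> u = 0) ->
  (forall u, (forall t, \sum_i t i = 0 ->
     sigma (cisdiag t) *m u = cis (t 1 - t 2%:R + m t) *: u) -> u = 0) ->
  exists p q : nat, [/\ m (coroot 0 1) = p%:R, m (coroot 1 2%:R) = q%:R &
    forall t, \sum_i t i = 0 -> \tr (sigma (cisdiag t)) =
      cis (m t) * weight_sum (cis (t 1 - t 0)) (cis (t 2%:R - t 1)) p q].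
Proof.
move=> v0 vm mZ m01 m12.
pose op (Z : M3) : {linear 'cV[C]_n -> 'cV[C]_n} := mulmx (drepC sigma Z).
have op_lin (c : C) Z W u : \tr Z = 0 -> \tr W = 0 ->
    op (c *: Z + W) u = c *: op Z u + op W u.
  move=> tZ tW; apply: etrans (congr1 (mulmx^~ u) (drepC_lin rep c tZ tW)) _.
  by rewrite /= mulmxDl -scalemxAl.
have op_br Z W Y u : \tr Z = 0 -> \tr W = 0 -> Z *m W - W *m Z = Y ->
    op Z (op W u) = op W (op Z u) + op Y u.
  by move=> tZ tW <-; exact: mulmx_commE (drepC_bracket rep tZ tW).
have e1v : op (delta_mx 0 1) v = 0.
  apply: m01 => t t0; rewrite /op /= (sigma_root _ t0) // (vm _ t0).
  by rewrite -scalemxAr scalerA -cisD.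
have e2v : op (delta_mx 1 2%:R) v = 0.
  apply: m12 => t t0; rewrite /op /= (sigma_root _ t0) // (vm _ t0).
  by rewrite -scalemxAr scalerA -cisD.
have hv i j : op (delta_mx i i - delta_mx j j) v = (m (coroot i j))%:C *: v.
  have c0 := coroot_sum i j.
  have := @drep_weight (coroot i j) v (m (coroot i j)) c0.
  have tE : \tr (delta_mx i i - delta_mx j j : M3) = 0 by exact: tr_EE.
  rewrite -(drepC_su3 rep (idiag_su3 c0)) -idiag_coroot (drepCZ rep _ tE) => h.
  have {}h := h _.
  have ci : ('i : C) != 0 by rewrite eq_complex /= oner_eq0 andbF.
  apply: (scalerI ci); rewrite /op /= scalemxAl h ?scalerA //.
  by move=> y; rewrite vm -?mulr_sumr ?c0 ?mulr0 // mZ.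
have [p [q [w [mp mq [fr vw] st ev]]]] :=
  sl3_character op_lin op_br e1v e2v (hv 0 1) (hv 1 2%:R) v0.
have toR (x : R) (k : nat) : x%:C = k%:R -> x = k%:R.
  by rewrite -(rmorph_nat (real_complex R)) => /complexI.
exists p, q; split; [exact: toR mp | exact: toR mq |].
move=> t t0.
set U := <<_>>%VS in vw st.
(* The span contains [v] and is stable under sl_3, hence under the group. *)
have Ufull : U = fullv.
  have [||//] := irr.2 U.
    move=> g u g3 uU; apply: (rep_stable rep) g3 uU => X u' sX u'U.
    by rewrite -(drepC_su3 rep sX); apply: st => //; case: sX.
  by move=> U0; move: vw; rewrite U0 memv0 (negbTE v0).
have bs : basis_of fullv [seq w i | i <- gt_index p q].
  by rewrite /basis_of fr andbT -/U Ufull.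
have s10 : forall u, mulmx (sigma (cisdiag t)) (op (delta_mx 1 0) u) =
    cis (t 1 - t 0) *: op (delta_mx 1 0) (sigma (cisdiag t) *m u).
  by move=> u; exact: sigma_root.
have s21 : forall u, mulmx (sigma (cisdiag t)) (op (delta_mx 2%:R 1) u) =
    cis (t 2%:R - t 1) *: op (delta_mx 2%:R 1) (sigma (cisdiag t) *m u).
  by move=> u; exact: sigma_root.
have s20 : forall u, mulmx (sigma (cisdiag t)) (op (delta_mx 2%:R 0) u) =
    (cis (t 1 - t 0) * cis (t 2%:R - t 1)) *: op (delta_mx 2%:R 0) (sigma (cisdiag t) *m u).
  move=> u; rewrite -cisD (_ : t 1 - t 0 + _ = t 2%:R - t 0); first exact: sigma_root.
  by rewrite addrC addrA subrK.
have sh : forall u, mulmx (sigma (cisdiag t)) (op (delta_mx 0 0 - delta_mx 1 1) u) =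
    op (delta_mx 0 0 - delta_mx 1 1) (sigma (cisdiag t) *m u).
  by move=> u; exact: sigma_cartan.
have evt := ev (mulmx (sigma (cisdiag t))) _ _ _ (vm t t0) s10 s21 s20 sh.
apply: etrans (mxtrace_eigenbasis bs (fun i _ => evt i)) _.
rewrite big_gt_index /weight_sum big_distrr; apply: eq_bigr => a _ /=.
rewrite big_distrr; apply: eq_bigr => b _ /=.
by rewrite /geom !big_distrr; apply: eq_bigr => j _ /=; rewrite !mulrA.
Qed.

End CharacterFormula.

(** * Maximal tori, roots and the Weyl group *)

Lemma conj_mulmx (K : pzSemiRingType) n (P Q A B : 'M[K]_n) : P *m Q = 1%:M ->
  (Q *m A *m P) *m (Q *m B *m P) = Q *m (A *m B) *m P.
Proof. by move=> PQ; rewrite -!mulmxA (mulmxA P) PQ mul1mx. Qed.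

Section MaximalTorus.
Variable R : realType.
Local Notation M3 := ('M[R[i]]_3).
Implicit Types (A B P X Y : M3) (t : 'I_3 -> R) (S T : set M3).

(** Reduces a commuting set of any size to a finite family for simultaneous triangularisation: among
    the finite subfamilies, one whose span has maximal dimension. *)
Lemma span_subset S : exists2 s : seq M3,
  {in s, forall A, S A} & forall A, S A -> A \in << s >>%VS.
Proof.
pose D k := `[< exists2 s : seq M3, {in s, forall A, S A} & \dim << s >> = k >].
have exD : exists k, D k.
  by exists 0%N; apply/asboolP; exists [::] => //; rewrite span_nil dimv0.
have leD k : D k -> (k <= 9)%N.
  by move=> /asboolP[s _ <-]; rewrite (leq_trans (dimvS (subvf _))) // dimvf.
case: (ex_maxnP exD leD) => k /asboolP[s sS dimk] maxk.
exists s => // A SA.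
have dA : (\dim <<A :: s>> <= k)%N.
  apply: maxk; apply/asboolP; exists (A :: s) => // B.
  by rewrite inE => /orP[/eqP ->//|/sS].
have /eqP sE : (<< s >> == <<A :: s>>)%VS.
  rewrite eqEdim dimk dA andbT; apply: sub_span => B Bs.
  by rewrite inE Bs orbT.
by rewrite sE memv_span ?mem_head.
Qed.

Lemma commuting_trig S :
  (forall A B, S A -> S B -> A *m B = B *m A) ->
  exists2 P : M3, P \is unitarymx &
    forall A, S A -> is_trig_mx (P *m A *m P^t*).
Proof.
move=> comS; have [s sS Ss] := span_subset S.
have [|P uP /allP/= Ptrig] := @cotrigonalization _ 3 s.
  by move=> A B /sS SA /sS SB; exact: comS.
exists P; first exact: uP.
have trig A : A \in s -> is_trig_mx (P *m A *m P^t*).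
  by move=> /Ptrig; rewrite /similar_to conjumx ?unitarymx_unit // invmx_unitary.
move=> A /Ss As; rewrite (coord_span (X := in_tuple s) As); apply/is_trig_mxP => i j ij.
rewrite mulmx_sumr mulmx_suml summxE big1 // => k _.
rewrite -scalemxAr -scalemxAl mxE.
have /trig/is_trig_mxP/(_ i j ij) -> : (in_tuple s)`_k \in s by rewrite mem_nth.
by rewrite mulr0.
Qed.

Lemma torus_diagonalizable T : torus T -> exists2 P, P \is unitarymx &
  forall A, T A -> exists a b,
    [/\ `|a| <= pi, `|b| <= pi & A = P^t* *m cisdiag (angles3 a b) *m P].
Proof.
case=> -[T3 _ _] [_ _ TV Tcom]; have [P uP Ptrig] := commuting_trig Tcom.
exists P; first exact: uP.
move=> A TA; have [uA _] := T3 _ TA.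
have uP' : P^t* \is unitarymx by rewrite trmxC_unitary; exact: uP.
have AE : A = P^t* *m (P *m A *m P^t*) *m P.
  by rewrite !mulmxA (unitarymx_tCmul uP) mul1mx -mulmxA (unitarymx_tCmul uP) mulmx1.
have D3 : SU3 (P *m A *m P^t*).
  by have := SU3_conj uP' (T3 _ TA); rewrite trmxCK.
(* The inverse of [A] lies in [T] and is its adjoint; its triangularity kills the entries on the
   other side of the diagonal. *)
have /is_diag_mxP/diag_mxP[d dE] : forall i j : 'I_3, i != j :> nat -> (P *m A *m P^t*) i j = 0.
  move=> i j; case: ltngtP => // [ij|ji] _; first exact: (is_trig_mxP (Ptrig _ TA)).
  have := is_trig_mxP (Ptrig _ (TV _ TA)) _ _ ji; rewrite (invmx_unitary uA).
  have -> : P *m A^t* *m P^t* = (P *m A *m P^t*)^t*.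
    by rewrite !trmx_mul !map_mxM trmxCK mulmxA.
  by rewrite adjmxE => /eqP; rewrite conjC_eq0 => /eqP.
have [|a [b [api bpi abE]]] := SU3_diag_mx (d := d); first by rewrite -dE.
exists a, b; split; [exact: api | exact: bpi | ].
have E1 := etrans dE abE.
have E2 := congr1 (fun M : M3 => P^t* *m M *m P) E1.
have E3 := etrans AE E2.
exact: E3.
Qed.

Lemma cisdiag_conj_continuous (V : topologicalType) (f : V -> 'I_3 -> R) P :
  (forall i, continuous (fun x => f x i)) ->
  continuous (fun x => P^t* *m cisdiag (f x) *m P).
Proof.
move=> cf x S /nbhs_l1norm[e e0 eS].
pose c y : R := \sum_i (`|cos (f y i) - cos (f x i)| + `|sin (f y i) - sin (f x i)|).
have cc : (fun y => l1norm (P^t*) * c y * l1norm P) @ x --> (0 : R).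
  have -> : 0 = l1norm (P^t*) * 0 * l1norm P by rewrite mulr0 mul0r.
  apply: cvgM; last exact: cvg_cst.
  apply: cvgM; first exact: cvg_cst.
  have -> : 0 = \sum_(i < 3) (`|cos (f x i) - cos (f x i)| + `|sin (f x i) - sin (f x i)|).
    by rewrite big1 // => i _; rewrite !subrr normr0 addr0.
  apply: cvg_big => [|i _]; first exact: add_continuous.
  apply: cvgD; apply: cvg_norm; apply: cvgB; try exact: cvg_cst.
    by apply: continuous_cvg; [exact: continuous_cos | exact: cf].
  by apply: continuous_cvg; [exact: continuous_sin | exact: cf].
suff: \forall y \near x, S (P^t* *m cisdiag (f y) *m P) by [].
near=> y; apply: eS; apply: (@le_lt_trans _ _ (l1norm (P^t*) * c y * l1norm P)); last first.
  near: y; exact: (cvgr_lt _ cc).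
rewrite -mulmxBl -mulmxBr; apply: le_trans (l1normM _ _) _.
apply: (ler_wpM2r (l1norm_ge0 _)); apply: le_trans (l1normM _ _) _.
apply: (ler_wpM2l (l1norm_ge0 _)); rewrite /l1norm; apply: ler_sum => i _.
rewrite (bigD1 i) //= big1 ?addr0 => [|j ji]; rewrite !mxE ?eqxx ?mulr1n.
  exact: normc_le_ReIm.
by rewrite eq_sym (negbTE ji) !mulr0n subrr normc0.
Unshelve. all: by end_near. Qed.

Definition diag_torus P : set M3 :=
  [set P^t* *m cisdiag t *m P | t in [set t : 'I_3 -> R | \sum_i t i = 0]].

Lemma eq_conj_cisdiag P t t' : t =1 t' ->
  P^t* *m cisdiag t *m P = P^t* *m cisdiag t' *m P.
Proof. by move=> /funext ->. Qed.

Section DiagTorus.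
Variable P : M3.
Hypothesis uP : P \is unitarymx.

Lemma diag_torus_mul t t' : (P^t* *m cisdiag t *m P) *m (P^t* *m cisdiag t' *m P) =
  P^t* *m cisdiag (fun i => t i + t' i) *m P.
Proof. by rewrite (conj_mulmx _ _ (unitarymxP uP)) cisdiagM. Qed.

Lemma diag_torus_torus : torus (diag_torus P).
Proof.
have sub3 : diag_torus P `<=` @SU3 R.
  by move=> _ [t /= t0 <-]; apply: (SU3_conj uP); exact: cisdiag_SU3.
have cis01 : cisdiag (fun=> 0) = 1%:M :> M3.
  by rewrite -[1%:M]diag_const_mx; congr diag_mx; apply/rowP => i; rewrite !mxE cis0.
have torus1 : P^t* *m cisdiag (fun=> 0) *m P = 1%:M.
  by rewrite cis01 mulmx1 (unitarymx_tCmul uP).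
split; split.
- exact: sub3.
(* Compactness: the two free angles can be reduced to [-pi, pi], so the torus is the continuous
   image of a square. *)
- pose f (ab : R * R) := P^t* *m cisdiag (angles3 ab.1 ab.2) *m P.
  have -> : diag_torus P = f @` (`[- pi, pi] `*` `[- pi, pi]).
    apply/seteqP; split=> [_ [t /= t0 <-]|_ [[a b] _ <-]]; last first.
      by exists (angles3 a b) => //; exact: angles3_sum.
    have [a [b [api bpi abE]]] := SU3_diag_mx (cisdiag_SU3 t0).
    rewrite -/(cisdiag t) in abE.
    exists (a, b); first by rewrite /= !in_itv /= -!ler_norml.
    by rewrite /f abE.
  apply: continuous_compact; last by apply: compact_setX; exact: segment_compact.
  apply: continuous_subspaceT; apply: cisdiag_conj_continuous => i.
  rewrite /angles3; case: (i == 0) => /= [ab|]; first exact: cvg_fst.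
  case: (i == 1) => /= ab; first exact: cvg_snd.
  by apply: cvgN; apply: cvgD; [exact: cvg_fst | exact: cvg_snd].
(* Connectedness: a union of one-parameter subgroups, all passing through 1. *)
- have -> : diag_torus P = \bigcup_(t in [set t : 'I_3 -> R | \sum_i t i = 0])
      [set P^t* *m cisdiag (fun i => x * t i) *m P | x in [set: R]].
    apply/seteqP; split=> [_ [t /= t0 <-]|_ [t /= t0 [x _ <-]]].
      exists t; first exact: t0.
      exists 1; first exact: I.
      by apply: eq_conj_cisdiag => i; exact: mul1r.
    by exists (fun i => x * t i) => //=; rewrite -mulr_sumr t0 mulr0.
  apply: bigcup_connected.
    exists 1%:M => t _; exists 0; first exact: I.
    by apply: etrans torus1; apply: eq_conj_cisdiag => i; exact: mul0r.
  move=> t _; apply: connected_continuous_connected.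
    by apply/connected_intervalP.
  apply: continuous_subspaceT; apply: cisdiag_conj_continuous => i x.
  by apply: cvgM; [exact: cvg_id | exact: cvg_cst].
- exists (fun=> 0); last exact: torus1.
  by rewrite /= big1.
- move=> _ _ [t /= t0 <-] [t' /= t'0 <-]; rewrite diag_torus_mul.
  by exists (fun i => t i + t' i) => //=; rewrite big_split /= t0 t'0 addr0.
- move=> A TA; have [uA _] := sub3 _ TA; rewrite (invmx_unitary uA).
  case: TA => t /= t0 <-; exists (fun i => - t i); first by rewrite /= sumrN t0 oppr0.
  by rewrite -cisdiag_adj !trmx_mul !map_mxM trmxCK mulmxA.
- move=> _ _ [t /= t0 <-] [t' /= t'0 <-]; 
  rewrite (diag_torus_mul t t') (diag_torus_mul t' t).
  by apply: eq_conj_cisdiag => i; exact: addrC.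
Qed.

End DiagTorus.

(** Diagonalisation puts [T] inside a full diagonal torus, and maximality gives equality. *)
Lemma maximal_torus_diag T : maximal_torus T ->
  exists2 P, P \is unitarymx & T = diag_torus P.
Proof.
case=> torT maxT; have [P uP PT] := torus_diagonalizable torT.
exists P; first exact: uP.
apply/esym/maxT; first exact: diag_torus_torus.
move=> A /PT[a [b [_ _ AE]]].
exists (angles3 a b); [exact: angles3_sum | exact: esym AE].
Qed.

Lemma det_cisdiag t : \det (cisdiag t) = cis (\sum_i t i).
Proof.
rewrite det_diag; under eq_bigr do rewrite mxE.
by rewrite !big_ord_recl !big_ord0 mulr1 addr0 !cisD.
Qed.

Lemma squeeze_cst0 (a : R) (b : nat -> R) : 0 <= a -> (forall k, a <= b k) ->
  b k @[k --> \oo] --> (0 : R) -> a = 0.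
Proof.
move=> a0 ab b0; apply/eqP; rewrite eq_le a0 andbT leNgt; apply/negP => agt0.
have [k _ /(_ k (leqnn k)) bk] : \forall k \near \oo, b k < a by exact: (cvgr_lt _ b0).
by have := ab k; rewrite leNgt bk.
Qed.

Lemma normc_ge_Re (z : R[i]) : `|complex.Re z| <= normc z.
Proof. by case: z => x y /=; rewrite -sqrtr_sqr ler_wsqrtr // lerDl sqr_ge0. Qed.

(** From Re (e^(ia) - 1) = - |e^(ia) - 1|^2 / 2: a rescaled chord of bounded length has real part of
    order 2^-k, whatever the angle. *)
Lemma Re_chord k (a : R) :
  let z := (2 ^ k)%:R * (cis a - 1) in
  complex.Re z = - (dyadic R k / 2 * normc z ^+ 2).
Proof.
have dN := dyadicV R k.
rewrite -(rmorph_nat (real_complex R)) /cis; move: dN; set N : R := (2 ^ k)%:R => dN.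
have -> : N%:C * (cos a +i* sin a - 1) = N * (cos a - 1) +i* (N * sin a).
  by apply/eqP; rewrite eq_complex /=; apply/andP; split; apply/eqP; ring.
have csE := cos2Dsin2 a.
rewrite /= sqr_sqrtr ?addr_ge0 ?sqr_ge0 //.
have -> : (N * (cos a - 1)) ^+ 2 + (N * sin a) ^+ 2 =
    N * N * (cos a ^+ 2 + sin a ^+ 2 + 1 - 2 * cos a) by ring.
have -> : dyadic R k / 2 * (N * N * (cos a ^+ 2 + sin a ^+ 2 + 1 - 2 * cos a)) =
  (N * dyadic R k) * (N * (cos a ^+ 2 + sin a ^+ 2 + 1 - 2 * cos a) / 2) by ring.
by rewrite csE dN; field.
Qed.

(** The angles at time x are not known to be continuous in x, so they are never followed. The
    difference quotients are diagonal, and the real parts of their diagonal vanish in the limit by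
    [Re_chord]. *)
Lemma one_parameter_cisdiag Y :
  (forall x : R, exists2 t, \sum_i t i = 0 & expM (x%:C *: Y) = cisdiag t) ->
  exists2 t, \sum_i t i = 0 & Y = idiag t.
Proof.
move=> expY.
pose u k := (2 ^ k)%:R *: (expM ((dyadic R k)%:C *: Y) - 1).
pose dl k := l1norm (u k - Y).
have uY : dl k @[k --> \oo] --> (0 : R) by exact: expM_deriv.
have uYe k i j : normc (Y i j) <= normc (u k i j) + dl k.
  have -> : Y i j = u k i j - (u k - Y) i j.
    by rewrite [(u k - Y) i j]mxE [(- Y) i j]mxE opprB addrC subrK.
  by rewrite (le_trans (normcB _ _)) // lerD2l; exact: normc_le_l1norm.
have uE k : exists t, u k = (2 ^ k)%:R *: (cisdiag t - 1).
  by have [t _ E] := expY (dyadic R k); exists t; rewrite /u E.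
have Yoff i j : i != j -> Y i j = 0.
  move=> ij; apply: eq0_normc; apply: (squeeze_cst0 (normc_ge0 _) _ uY) => k.
  have -> // : normc (Y i j) <= dl k.
  have [t ut] := uE k; have := uYe k i j.
  by rewrite ut !mxE (negbTE ij) !mulr0n subrr mulr0 normc0 add0r.
have YRe i : complex.Re (Y i i) = 0.
  apply/eqP; rewrite -normr_eq0; apply/eqP.
  pose b k := dyadic R k / 2 * (normc (Y i i) + dl k) ^+ 2 + dl k.
  apply: (squeeze_cst0 (b := b) (normr_ge0 _)); last first.
    have -> : 0 = 0 / 2 * (normc (Y i i) + 0) ^+ 2 + 0 :> R by rewrite !mul0r addr0.
    apply: (cvgD _ uY); apply: cvgM.
      by apply: cvgM; [exact: dyadic_cvg | exact: cvg_cst].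
    by apply: cvgM; apply: (cvgD _ uY); exact: cvg_cst.
  move=> k; have [t ut] := uE k.
  set z := u k i i.
  have zY : normc (z - Y i i) <= dl k.
    by have := normc_le_l1norm (u k - Y) i i; rewrite [(u k - Y) i i]mxE [(- Y) i i]mxE.
  have zn : normc z <= normc (Y i i) + dl k.
    have -> : z = Y i i + (z - Y i i) by rewrite addrC subrK.
    by rewrite (le_trans (le_normcD _ _)) // lerD2l.
  have [a za] : exists a, z = (2 ^ k)%:R * (cis a - 1).
    by exists (t i); rewrite /z ut !mxE eqxx mulr1n.
  have zz : complex.Re z = - (dyadic R k / 2 * normc z ^+ 2) by rewrite za; exact: Re_chord.
  have ReE : complex.Re (Y i i) = complex.Re z - complex.Re (z - Y i i).
    by rewrite raddfB /= opprB addrC subrK.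
  rewrite ReE (le_trans (ler_normB _ _)) // /b lerD //; last first.
    by rewrite (le_trans (normc_ge_Re _)).
  have d0 := dyadic_gt0 R k.
  rewrite zz normrN ger0_norm; last by rewrite mulr_ge0 ?exprn_ge0 ?normc_ge0 // divr_ge0 // ltW.
  rewrite ler_wpM2l ?divr_ge0 ?(ltW d0) // ler_pXn2r ?nnegrE ?normc_ge0 //.
  by rewrite (le_trans _ zn) ?normc_ge0.
have YE : Y = idiag (fun i => complex.Im (Y i i)).
  apply/matrixP => i j; rewrite !mxE; case: eqVneq => [->|ij]; last exact: Yoff.
  rewrite mulr1n; have := YRe j; case: (Y j j) => x y /= ->; by simpc.
exists (fun i => complex.Im (Y i i)); last exact: YE.
set s := \sum_i _.
(* The determinant is 1 at every time x; for s nonzero, x = pi / s would give -1 = 1. *)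
have cis_s x : cis (x * s) = 1 :> R[i].
  have [t t0] := expY x; rewrite YE idiagZ expM_idiag => /(congr1 (@determinant _ 3)).
  by rewrite !det_cisdiag t0 cis0 mulr_sumr.
apply/eqP; apply: contraT => s0.
have := cis_s (pi / s); rewrite divfK // /cis cospi sinpi => /eqP.
rewrite eq_complex /= => /andP[/eqP h _]; exfalso.
by move: (ltr01 (R := R)); rewrite -h oppr_gt0 ltr10.
Qed.

Lemma lie_algebra_diag P X : P \is unitarymx ->
  lie_algebra (diag_torus P) X <->
  exists2 t, \sum_i t i = 0 & X = P^t* *m idiag t *m P.
Proof.
move=> uP; have PP := unitarymxP uP; have PP' := unitarymx_tCmul uP.
have conjZ (x : R) (Z : M3) (A B : M3) : x%:C *: (A *m Z *m B) = A *m (x%:C *: Z) *m B.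
  by rewrite -scalemxAr scalemxAl.
split=> [LX|[t t0 ->] x]; last first.
  exists (fun i => x * t i); first by rewrite /= -mulr_sumr t0 mulr0.
  by rewrite conjZ idiagZ (expM_conj_idiag _ uP).
have [x|t t0 Yt] := @one_parameter_cisdiag (P *m X *m P^t*).
  have [t t0 E] := LX x; exists t; first exact: t0.
  rewrite conjZ (expM_conj _ PP' PP) -E.
  by rewrite !mulmxA PP mul1mx -mulmxA PP mulmx1.
exists t; first exact: t0.
by rewrite -Yt !mulmxA PP' mul1mx -mulmxA PP' mulmx1.
Qed.

End MaximalTorus.

(* Locked: unification otherwise unfolds these down to matrix products. *)
HB.lock Definition cartan (R : realType) (P : 'M[R[i]]_3) (t : 'I_3 -> R) : 'M[R[i]]_3 :=
  P^t* *m idiag t *m P.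

Definition angle (R : realType) (P X : 'M[R[i]]_3) (k : 'I_3) : R :=
  complex.Im ((P *m X *m P^t*) k k).

HB.lock Definition weight (R : realType) (P : 'M[R[i]]_3) (w : 'I_3 -> R) : 'M[R[i]]_3 -> R :=
  patch (fun=> 0) (lie_algebra (diag_torus P)) (fun X => \sum_k w k * angle P X k).

Section Weights.
Variables (R : realType) (P : 'M[R[i]]_3).
Hypothesis uP : P \is unitarymx.
Local Notation M3 := ('M[R[i]]_3).
Local Notation T := (diag_torus P).
Local Notation L := (lie_algebra (diag_torus P)).
Implicit Types (X Y : M3) (t w : 'I_3 -> R).

Local Notation cartan := (cartan P).
Local Notation angle := (angle P).
Local Notation weight := (weight P).

Lemma cartanE t : cartan t = P^t* *m idiag t *m P. Proof. by rewrite unlock. Qed.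

Lemma idiagD t t' : idiag (fun k => t k + t' k) = idiag t + idiag t' :> M3.
Proof.
by rewrite /idiag -linearD /=; congr diag_mx; apply/rowP => k; rewrite !mxE rmorphD mulrDr.
Qed.

Lemma cartanD t t' : cartan (fun k => t k + t' k) = cartan t + cartan t'.
Proof. by rewrite !cartanE idiagD mulmxDr mulmxDl. Qed.

Lemma cartanZ (x : R) t : cartan (fun k => x * t k) = x%:C *: cartan t.
Proof. by rewrite !cartanE -idiagZ -scalemxAr -scalemxAl. Qed.

Lemma cartan_conj t : P *m cartan t *m P^t* = idiag t.
Proof.
have PP := unitarymxP uP.
by rewrite !cartanE !mulmxA PP mul1mx -mulmxA PP mulmx1.
Qed.

Lemma angle_cartan t k : angle (cartan t) k = t k.
Proof.
rewrite /angle cartan_conj !mxE eqxx mulr1n /=; ring.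
Qed.

Lemma lie_algebra_cartan X : L X <-> exists2 t, \sum_k t k = 0 & X = cartan t.
Proof. by rewrite (lie_algebra_diag _ uP); split=> -[t t0 ->]; exists t; rewrite ?cartanE. Qed.

Lemma cartan_lie t : \sum_k t k = 0 -> L (cartan t).
Proof. by move=> t0; apply/lie_algebra_cartan; exists t. Qed.

Lemma weightE w t : \sum_k t k = 0 -> weight w (cartan t) = \sum_k w k * t k.
Proof.
move=> t0; rewrite unlock patchE mem_set; last exact: cartan_lie.
by apply: eq_bigr => k _; rewrite angle_cartan.
Qed.

Lemma weight_out w X : ~ L X -> weight w X = 0.
Proof. by move=> LX; rewrite unlock patchE memNset. Qed.

Lemma idual_cartan (f : M3 -> R) : (forall X, ~ L X -> f X = 0) ->
  (forall t t', \sum_k t k = 0 -> \sum_k t' k = 0 ->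
     f (cartan (fun k => t k + t' k)) = f (cartan t) + f (cartan t')) ->
  (forall x t, \sum_k t k = 0 -> f (cartan (fun k => x * t k)) = x * f (cartan t)) ->
  idual T f.
Proof.
move=> f0 fD fZ; split=> //.
  move=> _ _ /lie_algebra_cartan[t t0 ->] /lie_algebra_cartan[t' t'0 ->].
  by rewrite -cartanD; exact: fD.
by move=> x _ /lie_algebra_cartan[t t0 ->]; rewrite -cartanZ; exact: fZ.
Qed.

Lemma idual_ext (f g : M3 -> R) : idual T f -> idual T g ->
  (forall t, \sum_k t k = 0 -> f (cartan t) = g (cartan t)) -> f = g.
Proof.
move=> [_ _ f0] [_ _ g0] fg; apply/funext => X.
have [/lie_algebra_cartan[t t0 ->]|LX] := pselect (L X); first exact: fg.
by rewrite (f0 _ LX) (g0 _ LX).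
Qed.

Lemma sumD0 t t' : \sum_k t k = 0 -> \sum_k t' k = 0 -> \sum_k (t k + t' k) = 0 :> R.
Proof. by move=> t0 t'0; rewrite big_split /= t0 t'0 addr0. Qed.

Lemma sumZ0 (x : R) t : \sum_k t k = 0 -> \sum_k (x * t k) = 0.
Proof. by move=> t0; rewrite -mulr_sumr t0 mulr0. Qed.

Lemma idual0 : idual T 0.
Proof.
by split=> [X Y _ _|x X _|//]; [exact: esym (addr0 0) | exact: esym (mulr0 x)].
Qed.

Lemma weight_idual w : idual T (weight w).
Proof.
apply: idual_cartan => [X|t t' t0 t'0|x t t0]; first exact: weight_out.
  rewrite (weightE w (sumD0 t0 t'0)).
  rewrite (weightE w t0).
  rewrite (weightE w t'0).
  rewrite -big_split.
  rewrite /=.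
  by apply: eq_bigr => k _; exact: mulrDr.
rewrite (weightE w (sumZ0 x t0)) (weightE w t0) mulr_sumr.
by apply: eq_bigr => k _; exact: mulrCA.
Qed.

Lemma idual_weight f : idual T f -> exists w, f = weight w.
Proof.
move=> If; have [fD fZ _] := If.
(* The coordinates of a weight are determined up to a common constant; this choice makes the last
   one 0. *)
pose w (k : 'I_3) : R := f (cartan (coroot R k 2%:R)).
exists w; apply: idual_ext => // [|t t0]; first exact: weight_idual.
rewrite weightE // sum_ord3 /w.
have -> : cartan t = cartan (fun k => t 0 * coroot R 0 2%:R k + t 1 * coroot R 1 2%:R k).
  congr cartan; apply/funext; apply: ord3P; rewrite /coroot /=.
  - by ring.
  - by ring.
  - by move: t0; rewrite sum_ord3 => t0; lra.
have L2 j : L (cartan (coroot R j 2%:R)) by apply: cartan_lie; exact: coroot_sum.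
have c2 : f (cartan (coroot R 2%:R 2%:R)) = 0.
  rewrite (_ : coroot R 2%:R 2%:R = fun k => 0 * coroot R 0 2%:R k).
    by rewrite cartanZ (fZ _ _ (L2 _)) mul0r.
  by apply/funext => k; rewrite /coroot subrr mul0r.
rewrite cartanD fD; first last.
- by apply: cartan_lie; apply: sumZ0; exact: coroot_sum.
- by apply: cartan_lie; apply: sumZ0; exact: coroot_sum.
rewrite (cartanZ (t 0)).
rewrite (cartanZ (t 1)).
rewrite (fZ (t 0) _ (L2 0)).
rewrite (fZ (t 1) _ (L2 1)).
rewrite c2.
rewrite mul0r addr0.
by rewrite mulrC; congr (_ + _); exact: mulrC.
Qed.

Lemma weightD v w : weight (fun k => v k + w k) = weight v + weight w.
Proof.
apply/funext => X; rewrite [RHS]/GRing.add /=.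
have [/lie_algebra_cartan[t t0 ->]|LX] := pselect (L X); last by rewrite !weight_out ?addr0.
rewrite (weightE _ t0) (weightE v t0) (weightE w t0) -big_split.
by apply: eq_bigr => k _; exact: mulrDl.
Qed.

Lemma weightZ (x : R) w : weight (fun k => x * w k) = x *: weight w.
Proof.
apply/funext => X; rewrite [RHS]/GRing.scale /=.
have [/lie_algebra_cartan[t t0 ->]|LX] := pselect (L X); last first.
  by rewrite !weight_out //; exact: esym (mulr0 _).
rewrite (weightE _ t0) (weightE w t0) [RHS]mulr_sumr.
by apply: eq_bigr => k _; exact: esym (mulrA _ _ _).
Qed.

Lemma weightN w : weight (fun k => - w k) = - weight w.
Proof.
rewrite -scaleN1r -weightZ; congr weight; apply/funext => k; exact: esym (mulN1r _).
Qed.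

Lemma coroot_dot w j k : \sum_l w l * coroot R j k l = w j - w k.
Proof.
under eq_bigr do rewrite mulrBr.
rewrite sumrB; congr (_ - _).
  by rewrite (bigD1 j) //= eqxx mulr1 big1 ?addr0 // => l /negbTE ->; rewrite mulr0.
by rewrite (bigD1 k) //= eqxx mulr1 big1 ?addr0 // => l /negbTE ->; rewrite mulr0.
Qed.

Lemma dot_coroot t j k : \sum_l coroot R j k l * t l = t j - t k.
Proof. by rewrite -coroot_dot; apply: eq_bigr => l _; exact: mulrC. Qed.

Lemma weight_coroot w j k : weight w (cartan (coroot R j k)) = w j - w k.
Proof. by rewrite (weightE w (coroot_sum R j k)); exact: coroot_dot. Qed.

Definition std_root j k : M3 -> R := weight (coroot R j k).

Lemma std_rootE t j k : \sum_l t l = 0 -> std_root j k (cartan t) = t j - t k.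
Proof. by move=> t0; rewrite /std_root (weightE _ t0); exact: dot_coroot. Qed.

Lemma std_rootN j k : std_root k j = - std_root j k.
Proof.
rewrite /std_root -weightN; congr weight; apply/funext => l.
by rewrite /coroot opprB.
Qed.

Lemma std_rootD j k l : std_root j k + std_root k l = std_root j l.
Proof.
rewrite /std_root -weightD; congr weight; apply/funext => m.
by rewrite /coroot addrA subrK.
Qed.

Lemma coroot_jj j k : j != k -> coroot R j k j - coroot R j k k = 2.
Proof. by move=> jk; rewrite /coroot !eqxx [k == j]eq_sym (negbTE jk) subr0 sub0r opprK. Qed.

Lemma std_root_neq0 j k : j != k -> std_root j k <> 0.
Proof.
move=> jk /(congr1 (fun f => f (cartan (coroot R j k)))).
rewrite /std_root weight_coroot (coroot_jj jk) => /eqP.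
by rewrite pnatr_eq0.
Qed.

Lemma idiag_delta t j k : idiag t *m delta_mx j k - delta_mx j k *m idiag t =
  ('i * (t j - t k)%:C) *: delta_mx j k.
Proof.
rewrite mul_mx_diag mul_diag_mx; apply/matrixP => a b; rewrite !mxE.
case: (eqVneq a j) => [->|_] /=; last by rewrite !mulr0 mul0r subrr.
case: (eqVneq b k) => [->|_] /=; last by rewrite !mulr0 mul0r subrr.
by rewrite !mulr1 mul1r rmorphB mulrBr.
Qed.

(** In the eigenbasis of the torus, the commutator with H multiplies the entry (j, k) by i (t_j -
    t_k), so any nonzero entry of a root vector determines the root. *)
Lemma rootP (beta : M3 -> R) : Defs.root T beta <-> exists j k, j != k /\ beta = std_root j k.
Proof.
have PP := unitarymxP uP; have PP' := unitarymx_tCmul uP.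
split=> [[Ib b0 [X [X0 trX HX]]]|[j [k [jk ->]]]].
  pose Y := P *m X *m P^t*.
  have XY : X = P^t* *m Y *m P.
    by rewrite /Y !mulmxA PP' mul1mx -mulmxA PP' mulmx1.
  have Y0 : Y != 0 by apply: contraNneq X0 => Y0; rewrite XY Y0 mulmx0 mul0mx.
  have [j [k Yjk]] : exists j k, Y j k != 0.
    apply: contrapT => h; move/eqP: Y0; apply; apply/matrixP => j k; rewrite [RHS]mxE.
    by have [//|Yjk] := eqVneq (Y j k) 0; case: h; exists j, k.
  have bE t : \sum_l t l = 0 -> beta (cartan t) = t j - t k.
    move=> t0; have := HX _ (cartan_lie t0).
    move=> /(congr1 (fun Z : M3 => P *m Z *m P^t*)).
    rewrite mulmxBr mulmxBl -(conj_mulmx (cartan t) X PP') -(conj_mulmx X (cartan t) PP').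
    rewrite cartan_conj -/Y -scalemxAr -scalemxAl -/Y => /matrixP/(_ j k).
    rewrite mul_mx_diag mul_diag_mx; clearbody Y; rewrite !mxE => E.
    have : ('i * (t j - t k)%:C) * Y j k = ('i * (beta (cartan t))%:C) * Y j k.
      by rewrite -E rmorphB; ring.
    by move/(mulIf Yjk)/(mulfI (neq0Ci _))/complexI ->.
  exists j, k.
  have -> : beta = std_root j k.
    apply: (idual_ext Ib (weight_idual _)) => t t0.
    by rewrite (bE _ t0) -(std_rootE j k t0).
  split; last exact: erefl.
  apply/eqP => jk; apply: b0; apply: (idual_ext Ib idual0) => t t0.
  by rewrite (bE _ t0) jk; exact: subrr.
split; [exact: weight_idual | exact: std_root_neq0 |].
exists (P^t* *m delta_mx j k *m P); split.
- have D0 : (delta_mx j k : M3) <> 0.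
    by move=> /matrixP/(_ j k)/eqP; rewrite !mxE !eqxx oner_eq0.
  apply/eqP => /(congr1 (fun Z : M3 => P *m Z *m P^t*)).
  by rewrite !mulmxA PP mul1mx -mulmxA PP mulmx1 mulmx0 mul0mx => /D0.
- by rewrite mxtrace_mulC mulmxA PP mul1mx mxtrace_delta (negbTE jk).
move=> _ /lie_algebra_cartan[t t0 ->]; rewrite (std_rootE _ _ t0) cartanE.
rewrite (conj_mulmx (idiag t) _ PP) (conj_mulmx (delta_mx j k) _ PP) -mulmxBl -mulmxBr.
by rewrite idiag_delta -scalemxAr -scalemxAl.
Qed.

End Weights.

(** * Permutation matrices and reordering of the eigenbasis *)

Section PermutationMatrices.
Variable R : realType.
Local Notation M3 := ('M[R[i]]_3).
Implicit Types (s : 'S_3) (t : 'I_3 -> R) (P A X : M3).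

(** The sign corrects the determinant to 1, as the size 3 is odd. *)
Definition perm3 s : M3 := (-1) ^+ s *: perm_mx s.

Lemma perm_mx_adj s : (perm_mx s : M3)^t* = perm_mx s^-1.
Proof. by rewrite tr_perm_mx map_perm_mx. Qed.

Lemma perm_mx_unitary s : (perm_mx s : M3) \is unitarymx.
Proof. by apply/unitarymxP; rewrite perm_mx_adj -perm_mxM mulgV perm_mx1. Qed.

Lemma perm3_adj s : (perm3 s)^t* = perm3 s^-1.
Proof.
rewrite /perm3 -perm_mx_adj odd_permV; apply/matrixP => i j; rewrite !mxE rmorphM.
by congr (_ * _); rewrite rmorph_sign.
Qed.

Lemma SU3_perm3 s : SU3 (perm3 s).
Proof.
split.
  apply/unitarymxP; rewrite perm3_adj /perm3 odd_permV -scalemxAr -scalemxAl scalerA.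
  by rewrite -expr2 sqrr_sign scale1r -perm_mxM mulgV perm_mx1.
by rewrite detZ det_perm; case: (odd_perm s); rewrite ?expr0 ?expr1; ring.
Qed.

Lemma perm_mx_diag s (d : 'rV[R[i]]_3) :
  perm_mx s *m diag_mx d *m perm_mx s^-1 = diag_mx (\row_k d 0 (s k)).
Proof.
rewrite -row_permE -col_permE; apply/matrixP => i j; rewrite !mxE.
by rewrite (inj_eq perm_inj).
Qed.

Lemma perm3_diag s (d : 'rV[R[i]]_3) :
  perm3 s *m diag_mx d *m perm3 s^-1 = diag_mx (\row_k d 0 (s k)).
Proof.
rewrite /perm3 odd_permV -!scalemxAr -!scalemxAl scalerA -expr2 sqrr_sign scale1r.
exact: perm_mx_diag.
Qed.

Lemma perm3_idiag s t : perm3 s *m idiag t *m perm3 s^-1 = idiag (fun k => t (s k)).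
Proof. by rewrite perm3_diag; congr diag_mx; apply/rowP => k; rewrite !mxE. Qed.

Lemma perm3_cisdiag s t : perm3 s *m cisdiag t *m perm3 s^-1 = cisdiag (fun k => t (s k)).
Proof. by rewrite perm3_diag; congr diag_mx; apply/rowP => k; rewrite !mxE. Qed.

Lemma perm_mx_cisdiag s t : perm_mx s *m cisdiag t *m perm_mx s^-1 = cisdiag (fun k => t (s k)).
Proof. by rewrite perm_mx_diag; congr diag_mx; apply/rowP => k; rewrite !mxE. Qed.

Lemma sum_perm0 s t : \sum_k t k = 0 -> \sum_k t (s k) = 0.
Proof. by move=> t0; rewrite -[RHS]t0 [RHS](reindex_inj (@perm_inj _ s)). Qed.

End PermutationMatrices.

Section PermutedBasis.
Variables (R : realType) (P : 'M[R[i]]_3).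
Hypothesis uP : P \is unitarymx.
Local Notation M3 := ('M[R[i]]_3).
Implicit Types (s : 'S_3).

Lemma perm_unitary s : perm_mx s *m P \is unitarymx.
Proof. by apply: mul_unitarymx; [exact: perm_mx_unitary | exact: uP]. Qed.

Lemma diag_torus_perm s : diag_torus (perm_mx s *m P) = diag_torus P.
Proof.
have E r t : (perm_mx r *m P)^t* *m cisdiag t *m (perm_mx r *m P) =
    P^t* *m cisdiag (fun k => t ((r^-1)%g k)) *m P.
  rewrite trmx_mul map_mxM perm_mx_adj -perm_mx_cisdiag invgK.
  by rewrite !mulmxA.
apply/seteqP; split=> _ [t /= t0 <-].
  by rewrite E; exists (fun k => t ((s^-1)%g k)) => //; exact: sum_perm0.
exists (fun k => t (s k)); first exact: sum_perm0.
by rewrite E; apply: eq_conj_cisdiag => k; rewrite permKV.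
Qed.

(** Reordering the eigenbasis keeps the torus and relabels the roots: this is how a positive system
    is brought to standard form. *)
Lemma std_root_perm s j k :
  std_root (perm_mx s *m P) j k = std_root P (s j) (s k).
Proof.
apply/funext => X; rewrite /std_root unlock diag_torus_perm !patchE.
case: ifP => // _; rewrite !dot_coroot /angle.
suff E l : (perm_mx s *m P *m X *m (perm_mx s *m P)^t*) l l = (P *m X *m P^t*) (s l) (s l).
  by rewrite !E.
rewrite trmx_mul map_mxM perm_mx_adj.
have -> : perm_mx s *m P *m X *m (P^t* *m perm_mx s^-1) =
    perm_mx s *m (P *m X *m P^t*) *m perm_mx s^-1 by rewrite !mulmxA.
by rewrite -row_permE -col_permE [LHS]mxE [LHS]mxE.
Qed.

End PermutedBasis.

Lemma perm3_ex (a b c : 'I_3) : a != b -> b != c -> a != c ->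
  exists s : 'S_3, [/\ s 0 = a, s 1 = b & s 2%:R = c].
Proof.
move=> ab bc ac.
pose f (i : 'I_3) := if i == 0 then a else if i == 1 then b else c.
have fI : injective f.
  by apply: ord3P; apply: ord3P => //; rewrite /f /= => /eqP;
    rewrite ?(negbTE ab) ?(negbTE bc) ?(negbTE ac) // eq_sym
      ?(negbTE ab) ?(negbTE bc) ?(negbTE ac).
by exists (perm fI); rewrite !permE.
Qed.

(** * Standard form of a positive system *)

Section PositiveSystem.
Variable R : realType.
Local Notation M3 := ('M[R[i]]_3).

(** A positive system picks one of the roots (j, k), (k, j) for each pair, in a transitive way: it
    is a linear order of the three indices, listed as a, b, c in [key]. *)
Lemma positive_system_std (T : set M3) (Phi : set (M3 -> R)) :
  maximal_torus T -> positive_system T Phi ->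
  exists P : M3, [/\ P \is unitarymx, T = diag_torus P &
    Phi = [set` [:: std_root P 0 1; std_root P 1 2%:R; std_root P 0 2%:R]]].
Proof.
move=> /maximal_torus_diag[Q uQ ->] [Phi_root Phi_total Phi_anti Phi_add].
have std_rootQ j k : j != k -> Defs.root (diag_torus Q) (std_root Q j k).
  by move=> jk; apply/(rootP uQ); exists j, k.
have anti j k : Phi (std_root Q j k) -> ~ Phi (std_root Q k j).
  by rewrite (std_rootN uQ j k); exact: Phi_anti.
have total j k : j != k -> Phi (std_root Q j k) \/ Phi (std_root Q k j).
  by move=> /std_rootQ/Phi_total; rewrite -(std_rootN uQ).
have add j k l : j != l -> Phi (std_root Q j k) -> Phi (std_root Q k l) ->
    Phi (std_root Q j l).
  move=> jl Pjk Pkl; rewrite -(std_rootD uQ j k l); apply: Phi_add; [exact: Pjk | exact: Pkl |].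
  by rewrite (std_rootD uQ); exact: std_rootQ.
have key a b c : a != b -> b != c -> a != c ->
    Phi (std_root Q a b) -> Phi (std_root Q b c) ->
  exists P : M3, [/\ P \is unitarymx, diag_torus Q = diag_torus P &
    Phi = [set` [:: std_root P 0 1; std_root P 1 2%:R; std_root P 0 2%:R]]].
  move=> ab bc ac Pab Pbc; have Pac := add _ _ _ ac Pab Pbc.
  have [s [s0 s1 s2]] := perm3_ex ab bc ac.
  exists (perm_mx s *m Q); split; [exact: perm_unitary | by rewrite diag_torus_perm |].
  have in3 (x y z u : M3 -> R) : u \in [:: x; y; z] <-> [\/ u = x, u = y | u = z].
    rewrite !inE; split=> [/or3P[]/eqP|[]] ->; [by constructor 1 | by constructor 2
      | by constructor 3 | ..]; by rewrite eqxx ?orbT.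
  apply/seteqP; split=> beta /=; rewrite in3 !(std_root_perm _ s) s0 s1 s2; last by case=> ->.
  move=> Pb; have /(rootP uQ)[j [k [jk bE]]] := Phi_root _ Pb.
  have [[j' jE] [k' kE]] : (exists j', j = s j') /\ (exists k', k = s k').
    by split; [exists ((s^-1)%g j) | exists ((s^-1)%g k)]; rewrite permKV.
  move: Pb jk; rewrite bE jE kE (inj_eq perm_inj).
  move: j' k' {bE jE kE}; apply: ord3P; apply: ord3P => //; rewrite ?s0 ?s1 ?s2 => Pb _;
    first [by constructor 1 | by constructor 2 | by constructor 3
      | by case: (anti _ _ Pb)].
have [P01|P10] := total 0 1 isT.
  have [P12|P21] := total 1 2%:R isT; first exact: (key 0 1 2%:R isT isT isT P01 P12).
  have [P02|P20] := total 0 2%:R isT; first exact: (key 0 2%:R 1 isT isT isT P02 P21).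
  exact: (key 2%:R 0 1 isT isT isT P20 P01).
have [P12|P21] := total 1 2%:R isT; last exact: (key 2%:R 1 0 isT isT isT P21 P10).
have [P02|P20] := total 0 2%:R isT; first exact: (key 1 0 2%:R isT isT isT P10 P02).
exact: (key 1 2%:R 0 isT isT isT P12 P20).
Qed.

End PositiveSystem.

(** * The Weyl group and its invariant inner products *)

Section WeylGroup.
Variables (R : realType) (P : 'M[R[i]]_3).
Hypothesis uP : P \is unitarymx.
Local Notation M3 := ('M[R[i]]_3).
Local Notation T := (diag_torus P).
Local Notation L := (lie_algebra (diag_torus P)).
Implicit Types (X Y H g : M3) (t w : 'I_3 -> R) (s : 'S_3).

(** The signed permutation matrix, written in the eigenbasis, normalises the torus and permutes the
    angles. *)
Lemma weyl_perm s : exists2 f, weyl_group T f &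
  forall w, f (weight P w) = weight P (fun k => w (s k)).
Proof.
have PP := unitarymxP uP.
pose g : M3 := P^t* *m perm3 R s *m P.
have gV : invmx g = P^t* *m perm3 R s^-1 *m P.
  rewrite invmx_unitary; last exact: SU3_unitary (SU3_conj uP (SU3_perm3 R s)).
  by rewrite !trmx_mul !map_mxM trmxCK perm3_adj mulmxA.
have conjg (D : M3) : invmx g *m (P^t* *m D *m P) *m g =
    P^t* *m (perm3 R s^-1 *m D *m perm3 R s) *m P.
  by rewrite gV (conj_mulmx (perm3 R s^-1) D PP); exact: conj_mulmx.
have conj_cis t : invmx g *m (P^t* *m cisdiag t *m P) *m g =
    P^t* *m cisdiag (fun k => t ((s^-1)%g k)) *m P.
  by have := perm3_cisdiag s^-1 t; rewrite invgK (conjg (cisdiag t)) => ->.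
have conj_cartan t : invmx g *m cartan P t *m g = cartan P (fun k => t ((s^-1)%g k)).
  by have := perm3_idiag s^-1 t; rewrite invgK !cartanE (conjg (idiag t)) => ->.
exists (coadjoint T g).
  exists g; split; [exact: SU3_conj uP (SU3_perm3 R s) | | exact: erefl].
  apply/seteqP; split=> [_ [_ [t /= t0 <-] <-]|_ [t /= t0 <-]].
    rewrite conj_cis; exists (fun k => t ((s^-1)%g k)); [exact: sum_perm0 | exact: erefl].
  exists (P^t* *m cisdiag (fun k => t (s k)) *m P).
    by exists (fun k => t (s k)); [exact: sum_perm0 | exact: erefl].
  by rewrite conj_cis; apply: eq_conj_cisdiag => k; rewrite permKV.
move=> w; apply/funext => X; rewrite /coadjoint patchE; case: ifPn => [|/negP LX].
  move=> /set_mem/(lie_algebra_cartan uP)[t t0 ->].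
  rewrite conj_cartan (weightE uP _ t0) (weightE uP _ (sum_perm0 _ t0)).
  by rewrite (reindex_inj (@perm_inj _ s)); apply: eq_bigr => k _; rewrite permK.
by rewrite weight_out // => h; apply: LX; exact: mem_set.
Qed.

Section Normalizer.
Variable g : M3.
Hypotheses (g3 : SU3 g) (gT : normalizes T g).

Let gV : invmx g *m g = 1%:M.
Proof. exact: mulVmx (unitarymx_unit (SU3_unitary g3)). Qed.

Let gV' : g *m invmx g = 1%:M.
Proof. exact: mulmxV (unitarymx_unit (SU3_unitary g3)). Qed.

Let conjZ (x : R) (A B X : M3) : x%:C *: (A *m X *m B) = A *m (x%:C *: X) *m B.
Proof. by rewrite -scalemxAr scalemxAl. Qed.

Lemma normalizer_lie X : L X -> L (invmx g *m X *m g).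
Proof.
move=> LX x; rewrite conjZ (expM_conj _ gV' gV) -[X in X _]gT.
by exists (expM (x%:C *: X)); [exact: LX | exact: erefl].
Qed.

Lemma normalizer_lieV X : L X -> L (g *m X *m invmx g).
Proof.
move=> LX x; rewrite conjZ (expM_conj _ gV gV').
have := LX x; rewrite -[X in X _ -> _]gT => -[b Tb <-].
by rewrite !mulmxA gV' mul1mx -mulmxA gV' mulmx1.
Qed.

Lemma coadjointE f X : L X -> coadjoint T g f X = f (invmx g *m X *m g).
Proof. by move=> LX; rewrite /coadjoint patchE mem_set. Qed.

Lemma coadjoint_root beta : Defs.root T beta -> Defs.root T (coadjoint T g beta).
Proof.
move=> [[bD bZ b0] bn0 [X [X0 trX HX]]]; split.
- split=> [Y Z LY LZ|x Y LY|Y LY].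
  + have LYZ : L (Y + Z).
      move: LY LZ => /(lie_algebra_cartan uP)[t t0 ->] /(lie_algebra_cartan uP)[t' t'0 ->].
      by rewrite -cartanD; apply: (cartan_lie uP); exact: sumD0.
    rewrite !coadjointE // mulmxDr mulmxDl.
    by apply: bD; exact: normalizer_lie.
  + have LxY : L (x%:C *: Y).
      move: LY => /(lie_algebra_cartan uP)[t t0 ->].
      by rewrite -cartanZ; apply: (cartan_lie uP); exact: sumZ0.
    rewrite !coadjointE // -conjZ.
    by apply: bZ; exact: normalizer_lie.
  + by rewrite /coadjoint patchE memNset.
- move=> h; apply: bn0; apply/funext => Y; have [LY|/b0 //] := pselect (L Y).
  have := congr1 (fun f => f (g *m Y *m invmx g)) h.
  rewrite (coadjointE _ (normalizer_lieV LY)).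
  by rewrite !mulmxA gV mul1mx -mulmxA gV mulmx1.
exists (g *m X *m invmx g); split.
- apply: contra_neq X0 => h.
  have -> : X = invmx g *m (g *m X *m invmx g) *m g.
    by rewrite !mulmxA gV mul1mx -mulmxA gV mulmx1.
  by rewrite h mulmx0 mul0mx.
- by rewrite mxtrace_mulC mulmxA gV mul1mx.
move=> H LH; rewrite (coadjointE _ LH).
have {1 2}-> : H = g *m (invmx g *m H *m g) *m invmx g.
  by rewrite !mulmxA gV' mul1mx -mulmxA gV' mulmx1.
rewrite (conj_mulmx _ _ gV) (conj_mulmx _ _ gV) -mulmxBl -mulmxBr.
by rewrite (HX _ (normalizer_lie LH)) -scalemxAr -scalemxAl.
Qed.

End Normalizer.

(** Angles with sum 0 are determined by their consecutive differences, hence the action on the torus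
    by the images of the two simple roots. *)
Lemma coadjoint_inj g g' : SU3 g -> normalizes T g -> SU3 g' -> normalizes T g' ->
  coadjoint T g (std_root P 0 1) = coadjoint T g' (std_root P 0 1) ->
  coadjoint T g (std_root P 1 2%:R) = coadjoint T g' (std_root P 1 2%:R) ->
  coadjoint T g = coadjoint T g'.
Proof.
move=> g3 gT g'3 g'T e01 e12; apply/funext => f; apply/funext => X.
have [LX|LX] := pselect (L X); last by rewrite /coadjoint !patchE memNset.
rewrite !coadjointE //; congr f.
have := congr1 (fun f => f X) e01; have := congr1 (fun f => f X) e12.
rewrite !coadjointE //.
have /(lie_algebra_cartan uP)[t t0 ->] := normalizer_lie g3 gT LX.
have /(lie_algebra_cartan uP)[t' t'0 ->] := normalizer_lie g'3 g'T LX.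
rewrite !(std_rootE uP) // => h12 h01; congr (cartan P _); apply/funext.
by move: t0 t'0; rewrite !sum_ord3 => t0 t'0; apply: ord3P; lra.
Qed.

Lemma finite_root : finite_set (Defs.root T).
Proof.
apply: (@sub_finite_set _ _ [set std_root P jk.1 jk.2 | jk in [set: 'I_3 * 'I_3]]).
  by move=> beta /(rootP uP)[j [k [_ ->]]]; exists (j, k).
exact: finite_image.
Qed.

(** A finitary sum over an infinite support is 0 by default, so finiteness is what allows the sum to
    be bounded below by one of its terms. The images of the two simple roots leave finitely many
    choices. *)
Lemma finite_weyl_group : finite_set (weyl_group T).
Proof.
have root01 : Defs.root T (std_root P 0 1) by apply/(rootP uP); exists 0, 1.
have root12 : Defs.root T (std_root P 1 2%:R) by apply/(rootP uP); exists 1, 2%:R.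
pose ext b f := weyl_group T f /\ f (std_root P 0 1) = b.1 /\ f (std_root P 1 2%:R) = b.2.
pose pick (b : (M3 -> R) * (M3 -> R)) := xget (id : (M3 -> R) -> (M3 -> R)) [set f | ext b f].
apply: (@sub_finite_set _ _ (pick @` (Defs.root T `*` Defs.root T))).
  move=> f Wf; exists (f (std_root P 0 1), f (std_root P 1 2%:R)).
    by case: Wf => g [g3 gT ->]; split; exact: coadjoint_root.
  rewrite /pick; case: xgetP => [h _ [Wh [/= h01 h12]]|/(_ f)]; last by case.
  case: Wf h01 h12 => g [g3 gT ->]; case: Wh => g' [g'3 g'T ->].
  exact: coadjoint_inj.
by apply: finite_image; apply: finite_setX; exact: finite_root.
Qed.

Section InnerProduct.
Variable ip : (M3 -> R) -> (M3 -> R) -> R.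
Hypothesis ipW : weyl_inner_product T ip.

Let ip_lin (x : R) a b c : idual T a -> idual T b -> idual T c ->
  ip (x *: a + b) c = x * ip a c + ip b c.
Proof. by case: ipW => h _ _ _; exact: h. Qed.

Let ip_sym a b : idual T a -> idual T b -> ip a b = ip b a.
Proof. by case: ipW => _ h _ _; exact: h. Qed.

Lemma ipN a b : idual T a -> idual T b -> ip (- a) b = - ip a b.
Proof.
move=> Ia Ib; have I0 := idual0 P.
have z : ip 0 b = 0.
  by have := ip_lin 1 I0 I0 Ib; rewrite scaler0 addr0 mul1r => h; lra.
by have := ip_lin (-1) Ia I0 Ib; rewrite scaleN1r addr0 z addr0 mulN1r.
Qed.

(** Invariance under the reflection in the root a = (j, k), which sends a to - a and the weight w to
    w - (w_j - w_k) a. *)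
Lemma ip_reflect w j k : j != k -> ip (weight P w) (std_root P j k) =
  (w j - w k) / 2 * ip (std_root P j k) (std_root P j k).
Proof.
move=> jk; set a := std_root P j k.
have Ia : idual T a by exact: weight_idual.
have Iw := weight_idual uP w.
have [f Wf fE] := weyl_perm (tperm j k).
have fa : f a = - a.
  rewrite /a -std_rootN // /std_root fE; congr (weight P _); apply/funext => l.
  rewrite /coroot; congr ((_ : bool)%:R - (_ : bool)%:R).
    by rewrite (can2_eq (tpermK j k) (tpermK j k)) tpermL.
  by rewrite (can2_eq (tpermK j k) (tpermK j k)) tpermR.
have fw : f (weight P w) = (- (w j - w k)) *: a + weight P w.
  rewrite fE /a /std_root -weightZ // -weightD //; congr (weight P _); apply/funext => l.
  rewrite /coroot; case: tpermP => [->|->|/eqP lj /eqP lk].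
  - by rewrite eqxx (negbTE jk) /=; ring.
  - by rewrite eqxx [k == j]eq_sym (negbTE jk) /=; ring.
  - by rewrite (negbTE lj) (negbTE lk) subrr mulr0 add0r.
have : ip (f (weight P w)) (f a) = ip (weight P w) a by case: ipW => _ _ _; apply.
have INa : idual T (- a) by rewrite /a -std_rootN //; exact: weight_idual.
rewrite fw fa ip_lin // (ip_sym Ia INa) (ip_sym Iw INa) !ipN // (ip_sym Ia Iw).
move: (ip _ _) (ip _ _) => x y h; lra.
Qed.

Lemma ip_weight : exists2 c : R, 0 < c &
  forall w j k, j != k -> ip (weight P w) (std_root P j k) = c * (w j - w k).
Proof.
exists (ip (std_root P 0 1) (std_root P 0 1) / 2).
  rewrite divr_gt0 //; case: ipW => _ _ pos _; apply: pos; first exact: weight_idual.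
  exact: std_root_neq0.
move=> w j k jk; rewrite ip_reflect //.
(* All roots are conjugate, hence of equal length, so that half the squared length is one constant
   for all of them. *)
have [l kl jl] : exists2 l : 'I_3, k != l & j != l.
  by move: j k jk; apply: ord3P; apply: ord3P => // _;
    first [by exists 0 | by exists 1 | by exists 2%:R].
have [s [s0 s1 _]] := perm3_ex jk kl jl.
have [f Wf fE] := weyl_perm s.
have <- : ip (f (std_root P j k)) (f (std_root P j k)) = ip (std_root P j k) (std_root P j k).
  by case: ipW => _ _ _; apply => //; exact: weight_idual.
have -> : f (std_root P j k) = std_root P 0 1.
  rewrite /std_root fE; congr (weight P _); apply/funext => m.
  by rewrite /coroot -s0 -s1 !(inj_eq perm_inj).
by move: (ip _ _) => x; field.
Qed.

End InnerProduct.

End WeylGroup.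

(** * The character bound *)

Section ConjugatedRepresentation.
Variables (R : realType) (P : 'M[R[i]]_3) (n : nat) (sigma : 'M[R[i]]_3 -> 'M[R[i]]_n).
Hypotheses (uP : P \is unitarymx) (rep : representation sigma).
Local Notation M3 := ('M[R[i]]_3).

(** The twist by the change of basis makes the torus diagonal, where [char_formula] applies. *)
Definition conj_rep (A : M3) := sigma (P^t* *m A *m P).

Lemma conj_rep_representation : representation conj_rep.
Proof.
have PP := unitarymxP uP; split.
- apply/subspace_continuousP => A A3 S.
  move=> /nbhs_l1norm[e e0 eS].
  have [d d0 dP] := rep_eps_delta rep (SU3_conj uP A3) e0.
  pose K := l1norm (P^t*) * l1norm P + 1.
  have K0 : 0 < K by rewrite ltr_wpDl // mulr_ge0 // l1norm_ge0.
  suff : nbhs A [set B | SU3 B -> S (conj_rep B)] by [].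
  apply/nbhs_l1norm; exists (d / K); first exact: divr_gt0.
  move=> B BA B3; apply: eS; apply: (dP _ (SU3_conj uP B3)).
  rewrite -mulmxBl -mulmxBr; apply: le_lt_trans (l1normM _ _) _.
  apply: (@le_lt_trans _ _ (l1norm (P^t*) * l1norm P * l1norm (B - A))).
    rewrite mulrAC; apply: (ler_wpM2r (l1norm_ge0 _)); exact: l1normM.
  apply: (@le_lt_trans _ _ (K * l1norm (B - A))).
    by apply: (ler_wpM2r (l1norm_ge0 _)); rewrite /K lerDl.
  by rewrite mulrC -ltr_pdivlMr.
- rewrite /conj_rep mulmx1 (unitarymx_tCmul uP); by case: rep.
- move=> A B A3 B3; rewrite /conj_rep -(conj_mulmx A B PP).
  exact: (rep_mul rep (SU3_conj uP A3) (SU3_conj uP B3)).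
Qed.

Lemma conj_rep_irreducible : irreducible sigma -> irreducible conj_rep.
Proof.
have uP' : P^t* \is unitarymx by rewrite trmxC_unitary; exact: uP.
case=> n0 irr; split=> // U US; apply: irr => g v g3 vU.
have := US _ v (SU3_conj uP' g3) vU.
by rewrite /conj_rep trmxCK !mulmxA (unitarymx_tCmul uP) mul1mx -mulmxA
  (unitarymx_tCmul uP) mulmx1.
Qed.

End ConjugatedRepresentation.

Section SymmetricProducts.
Variable R : realType.

Lemma prod_pairs_perm (F : 'I_3 -> 'I_3 -> R) (s : 'S_3) : (forall j k, F j k = F k j) ->
  F (s 0) (s 1) * (F (s 0) (s 2%:R) * F (s 1) (s 2%:R)) = F 0 1 * (F 1 2%:R * F 0 2%:R).
Proof.
move=> Fsym.
have s01 : s 0 != s 1 by rewrite (inj_eq perm_inj).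
have s12 : s 1 != s 2%:R by rewrite (inj_eq perm_inj).
have s02 : s 0 != s 2%:R by rewrite (inj_eq perm_inj).
move: (s 0) (s 1) (s 2%:R) s01 s12 s02.
by apply: ord3P; apply: ord3P; apply: ord3P => // _ _ _;
  rewrite ?(Fsym 1 0) ?(Fsym 2%:R 1) ?(Fsym 2%:R 0); ring.
Qed.

Lemma minimal_pair (d : 'I_3 -> 'I_3 -> R) : (forall j k, d j k = d k j) ->
  exists s : 'S_3, d (s 0) (s 1) <= d (s 0) (s 2%:R) /\ d (s 0) (s 1) <= d (s 1) (s 2%:R).
Proof.
move=> dsym.
have pick a b c : a != b -> b != c -> a != c -> d a b <= d a c -> d a b <= d b c ->
    exists s : 'S_3, d (s 0) (s 1) <= d (s 0) (s 2%:R) /\ d (s 0) (s 1) <= d (s 1) (s 2%:R).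
  by move=> ab bc ac dac dbc; have [s [s0 s1 s2]] := perm3_ex ab bc ac; exists s; rewrite s0 s1 s2.
have [d1|d1] := leP (d 0 1) (d 0 2%:R).
  have [d2|d2] := leP (d 0 1) (d 1 2%:R); first exact: (pick 0 1 2%:R).
  apply: (pick 1 2%:R 0) => //; rewrite ?(dsym 1 0) ?(dsym 2%:R 0); first exact: ltW.
  exact: ltW (lt_le_trans d2 d1).
have [d2|d2] := leP (d 0 2%:R) (d 1 2%:R).
  by apply: (pick 0 2%:R 1) => //; [exact: ltW | rewrite (dsym 2%:R 1)].
apply: (pick 1 2%:R 0) => //; rewrite ?(dsym 1 0) ?(dsym 2%:R 0); last exact: ltW.
exact: ltW (lt_trans d2 d1).
Qed.

End SymmetricProducts.

Lemma mxtrace_rep_conj (R : realType) n (sigma : 'M[R[i]]_3 -> 'M[R[i]]_n) g h A :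
  representation sigma -> SU3 g -> SU3 h -> SU3 A -> h *m g = 1%:M ->
  \tr (sigma (g *m A *m h)) = \tr (sigma A).
Proof.
move=> rep g3 h3 A3 hg.
rewrite (rep_mul rep (SU3_mul g3 A3) h3) (rep_mul rep g3 A3) mxtrace_mulC mulmxA.
rewrite -(rep_mul rep h3 g3) hg; case: rep => _ -> _; by rewrite mul1mx.
Qed.

Lemma fct_natmul (T : Type) (V : zmodType) (f : T -> V) k x : (f *+ k) x = f x *+ k.
Proof. by elim: k => [|k IH]; rewrite ?mulr0n // !mulrS -IH. Qed.

Lemma sum3_at (T : Type) (V : zmodType) (f g h : T -> V) (c : (T -> V) -> nat) x :
  (\sum_(u <- [:: f; g; h]) u *+ c u) x = f x *+ c f + (g x *+ c g + h x *+ c h).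
Proof. by rewrite !big_cons big_nil addr0 -!fct_natmul. Qed.

Lemma fct_addE (T : Type) (V : zmodType) (f g : T -> V) x : (f + g) x = f x + g x.
Proof. by []. Qed.

Lemma fct_subE (T : Type) (V : zmodType) (f g : T -> V) x : (f - g) x = f x - g x.
Proof. by []. Qed.

Lemma uniq3 (K : eqType) (a b c : K) : a != b -> a != c -> b != c -> uniq [:: a; b; c].
Proof. by move=> ab ac bc; rewrite /= !inE negb_or ab ac bc. Qed.

Lemma std_roots_uniq (R : realType) (P : 'M[R[i]]_3) : P \is unitarymx ->
  uniq [:: std_root P 0 1; std_root P 1 2%:R; std_root P 0 2%:R].
Proof.
move=> uP.
have neq j k l m : coroot R 0 1 j - coroot R 0 1 k != coroot R 0 1 l - coroot R 0 1 m ->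
    std_root P j k != std_root P l m.
  apply: contraNneq => /(congr1 (fun f => f (cartan P (coroot R 0 1)))).
  by rewrite !(std_rootE uP) ?coroot_sum // => ->.
by apply: uniq3; apply: neq; apply/eqP; rewrite /coroot /=; lra.
Qed.

Section CharacterBound.
Variable R : realType.
Local Notation M3 := ('M[R[i]]_3).
Local Notation dist t j k := (`|sin ((t j - t k) / 2)|).

Lemma sin_dist_sym (t : 'I_3 -> R) j k : dist t j k = dist t k j.
Proof. by rewrite -normrN -sinN; congr (`|sin _|); ring. Qed.

Lemma weight_sum_bound (t : 'I_3 -> R) p q :
  dist t 0 1 <= dist t 0 2%:R -> dist t 0 1 <= dist t 1 2%:R ->
  normc (weight_sum (cis (t 1 - t 0)) (cis (t 2%:R - t 1)) p q) <=
  4 * (min_inv (p.+1 + q.+1)%:R (dist t 0 1) *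
       (min_inv p.+1%:R (dist t 0 2%:R) * min_inv q.+1%:R (dist t 1 2%:R))).
Proof.
have E j k : dist t j k = normc (1 - cis (t k - t j)) / 2.
  by rewrite sin_dist_sym normc_1Bcis.
have c02 : cis (t 2%:R - t 0) = cis (t 1 - t 0) * cis (t 2%:R - t 1).
  by rewrite -cisD; congr cis; ring.
rewrite !E c02 !ler_pM2r // => d1 d2.
exact: (normc_weight_sum p q (normc_cis (t 1 - t 0)) (normc_cis (t 2%:R - t 1)) d1 d2).
Qed.

Lemma character_bound (P : M3) n (sigma : M3 -> 'M[R[i]]_n) w :
  P \is unitarymx -> representation sigma -> irreducible sigma ->
  highest_weight (diag_torus P)
    [set` [:: std_root P 0 1; std_root P 1 2%:R; std_root P 0 2%:R]] sigma (weight P w) ->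
  exists p q : nat, [/\ w 0 - w 1 = p%:R, w 1 - w 2%:R = q%:R &
    forall t, \sum_k t k = 0 -> exists s : 'S_3,
      normc (character sigma (expM (cartan P t))) <=
      4 * (min_inv (p.+1 + q.+1)%:R (dist t (s 0) (s 1)) *
           (min_inv p.+1%:R (dist t (s 0) (s 2%:R)) *
            min_inv q.+1%:R (dist t (s 1) (s 2%:R))))].
Proof.
move=> uP rep irr [[_ [v v0 vm]] high].
have rep' := conj_rep_representation uP rep; have irr' := conj_rep_irreducible uP irr.
(* At the coroot of the highest root the positive roots take the values 1, 1 and 2. There mu - (mu +
   alpha) is -1 for a simple root alpha, so it is no combination of them with natural
   coefficients. *)
have aux (y : R) (a b d : nat) : y - (1 + y) = 1 *+ a + (1 *+ b + 2 *+ d) -> False.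
  have := ler0n R a; have := ler0n R b; have := ler0n R d.
  rewrite -[2 *+ d]mulr_natr => a0 b0 d0 h; lra.
have expE t : expM (cartan P t) = P^t* *m cisdiag t *m P.
  by rewrite cartanE; exact: expM_conj_idiag.
pose m (t : 'I_3 -> R) := \sum_k w k * t k.
have vm' t : \sum_i t i = 0 -> conj_rep P sigma (cisdiag t) *m v = cis (m t) *: v.
  by move=> t0; rewrite /conj_rep -expE (vm _ (cartan_lie uP t0)) (weightE uP _ t0).
have mZ (x : R) t : \sum_i t i = 0 -> m (fun i => x * t i) = x * m t.
  by move=> _; rewrite /m mulr_sumr; apply: eq_bigr => k _; exact: mulrCA.
have no_higher j k (u : 'cV[R[i]]_n) : (j, k) \in [:: (0, 1); (1, 2%:R)] ->
    (forall t, \sum_i t i = 0 -> conj_rep P sigma (cisdiag t) *m u = cis (t j - t k + m t) *: u) ->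
    u = 0.
  move=> jk um; apply/eqP; apply: contraT => u0; exfalso.
  have [|c /(congr1 (fun f => f (cartan P (coroot R 0 2%:R))))] :=
      high (weight P (fun l => coroot R j k l + w l)).
    split; first exact: weight_idual.
    exists u => // _ /(lie_algebra_cartan uP)[t t0 ->].
    rewrite expE -/(conj_rep P sigma _) (um _ t0) (weightE uP _ t0); congr (cis _ *: _).
    rewrite -dot_coroot /m -big_split; apply: eq_bigr => l _; exact: esym (mulrDl _ _ _).
  rewrite -fsbig_seq; last exact: std_roots_uniq.
  rewrite sum3_at !(std_rootE uP) ?coroot_sum //.
  rewrite (weightD uP) fct_subE fct_addE -/(std_root P j k) (std_rootE uP) ?coroot_sum //.
  have : coroot R 0 2%:R j - coroot R 0 2%:R k = 1.
    by move: jk; rewrite !inE => /orP[]/eqP[-> ->]; rewrite /coroot /=; ring.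
  have : coroot R 0 2%:R 0 - coroot R 0 2%:R 1 = 1 by rewrite /coroot /=; ring.
  have : coroot R 0 2%:R 1 - coroot R 0 2%:R 2%:R = 1 by rewrite /coroot /=; ring.
  have : coroot R 0 2%:R 0 - coroot R 0 2%:R 2%:R = 2 by rewrite /coroot /=; ring.
  move=> -> -> -> ->; exact: aux.
have [p [q [mp mq chi]]] := char_formula rep' irr' v0 vm' mZ
  (no_higher 0 1 ^~ isT) (no_higher 1 2%:R ^~ isT).
exists p, q; split; [by rewrite -mp -coroot_dot | by rewrite -mq -coroot_dot |].
move=> t t0; have [s [d1 d2]] := minimal_pair (sin_dist_sym t).
exists s; have ts0 := sum_perm0 s t0.
(* Conjugation by a permutation matrix preserves the trace, so the angles may be reordered to put
   the closest pair first. *)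
have -> : character sigma (expM (cartan P t)) =
    \tr (conj_rep P sigma (cisdiag (fun k => t (s k)))).
  have SV : SU3 (perm3 R s^-1) by exact: SU3_perm3.
  have VS : perm3 R s^-1 *m perm3 R s = 1%:M.
    by rewrite -perm3_adj; exact: unitarymx_tCmul (SU3_unitary (SU3_perm3 R s)).
  rewrite -(perm3_cisdiag s t).
  rewrite (mxtrace_rep_conj rep' (SU3_perm3 R s) SV (cisdiag_SU3 t0) VS).
  by rewrite /character expE.
rewrite (chi _ ts0) normcM normc_cis mul1r.
exact: (weight_sum_bound (t := fun k => t (s k))).
Qed.

End CharacterBound.

Lemma sum_seq3 (V : zmodType) (u v w : V) :
  \sum_(x <- [:: u; v; w]) x = u + v + w.
Proof. by rewrite !big_cons big_nil addr0 addrA. Qed.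

Lemma prod_seq3 (K : Type) (V : pzRingType) (F : K -> V) (u v w : K) :
  \prod_(x <- [:: u; v; w]) F x = F u * (F v * F w).
Proof. by rewrite !big_cons big_nil mulr1. Qed.

Section WeylTerm.
Variables (R : realType) (P : 'M[R[i]]_3).
Hypothesis uP : P \is unitarymx.

Local Notation Phi := [set` [:: std_root P 0 1; std_root P 1 2%:R; std_root P 0 2%:R]].

(** The third positive root is the sum of the other two, so it equals rho. *)
Lemma half_sum_std : half_sum Phi = std_root P 0 2%:R.
Proof.
rewrite /half_sum -fsbig_seq; last exact: std_roots_uniq.
rewrite sum_seq3 (std_rootD uP); apply/funext => X.
rewrite -[LHS]/(2^-1 * (std_root P 0 2%:R X + std_root P 0 2%:R X)).
by move: (std_root P 0 2%:R X) => x; field.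
Qed.

Lemma std_prod (F : ('M[R[i]]_3 -> R) -> R) :
  \big[*%R/1]_(alpha \in Phi) F alpha =
  F (std_root P 0 1) * (F (std_root P 1 2%:R) * F (std_root P 0 2%:R)).
Proof.
rewrite -fsbig_seq; last exact: std_roots_uniq.
exact: prod_seq3.
Qed.

End WeylTerm.

Lemma min_inv_bound (R : realType) (c e x x' y : R) : 0 < e -> e <= c -> e <= 1 ->
  0 <= x -> x = x' -> 0 <= y -> e * min_inv x y <= min_inv (c * x') y.
Proof.
move=> e0 ec e1 x0 <- y0; apply: (@le_trans _ _ (min_inv (e * x) y)).
  by apply: min_inv_scale => //; rewrite e1 ltW.
by apply: min_inv_homo => //; exact: ler_wpM2r.
Qed.

Theorem theorem1p1 (R : realType)
    (T : set 'M[R[i]]_3) (maxT : maximal_torus T)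
    (Phi : set ('M[R[i]]_3 -> R)) (posPhi : positive_system T Phi)
    (ip : ('M[R[i]]_3 -> R) -> ('M[R[i]]_3 -> R) -> R)
    (ipW : weyl_inner_product T ip) :
  exists2 C : R, 0 < C &
    forall mu : 'M[R[i]]_3 -> R, dominant_weight T Phi ip mu ->
    forall (n : nat) (sigma : 'M[R[i]]_3 -> 'M[R[i]]_n),
      representation sigma -> irreducible sigma ->
      highest_weight T Phi sigma mu ->
    forall H : 'M[R[i]]_3, lie_algebra T H ->
      ComplexField.Normc.normc (character sigma (expM H)) <=
      C * \sum_(s \in weyl_group T)
            \big[*%R/1]_(alpha \in Phi)
              min_inv `|ip (s (mu + half_sum Phi)) alpha|
                      `|sin (alpha H / 2)|.
Proof.
have [P [uP TE PhiE]] := positive_system_std maxT posPhi.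
rewrite {}TE {}PhiE {T Phi maxT posPhi} in ipW *.
have [c c0 ipE] := ip_weight uP ipW.
(* The inner product scales the first argument of each of the three minima by c, and a factor can be
   pulled into a minimum only if it is at most 1: hence min(c, 1), and its cube below. *)
pose e := Num.min c 1.
have e0 : 0 < e by rewrite lt_min c0 ltr01.
have ec : e <= c by rewrite ge_min lexx.
have e1 : e <= 1 by rewrite ge_min lexx orbT.
exists (4 / e ^+ 3); first by rewrite divr_gt0 // exprn_gt0.
move=> mu [[Imu _] _] n sigma rep irr + H /(lie_algebra_cartan uP)[t t0 ->].
have [w ->] := idual_weight uP Imu => high.
have [p [q [wp wq bound]]] := character_bound uP rep irr high.
have [s bs] := bound t t0.
(* Coordinates of mu + rho; rho adds 1 to each simple difference, which gives p + 1 and q + 1. *)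
pose lam k := w k + coroot R 0 2%:R k.
have -> : weight P w + half_sum [set` [:: std_root P 0 1; std_root P 1 2%:R; std_root P 0 2%:R]] =
    weight P lam by rewrite (half_sum_std uP) -(weightD uP).
have l01 : lam 0 - lam 1 = p.+1%:R.
  by rewrite -(natr1 p) -wp /lam /coroot /=; ring.
have l12 : lam 1 - lam 2%:R = q.+1%:R.
  by rewrite -(natr1 q) -wq /lam /coroot /=; ring.
(* The Weyl group element r pairs the closest angles t (s 0), t (s 1) with the
   long side lam 0 - lam 2 = p + q + 2. *)
pose r := (s^-1 * tperm 1%R 2%:R)%g.
have rs k : r (s k) = tperm 1 2%:R k by rewrite permM permK.
have [f Wf fE] := weyl_perm uP r.
pose F j k := min_inv (c * `|lam (r j) - lam (r k)|) `|sin ((t j - t k) / 2)|.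
have Fsym j k : F j k = F k j.
  by rewrite /F distrC (sin_dist_sym t j k).
have min_pos (x y : R) : 0 <= min_inv `|x| `|y| by exact: min_inv_ge0.
pose term (g : ('M[R[i]]_3 -> R) -> 'M[R[i]]_3 -> R) :=
  \big[*%R/1]_(alpha \in [set` [:: std_root P 0 1; std_root P 1 2%:R; std_root P 0 2%:R]])
    min_inv `|ip (g (weight P lam)) alpha| `|sin (alpha (cartan P t) / 2)|.
(* A product over the positive roots is one over unordered pairs of indices, so it may be reordered
   by [s]. *)
have term_f : term f = F (s 0) (s 1) * (F (s 0) (s 2%:R) * F (s 1) (s 2%:R)).
  rewrite (prod_pairs_perm _ Fsym) /term std_prod // fE.
  by rewrite !ipE // !normrM !(gtr0_norm c0) !(std_rootE uP).
have term_ge0 g : 0 <= term g by rewrite /term std_prod // !mulr_ge0.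
rewrite -[leRHS]/(4 / e ^+ 3 * \sum_(g \in weyl_group (diag_torus P)) term g).
(* All terms are nonnegative, and only that of [f] is kept. *)
apply: (@le_trans _ _ (4 / e ^+ 3 * term f)); last first.
  rewrite ler_wpM2l ?divr_ge0 ?exprn_ge0 ?(ltW e0) //.
  rewrite (fsbigD1 f) //; last exact: finite_weyl_group.
  by rewrite lerDl; apply: fsumr_ge0.
apply: le_trans bs _.
rewrite term_f /F !rs tpermL tpermR tpermD //.
set M := (X in 4 * X <= _); set N := (X in _ <= _ * X).
suff : e ^+ 3 * M <= N.
  move=> h; rewrite -mulrA ler_pM2l // mulrC ler_pdivlMr ?exprn_gt0 // mulrC.
  exact: h.
rewrite /M /N.
have -> (a b d : R) : e ^+ 3 * (a * (b * d)) = (e * a) * ((e * b) * (e * d)) by ring.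
have lt02 : `|lam 0 - lam 2%:R| = (p.+1 + q.+1)%:R.
  have -> : lam 0 - lam 2%:R = (lam 0 - lam 1) + (lam 1 - lam 2%:R) by ring.
  by rewrite l01 l12 -natrD normr_nat.
have ge0 (a : R) k : 0 <= e * min_inv k%:R `|a| by rewrite mulr_ge0 ?min_inv_ge0 // ltW.
apply: ler_pM; [exact: ge0 | by apply: mulr_ge0; exact: ge0 | |].
  by apply: min_inv_bound => //; rewrite lt02.
apply: ler_pM; [exact: ge0 | exact: ge0 | |].
  by apply: min_inv_bound => //; rewrite l01 normr_nat.
by apply: min_inv_bound => //; rewrite distrC l12 normr_nat.
Qed.
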